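(* Let $(M,\omega)$ be a compact connected toric Kähler manifold of complex dimension $n$ with torus-invariant Kähler form $\omega$, let $\psi_\omega:\mathbb{R}^n\to\mathbb{R}$ be the function representing an $(S^1)^n$-invariant potential of $\omega$ on the open orbit, let $v_0,v_1$ be bounded $(S^1)^n$-invariant functions in $\mathrm{PSH}(M,\omega)$, and let $\psi_0,\psi_1$ be the convex functions on $\mathbb{R}^n$ given by $\psi_i(x)=\psi_\omega(x)+v_i(e^x)$, $i\in\{0,1\}$. Then the solution $\psi$ of the homogeneous real Monge--Ampère equation $$\mathrm{MA}\,\psi(s,x)=0\ \text{ on } [0,1]\times\mathbb{R}^n,\qquad \psi(i,x)=\psi_i(x),\quad i\in\{0,1\},$$ is given by $$\psi(s,x)=\sup_{\sigma\in\mathbb{R}}\big[\min\{\psi_0,\psi_1-\sigma\}^{\star\star}(x)+s\sigma\big],\qquad s\in[0,1],\ x\in\mathbb{R}^n.$$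
   Context: The open orbit of the complex torus $(\mathbb{C}^\star)^n$ is dense in $M$; for $z$ in it put $x=\mathrm{Re}\log z\in\mathbb{R}^n$. On the open orbit $\omega=\sqrt{-1}\,\partial\bar\partial\psi_\omega$ with $\psi_\omega$ $(S^1)^n$-invariant, so $\psi_\omega$ is regarded as a function of $x\in\mathbb{R}^n$; similarly an $(S^1)^n$-invariant function $v$ on $M$ gives the function $x\mapsto v(e^x)$ on $\mathbb{R}^n$. $\mathrm{PSH}(M,\omega)$ is the set of upper semi-continuous functions $u$ with $\omega+\sqrt{-1}\,\partial\bar\partial u\ge0$. $\mathrm{MA}$ is the real Monge--Ampère operator (in all the variables $(s,x)$), i.e. the unique continuous extension to convex functions of $f\mapsto d\frac{\partial f}{\partial x_1}\wedge\cdots\wedge d\frac{\partial f}{\partial x_m}$ ($m$ the number of variables) defined on $C^2$ functions. The solution is the convex function $\psi$ on $[0,1]\times\mathbb{R}^n$ attaining the boundary values continuously and corresponding to the bounded solution of the homogeneous complex Monge--Ampère equation on $([0,1]\times\mathbb{R})\times M$ with boundary data $v_0,v_1$, i.e. such that $\psi(s,x)-\psi_\omega(x)$ is bounded. For a function $f$ on $\mathbb{R}^n$, $f^\star(y)=\sup_{x\in\mathbb{R}^n}[\langle x,y\rangle-f(x)]$ is the Legendre transform, and $f^{\star\star}$ is its double Legendre transform, i.e. the largest convex function majorized by $f$ (here both transforms are in the $x$ variables). *)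

(* Defs.v *)
From HB Require Import structures.
From mathcomp Require Import all_boot all_order all_algebra.
From mathcomp Require Import all_classical all_reals all_analysis.
From mathcomp Require Import complex.

Set Implicit Arguments.
Unset Strict Implicit.
Unset Printing Implicit Defensive.

Import Order.TTheory GRing.Theory Num.Theory.
Import numFieldTopology.Exports numFieldNormedType.Exports.

Local Open Scope classical_set_scope.
Local Open Scope ring_scope.

(** * Real calculus on R^m *)

Definition partial (R : realType) (m : nat) (i : 'I_m)
    (f : 'rV[R]_m -> R) (x : 'rV[R]_m) : R :=
  'D_(delta_mx 0 i) f x.

(* C^k on the open set [E]. *)
Fixpoint Ck (R : realType) (m k : nat) (E : set 'rV[R]_m)
    (f : 'rV[R]_m -> R) : Prop :=
  (forall x, E x -> {for x, continuous f}) /\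
  (if k is k'.+1 then
     forall i : 'I_m,
       (forall x, E x -> derivable f x (delta_mx 0 i)) /\
       Ck k' E (partial i f)
   else True).

Definition hessian (R : realType) (m : nat) (f : 'rV[R]_m -> R)
    (x : 'rV[R]_m) : 'M[R]_m :=
  \matrix_(i, j) partial i (partial j f) x.

Definition dotv (R : realType) (m : nat) (x y : 'rV[R]_m) : R :=
  \sum_i x 0 i * y 0 i.

(* Lebesgue integral over R^m as an iterated integral; it is only applied to
   continuous compactly supported functions. *)
Fixpoint integralRn (R : realType) (m : nat) : ('rV[R]_m -> R) -> R :=
  match m return ('rV[R]_m -> R) -> R with
  | 0 => fun f => f 0
  | m'.+1 => fun f =>
      \int[@lebesgue_measure R]_(t in setT)
        integralRn (fun x : 'rV[R]_m' =>
          f (row_mx (t%:M : 'rV[R]_1) x : 'rV[R]_(1 + m')))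
  end.

(** * The real Monge-Ampere operator *)

Definition test_function (R : realType) (m : nat) (Om : set 'rV[R]_m)
    (chi : 'rV[R]_m -> R) : Prop :=
  continuous chi /\
  exists K : set 'rV[R]_m,
    [/\ compact K, K `<=` Om & forall x, ~ K x -> chi x = 0].

(* d(df/dx_1) /\ ... /\ d(df/dx_m) = det(D^2 f) dx for f of class C^2, seen as
   a Radon measure, i.e. as a functional on test functions. *)
Definition MA_C2 (R : realType) (m : nat) (f : 'rV[R]_m -> R)
    (chi : 'rV[R]_m -> R) : R :=
  integralRn (fun x => chi x * \det (hessian f x)).

(* [is_MA Om f mu]: the Radon measure [mu] on the convex open set [Om] is the
   value at the convex function [f] of the continuous extension of [MA_C2]
   from C^2 convex functions to convex functions, for locally uniform
   convergence of functions and weak convergence of measures. *)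
Definition is_MA (R : realType) (m : nat) (Om : set 'rV[R]_m)
    (f : 'rV[R]_m -> R) (mu : ('rV[R]_m -> R) -> R) : Prop :=
  forall g : nat -> 'rV[R]_m -> R,
    (forall k, Ck 2 Om (g k) /\ convex_function Om (g k)) ->
    (forall K, compact K -> K `<=` Om -> {uniform K, g @ \oo --> f}) ->
    forall chi, test_function Om chi ->
      (fun k => MA_C2 (g k) chi) @ \oo --> mu chi.

(** * The Legendre transform *)

Definition legendre (R : realType) (n : nat) (f : 'rV[R]_n -> \bar R)
    (y : 'rV[R]_n) : \bar R :=
  ereal_sup [set ((dotv x y)%:E - f x)%E | x in setT].

(** * The Dirichlet problem on [0,1] x R^n *)

(* Functions of (s, x) as functions on R^(1+n), [s] being the first
   coordinate. *)
Definition joint (R : realType) (n : nat) (psi : R -> 'rV[R]_n -> R)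
    (z : 'rV[R]_(1 + n)) : R :=
  psi (lsubmx z 0 0) (rsubmx z).

Definition strip (R : realType) (n : nat) : set 'rV[R]_(1 + n) :=
  [set z | 0 <= lsubmx z 0 0 <= 1].

Definition open_strip (R : realType) (n : nat) : set 'rV[R]_(1 + n) :=
  [set z | 0 < lsubmx z 0 0 < 1].

Record HRMA_solution (R : realType) (n : nat) (psiw psi0 psi1 : 'rV[R]_n -> R)
    (psi : R -> 'rV[R]_n -> R) : Prop := {
  HRMA_convex : convex_function (@strip R n) (joint psi) ;
  HRMA_MA : is_MA (@open_strip R n) (joint psi) (fun=> 0) ;
  HRMA_bound0 : forall x, psi 0 x = psi0 x ;
  HRMA_bound1 : forall x, psi 1 x = psi1 x ;
  HRMA_cont0 : forall x,
    joint psi z @[z --> within (@strip R n)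
                         (nbhs (row_mx (0 : R)%:M x : 'rV[R]_(1 + n)))]
      --> psi0 x ;
  HRMA_cont1 : forall x,
    joint psi z @[z --> within (@strip R n)
                         (nbhs (row_mx (1 : R)%:M x : 'rV[R]_(1 + n)))]
      --> psi1 x ;
  HRMA_bounded : exists B : R, forall s x, 0 <= s <= 1 ->
    `|psi s x - psiw x| <= B
}.

(** * Complex calculus on C^n *)

(* [R[i]] packed as a [numClosedFieldType], so that it inherits the topology
   and the normed module structure over itself. *)
Definition Cpx (R : realType) : numClosedFieldType := R[i].

Definition reC (R : realType) (z : Cpx R) : R := complex.Re z.
Definition imC (R : realType) (z : Cpx R) : R := complex.Im z.
Definition mkC (R : realType) (x y : R) : Cpx R := complex.Complex x y.

(* C^n is identified with R^(n+n) by z = x + iy |-> (x, y). *)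
Definition toC (R : realType) (n : nat) (t : 'rV[R]_(n + n)) : 'rV[Cpx R]_n :=
  \row_j mkC (t 0 (lshift n j)) (t 0 (rshift n j)).
Definition ofC (R : realType) (n : nat) (z : 'rV[Cpx R]_n) : 'rV[R]_(n + n) :=
  row_mx (\row_j reC (z 0 j)) (\row_j imC (z 0 j)).

Definition smooth (R : realType) (n : nat) (E : set 'rV[Cpx R]_n)
    (f : 'rV[Cpx R]_n -> R) : Prop :=
  forall k, Ck k (@toC R n @^-1` E) (f \o @toC R n).

Definition smoothC (R : realType) (n : nat) (E : set 'rV[Cpx R]_n)
    (f : 'rV[Cpx R]_n -> Cpx R) : Prop :=
  smooth E (@reC R \o f) /\ smooth E (@imC R \o f).

Definition partialC (R : realType) (n : nat) (k : 'I_(n + n))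
    (f : 'rV[Cpx R]_n -> Cpx R) (z : 'rV[Cpx R]_n) : Cpx R :=
  mkC (partial k (@reC R \o f \o @toC R n) (ofC z))
      (partial k (@imC R \o f \o @toC R n) (ofC z)).

Definition dz (R : realType) (n : nat) (j : 'I_n)
    (f : 'rV[Cpx R]_n -> Cpx R) (z : 'rV[Cpx R]_n) : Cpx R :=
  (partialC (lshift n j) f z - 'i * partialC (rshift n j) f z) / 2.
Definition dzbar (R : realType) (n : nat) (j : 'I_n)
    (f : 'rV[Cpx R]_n -> Cpx R) (z : 'rV[Cpx R]_n) : Cpx R :=
  (partialC (lshift n j) f z + 'i * partialC (rshift n j) f z) / 2.

(* The coefficients of i d dbar phi in the frame i dz_j /\ dzbar_k. *)
Definition levi (R : realType) (n : nat) (phi : 'rV[Cpx R]_n -> R)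
    (z : 'rV[Cpx R]_n) : 'M[Cpx R]_n :=
  \matrix_(j, k) dz j (dzbar k (fun w => mkC (phi w) 0)) z.

Definition conjmx (R : realType) (m n : nat) (A : 'M[Cpx R]_(m, n)) :
  'M[Cpx R]_(n, m) := (map_mx Num.conj A)^T.

(* The pullback by the holomorphic map [tau] of the (1,1)-form
   i sum_jk h_jk dw_j /\ dwbar_k. *)
Definition pullback (R : realType) (n : nat) (tau : 'rV[Cpx R]_n -> 'rV[Cpx R]_n)
    (h : 'rV[Cpx R]_n -> 'M[Cpx R]_n) (z : 'rV[Cpx R]_n) : 'M[Cpx R]_n :=
  jacobian tau z *m h (tau z) *m conjmx (jacobian tau z).

Definition holomorphic (R : realType) (n : nat) (E : set 'rV[Cpx R]_n)
    (f : 'rV[Cpx R]_n -> 'rV[Cpx R]_n) : Prop :=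
  forall z, E z -> differentiable f z.

Definition usc_at (R : realType) (T : topologicalType) (u : T -> \bar R)
    (p : T) : Prop :=
  forall a : R, (u p < a%:E)%E -> \forall q \near p, (u q < a%:E)%E.

(* Plurisubharmonicity on an open set: upper semi-continuity, values in
   [-oo, +oo[ and the sub-mean value inequality on complex discs. *)
Definition psh (R : realType) (n : nat) (E : set 'rV[Cpx R]_n)
    (u : 'rV[Cpx R]_n -> \bar R) : Prop :=
  [/\ forall z, E z -> (u z < +oo)%E,
      forall z, E z -> usc_at u z &
      forall z v : 'rV[Cpx R]_n,
        (forall l : Cpx R, `|l| <= 1 -> E (z + l *: v)) ->
        (u z <= ((2 * pi)^-1)%:E *
          \int[@lebesgue_measure R]_(t in `[0%R, (2 * pi)%R])
            u (z + mkC (cos t) (sin t) *: v)%R)%E].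

(** * Complex manifolds *)

(* [cmap] and [cinv] are only meaningful on [cdom] and [crange]. *)
Record chart (R : realType) (n : nat) (M : topologicalType) := Chart {
  cdom : set M ;
  crange : set 'rV[Cpx R]_n ;
  cmap : M -> 'rV[Cpx R]_n ;
  cinv : 'rV[Cpx R]_n -> M ;
  cdom_open : open cdom ;
  crange_open : open crange ;
  cmapK : forall p, cdom p -> crange (cmap p) /\ cinv (cmap p) = p ;
  cinvK : forall z, crange z -> cdom (cinv z) /\ cmap (cinv z) = z ;
  cmap_continuous : forall p, cdom p -> {for p, continuous cmap} ;
  cinv_continuous : forall z, crange z -> {for z, continuous cinv} }.

Definition overlap (R : realType) (n : nat) (M : topologicalType)
    (c d : chart R n M) : set 'rV[Cpx R]_n :=
  [set z | crange c z /\ cdom d (cinv c z)].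

Definition transition (R : realType) (n : nat) (M : topologicalType)
    (c d : chart R n M) : 'rV[Cpx R]_n -> 'rV[Cpx R]_n :=
  cmap d \o cinv c.

Definition compatible (R : realType) (n : nat) (M : topologicalType)
    (c d : chart R n M) : Prop :=
  holomorphic (overlap c d) (transition c d) /\
  holomorphic (overlap d c) (transition d c).

(* A holomorphic structure, given by its maximal atlas. *)
Record complex_structure (R : realType) (n : nat) (M : topologicalType) :=
  ComplexStructure {
    atlas : set (chart R n M) ;
    atlas_cover : forall p : M, exists2 c, atlas c & cdom c p ;
    atlas_compatible : forall c d, atlas c -> atlas d -> compatible c d ;
    atlas_maximal : forall c,
      (forall d, atlas d -> compatible c d) -> atlas c }.

(* A (1,1)-form i sum_jk h_jk dz_j /\ dzbar_k is given by the matrix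
   (h_jk) of its coefficients in each chart. *)
Definition form11 (R : realType) (n : nat) (M : topologicalType) :=
  chart R n M -> 'rV[Cpx R]_n -> 'M[Cpx R]_n.

(* For a Hermitian matrix (h_jk), closedness amounts to
   d h_jk / d z_l = d h_lk / d z_j. *)
Record kahler_form (R : realType) (n : nat) (M : topologicalType)
    (X : complex_structure R n M) (om : form11 R n M) : Prop := {
  kf_compatible : forall c d, atlas X c -> atlas X d ->
    forall z, overlap c d z -> om c z = pullback (transition c d) (om d) z ;
  kf_smooth : forall c, atlas X c ->
    forall j k, smoothC (crange c) (fun z => om c z j k) ;
  kf_hermitian : forall c, atlas X c ->
    forall z, crange c z -> conjmx (om c z) = om c z ;
  kf_positive : forall c, atlas X c ->
    forall z, crange c z ->
    forall v : 'rV[Cpx R]_n, v != 0 -> 0 < (v *m om c z *m conjmx v) 0 0 ;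
  kf_closed : forall c, atlas X c ->
    forall z, crange c z ->
    forall j k l, dz l (fun w => om c w j k) z = dz j (fun w => om c w l k) z }.

(* om = i d dbar phi on the open set [E], read in the chart [c]. *)
Definition is_potential (R : realType) (n : nat) (M : topologicalType)
    (om : form11 R n M) (c : chart R n M) (E : set 'rV[Cpx R]_n)
    (phi : 'rV[Cpx R]_n -> R) : Prop :=
  [/\ open E, E `<=` crange c, smooth E phi &
      forall z, E z -> levi phi z = om c z].

(* om + i d dbar u >= 0 means that phi + u is plurisubharmonic for each local
   potential phi of om. *)
Definition PSH (R : realType) (n : nat) (M : topologicalType)
    (X : complex_structure R n M) (om : form11 R n M) : set (M -> \bar R) :=
  [set u | [/\ forall p, (u p < +oo)%E,
               forall p, usc_at u p &
               forall c E phi, atlas X c -> is_potential om c E phi ->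
                 psh E (fun z => ((phi z)%:E + u (cinv c z))%E)]].

(** * Toric manifolds *)

Definition torus (R : realType) (n : nat) : set 'rV[Cpx R]_n :=
  [set z | forall j, z 0 j != 0].

Definition compact_torus (R : realType) (n : nat) : set 'rV[Cpx R]_n :=
  [set z | forall j, `|z 0 j| = 1].

Definition tmul (R : realType) (n : nat) (z w : 'rV[Cpx R]_n) : 'rV[Cpx R]_n :=
  \row_j (z 0 j * w 0 j).

(* A holomorphic action of the complex torus with a dense open orbit
   identified with the torus itself: [open_orbit] is the holomorphic chart
   sending a point of the open orbit to the corresponding element of the torus,
   and [cinv open_orbit z] is the point of [M] denoted by [z]. *)
Record toric_structure (R : realType) (n : nat) (M : topologicalType)
    (X : complex_structure R n M) := ToricStructure {
  torus_act : 'rV[Cpx R]_n -> M -> M ;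
  open_orbit : chart R n M ;
  act1 : forall p, torus_act (const_mx 1) p = p ;
  actM : forall z w p, @torus R n z -> @torus R n w ->
    torus_act (tmul z w) p = torus_act z (torus_act w p) ;
  act_continuous : forall z p, @torus R n z ->
    {for (z, p), continuous (fun zp : 'rV[Cpx R]_n * M => torus_act zp.1 zp.2)} ;
  act_holomorphic : forall c d, atlas X c -> atlas X d ->
    forall z w, @torus R n z -> crange c w -> cdom d (torus_act z (cinv c w)) ->
    differentiable
      (fun zw : 'rV[Cpx R]_n * 'rV[Cpx R]_n =>
         cmap d (torus_act zw.1 (cinv c zw.2))) (z, w) ;
  orbit_atlas : atlas X open_orbit ;
  orbit_range : crange open_orbit = @torus R n ;
  orbit_dense : dense (cdom open_orbit) ;
  act_orbit : forall z w, @torus R n z -> @torus R n w ->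
    torus_act z (cinv open_orbit w) = cinv open_orbit (tmul z w) }.

Definition invariant_fun (R : realType) (n : nat) (M : topologicalType)
    (X : complex_structure R n M) (T : toric_structure X) (v : M -> R) : Prop :=
  forall z p, @compact_torus R n z -> v (torus_act T z p) = v p.

Definition invariant_form (R : realType) (n : nat) (M : topologicalType)
    (X : complex_structure R n M) (T : toric_structure X)
    (om : form11 R n M) : Prop :=
  forall t c d, @compact_torus R n t -> atlas X c -> atlas X d ->
  forall z, crange c z -> cdom d (torus_act T t (cinv c z)) ->
    om c z = pullback (fun w => cmap d (torus_act T t (cinv c w))) (om d) z.

(* Re log z, i.e. (log|z_1|, ..., log|z_n|); the norm of a complex number is
   here a (real) complex number. *)
Definition Relog (R : realType) (n : nat) (z : 'rV[Cpx R]_n) : 'rV[R]_n :=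
  \row_j ln (reC `|z 0 j|).

Definition expC (R : realType) (n : nat) (x : 'rV[R]_n) : 'rV[Cpx R]_n :=
  \row_j mkC (expR (x 0 j)) 0.

(* The function psi_om + v in the logarithmic coordinates of the open orbit. *)
Definition log_potential (R : realType) (n : nat) (M : topologicalType)
    (X : complex_structure R n M) (T : toric_structure X)
    (psiw : 'rV[R]_n -> R) (v : M -> R) (x : 'rV[R]_n) : R :=
  psiw x + v (cinv (open_orbit T) (expC x)).

(* Main.v *)
Require Import Defs.
From HB Require Import structures.
From mathcomp Require Import all_boot all_order all_algebra.
From mathcomp Require Import all_classical all_reals all_analysis.
From mathcomp Require Import complex ring lra.

Set Implicit Arguments.
Unset Strict Implicit.
Unset Printing Implicit Defensive.

Import Order.TTheory GRing.Theory Num.Theory.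
Import numFieldTopology.Exports numFieldNormedType.Exports.

Local Open Scope classical_set_scope.
Local Open Scope ring_scope.

(** Write psi_0, psi_1 for the boundary data and call (y, a, b) admissible when
    <x,y> - a <= psi_0(x) and <x,y> - b <= psi_1(x) for all x. The affine function
    ell(s,x) = <x,y> - (1-s) a - s b then lies below the data at s = 0 and s = 1.
    Since a Legendre transform of min(psi_0, psi_1 - sigma) at y is at most a
    exactly when (y, a, a - sigma) is admissible, the right-hand side of the
    formula is the supremum of the functions ell over the admissible triples
    ([envelope_legendre]). The theorem says that this envelope is the unique
    solution of the Dirichlet problem.

    What is used of the geometry. A plurisubharmonic function that depends on
    Re log z only is convex in x = Re log z: along the image of a small complex
    disc, x moves by r w cos t - r^2 w^2 cos(2t) / 2 + O(r^3), whose average is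
    O(r^3) while its square averages to r^2 w^2 / 2, and the sub-mean value
    inequality then forbids a strictly concave quadratic bound from above at a
    maximum ([submean_cvx], [log_potential_cvx]). So psi_0 and psi_1 are convex,
    and they are at bounded distance from the smooth function psi_om. Positivity
    of the Kahler form, expressed through second derivatives along the curves
    s |-> e^(m + s w) and t |-> e^(m + i t w), makes psi_om strictly convex, hence
    bounded below by an affine function plus c |x| ([strict_support],
    [psiw_coercive]).

    Both halves rest on a description of the Monge-Ampere measure of a convex
    function g of class C^2 in the strip. With P the gradient of
    g + kappa |x|^2 / 2 and H its derivative, the slice map x |-> P_x(s,x) is
    strongly monotone, so that it has an inverse X(s,.), and changing variables
    in each slice gives
      integral of chi det H
        = integral over y of integral over s of chi(s, X(s,y)) tau_y'(s)
    where tau_y(s) = P_s(s, X(s,y)) is nondecreasing ([change_of_variables],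
    [strip_formula]). The mass of the Monge-Ampere measure is thus the variation
    of the s-component of the gradient at a fixed x-component y. The term
    kappa |x|^2 / 2 is removed by letting kappa tend to 0 ([MA_limit]).

    The envelope is a solution. Suppose that two interior points carry
    subgradients with the same x-component y. Each subgradient is the gradient of
    an ell that touches the envelope at its point; taking the minimum of the two
    values of a and of the two values of b gives an admissible triple whose ell is
    at least as large as both, so that the two triples agree and so do the
    s-components: the envelope is rigid ([env_rigid]). For a sequence of convex
    C^2 functions converging to a rigid function, limits of gradients being
    subgradients, the variation of tau_y on compact sets tends to 0 uniformly in
    y, and the Monge-Ampere integrals tend to 0 ([close_grad], [rigid_is_MA]).

    A solution is the envelope. Every interior subgradient of a solution is the
    gradient of an admissible ell touching it, hence a solution is at most the
    envelope. Conversely suppose that a solution psi dips below an admissible ell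
    somewhere; mixing ell with the coercive affine minorant of psi_om, its linear
    part y0 may be assumed coercive. Mollify psi into convex C^2 functions g. For
    every y near y0 the minimizers X(s,y) stay in a fixed ball, and the dip forces
    tau_y to increase by a fixed amount between a slice near s = 0 and a slice
    near s = 1. By the integral formula the Monge-Ampere integrals of the g have a
    positive lower bound, contradicting MA psi = 0 ([slope_gap], [MA_lower],
    [no_dip]). *)

(** * Continuity, derivatives and the coordinates (s, x) *)

Section basics.
Context {R : realType}.

Lemma cont_epsP (V W : normedModType R) (f : V -> W) (x : V) :
  {for x, continuous f} <->
  (forall e, 0 < e -> exists2 d, 0 < d & forall y, `|y - x| < d -> `|f y - f x| < e).
Proof.
split=> [fx e e0|H].
  move/cvgrPdist_lt : fx => /(_ e e0) /nbhs_ballP[d /= d0 Hd].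
  exists d => // y yx; rewrite distrC; apply: Hd.
  by rewrite -ball_normE /= distrC.
apply/cvgrPdist_lt => e e0; have [d d0 Hd] := H e e0.
apply/nbhs_ballP; exists d => //= y; rewrite -ball_normE /= => yx.
by rewrite distrC; apply: Hd; rewrite distrC.
Qed.

Lemma nbhs_norm_lt (V : normedModType R) (x : V) e : 0 < e -> nbhs x [set y | `|y - x| < e].
Proof. by move=> e0; apply/nbhs_ballP; exists e => //= y; rewrite -ball_normE /= distrC. Qed.

Section ct.
Context {V : normedModType R}.
Implicit Types (x : V).

Lemma ct_cst (W : normedModType R) x (a : W) : continuous_at x (fun _ : V => a).
Proof. exact: cvg_cst. Qed.
Lemma ct_eq (W : normedModType R) (f g : V -> W) x :
  (forall y, f y = g y) -> continuous_at x g -> continuous_at x f.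
Proof. by move=> /funext ->. Qed.
Lemma ctD (f g : V -> R) x : continuous_at x f -> continuous_at x g ->
  continuous_at x (fun y => f y + g y).
Proof. exact: cvgD. Qed.
Lemma ctM (f g : V -> R) x : continuous_at x f -> continuous_at x g ->
  continuous_at x (fun y => f y * g y).
Proof. exact: cvgM. Qed.
Lemma ctN (f : V -> R) x : continuous_at x f -> continuous_at x (fun y => - f y).
Proof. exact: cvgN. Qed.
Lemma ctB (f g : V -> R) x : continuous_at x f -> continuous_at x g ->
  continuous_at x (fun y => f y - g y).
Proof. by move=> cf cg; apply: ctD => //; apply: ctN. Qed.
Lemma ctV (f : V -> R) x : f x != 0 -> continuous_at x f ->
  continuous_at x (fun y => (f y)^-1).
Proof. by move=> f0 cf; apply: cvgV. Qed.
Lemma ct_comp (W U : normedModType R) (f : V -> W) (g : W -> U) x :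
  continuous_at x f -> continuous_at (f x) g -> continuous_at x (fun y => g (f y)).
Proof. by move=> cf cg; apply: (@continuous_comp _ _ _ f g x). Qed.
Lemma ct_norm (W : normedModType R) (f : V -> W) x :
  continuous_at x f -> continuous_at x (fun y => `|f y|).
Proof. by move=> cf; apply: cvg_norm. Qed.
Lemma ct_sum I (r : seq I) (P : pred I) (f : I -> V -> R) x :
  (forall i, continuous_at x (f i)) -> continuous_at x (fun y => \sum_(i <- r | P i) f i y).
Proof.
move=> cf; elim: r => [|i r IH].
  by under eq_fun do rewrite big_nil; exact: ct_cst.
under eq_fun do rewrite big_cons; case: (P i) => //; exact: ctD.
Qed.
Lemma ct_prod I (r : seq I) (P : pred I) (f : I -> V -> R) x :
  (forall i, continuous_at x (f i)) -> continuous_at x (fun y => \prod_(i <- r | P i) f i y).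
Proof.
move=> cf; elim: r => [|i r IH].
  by under eq_fun do rewrite big_nil; exact: ct_cst.
under eq_fun do rewrite big_cons; case: (P i) => //; exact: ctM.
Qed.

End ct.

Section pt.
Context {n : nat}.
Implicit Types (t : R) (x : 'rV[R]_n) (z : 'rV[R]_(1 + n)).

(** A point (s, x) of R^(1+n), with its coordinates [hd] and [tl]. *)
Definition pt t x : 'rV[R]_(1 + n) := row_mx (t%:M : 'rV_1) x.
Definition hd z : R := lsubmx z 0 0.
Definition tl z : 'rV[R]_n := rsubmx z.

Lemma hd_pt t x : hd (pt t x) = t.
Proof. by rewrite /hd /pt row_mxKl mxE eqxx mulr1n. Qed.

Lemma tl_pt t x : tl (pt t x) = x.
Proof. by rewrite /tl /pt row_mxKr. Qed.

Lemma pt_hd_tl z : pt (hd z) (tl z) = z.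
Proof.
rewrite /pt /hd /tl -[RHS]hsubmxK; congr row_mx.
by rewrite [RHS]mx11_scalar.
Qed.

Lemma hdD z w : hd (z + w) = hd z + hd w. Proof. by rewrite /hd !mxE. Qed.
Lemma hdB z w : hd (z - w) = hd z - hd w. Proof. by rewrite /hd !mxE. Qed.
Lemma hdZ a z : hd (a *: z) = a * hd z. Proof. by rewrite /hd !mxE. Qed.
Lemma tlD z w : tl (z + w) = tl z + tl w.
Proof. by apply/rowP => i; rewrite /tl !mxE. Qed.
Lemma tlB z w : tl (z - w) = tl z - tl w.
Proof. by apply/rowP => i; rewrite /tl !mxE. Qed.
Lemma tlZ a z : tl (a *: z) = a *: tl z.
Proof. by apply/rowP => i; rewrite /tl !mxE. Qed.

Lemma ptP z w : hd z = hd w -> tl z = tl w -> z = w.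
Proof. by move=> h t; rewrite -(pt_hd_tl z) -(pt_hd_tl w) h t. Qed.

Lemma ptD t x t' x' : pt t x + pt t' x' = pt (t + t') (x + x').
Proof. by apply: ptP; rewrite ?hdD ?tlD ?hd_pt ?tl_pt. Qed.
Lemma ptB t x t' x' : pt t x - pt t' x' = pt (t - t') (x - x').
Proof. by apply: ptP; rewrite ?hdB ?tlB ?hd_pt ?tl_pt. Qed.
Lemma ptZ a t x : a *: pt t x = pt (a * t) (a *: x).
Proof. by apply: ptP; rewrite ?hdZ ?tlZ ?hd_pt ?tl_pt. Qed.

End pt.

Section rownorm.
Context {n : nat}.
Implicit Types (x y : 'rV[R]_n).

Lemma row_norm_le x (a : R) : 0 <= a ->
  (forall i, `|x 0 i| <= a) <-> `|x| <= a.
Proof.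
move=> a0; split => [H|H i].
  rewrite -[`|x|]/(mx_norm x) mx_normrE; apply/bigmax_leP; split => // -[i j] _ /=.
  by rewrite ord1.
apply: le_trans H; rewrite -[`|x|]/(mx_norm x) mx_normrE.
by apply: (@le_bigmax _ _ _ 0 (fun ij => `|x ij.1 ij.2|) (0,i)).
Qed.

Lemma coord_le x i : `|x 0 i| <= `|x|.
Proof. by apply (row_norm_le _ (normr_ge0 x)). Qed.

Lemma row_norm_lt x (a : R) : 0 < a -> (forall i, `|x 0 i| < a) -> `|x| < a.
Proof.
move=> a0 H; rewrite -[`|x|]/(mx_norm x) mx_normrE; apply/bigmax_ltP; split => // -[i j] _ /=.
by rewrite ord1.
Qed.

End rownorm.

Lemma hd_le n (z : 'rV[R]_(1 + n)) : `|hd z| <= `|z|.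
Proof. by rewrite /hd mxE; exact: coord_le. Qed.

Lemma tl_le n (z : 'rV[R]_(1 + n)) : `|tl z| <= `|z|.
Proof. by apply/row_norm_le => // i; rewrite /tl mxE; exact: coord_le. Qed.

Lemma pt_norm_le n t (x : 'rV[R]_n) a : `|t| <= a -> `|x| <= a -> `|pt t x| <= a.
Proof.
move=> ta xa; have a0 : 0 <= a by exact: le_trans ta.
apply/row_norm_le => // i; rewrite /pt mxE.
by case: splitP => j _; [rewrite ord1 mxE eqxx mulr1n|apply: (row_norm_le _ a0).2].
Qed.

Lemma pt_norm_lt n t (x : 'rV[R]_n) a : `|t| < a -> `|x| < a -> `|pt t x| < a.
Proof.
move=> ta xa; have a0 : 0 < a by exact: le_lt_trans ta.
apply: row_norm_lt => // i; rewrite /pt mxE.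
case: splitP => j _; first by rewrite ord1 mxE eqxx mulr1n.
by apply: le_lt_trans xa; exact: coord_le.
Qed.

Lemma pt_normE n t (x : 'rV[R]_n) : `|pt t x| = Num.max `|t| `|x|.
Proof.
apply/eqP; rewrite eq_le; apply/andP; split.
  by apply: pt_norm_le; rewrite le_max lexx ?orbT.
by rewrite ge_max -{1}(hd_pt t x) hd_le -{1}(tl_pt t x) tl_le.
Qed.

Lemma ball_compact n (x : 'rV[R]_n) (N : R) : compact [set y | `|y - x| <= N].
Proof.
apply: bounded_closed_compact.
  exists (`|x| + N); split; first by rewrite num_real.
  move=> M NM y /= yN; apply: ltW; apply: le_lt_trans NM.
  by rewrite -[y](subrK x) addrC (le_trans (ler_normD _ _)) ?lerD2l.
have -> : [set y | `|y - x| <= N] = (fun y => `|y - x|) @^-1` [set r | r <= N] by [].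
apply: closed_comp; last exact: closed_le.
move=> y _; apply/cont_epsP => e e0; exists e => // z zy.
apply: le_lt_trans zy; rewrite (_ : z - y = (z - x) - (y - x)) ?ler_dist_dist//.
by rewrite opprB addrA subrK.
Qed.

Lemma ball0_compact n (N : R) : compact [set y : 'rV[R]_n | `|y| <= N].
Proof.
rewrite (_ : [set _ | _] = [set y | `|y - 0| <= N]); first exact: ball_compact.
by apply/seteqP; split => y /=; rewrite subr0.
Qed.

(** Compactness turns continuity of [f] at the points of [{t0} x K] into continuity
    in [t] at [t0] uniformly on [K]; this is how slices, limits in a parameter and
    moduli of continuity are handled below. *)
Lemma unif_slice (V W : normedModType R) (f : V -> W -> R) (t0 : V)
    (K : set W) : compact K ->
  (forall x, K x -> forall e, 0 < e -> exists2 d, 0 < d & forall t y,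
     `|t - t0| < d -> `|y - x| < d -> `|f t y - f t0 x| < e) ->
  forall e, 0 < e -> exists2 d, 0 < d & forall t, `|t - t0| < d ->
    forall x, K x -> `|f t x - f t0 x| < e.
Proof.
move=> cK H e e0; move/compact_near_coveringP : (cK) => nc.
have /nbhs_ballP[d /= d0 Hd] :
    \forall t \near t0, K `<=` (fun x => `|f t x - f t0 x| < e).
  apply: nc => x Kx; have [d d0 Hd] := H x Kx (e/2) (divr_gt0 e0 (ltr0n _ 2)).
  exists ([set y | `|y - x| < d], [set t | `|t - t0| < d]).
    split => /=; apply/nbhs_ballP; exists d => //= u; rewrite -ball_normE /= distrC//.
  move=> [y t] /= [yx tt].
  have h1 := Hd t y tt yx; have h2 := Hd t0 y.
  rewrite subrr normr0 in h2; have {}h2 := h2 d0 yx.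
  rewrite [e]splitr (_ : _ - _ = (f t y - f t0 x) - (f t0 y - f t0 x)); last lra.
  exact: le_lt_trans (ler_normB _ _) (ltrD h1 h2).
exists d => // t tt x Kx.
by apply: (Hd t) => //; rewrite -ball_normE /= distrC.
Qed.

Lemma is_derive_vepsP (V : normedModType R) (g : V -> R) (x v : V) (l : R) :
  is_derive x v g l <->
  (forall e, 0 < e -> exists2 d, 0 < d &
     forall h, `|h| < d -> `|g (x + h *: v) - g x - h * l| <= e * `|h|).
Proof.
split=> [[dg gl] e e0|H].
  move: dg; rewrite /derivable => /cvg_ex[l'] /[dup] Hl' /cvg_lim El'.
  have {El'} El' : l' = l by rewrite -gl -El'.
  move: Hl'; rewrite {}El' => /cvgrPdist_lt /(_ e e0) /nbhs_ballP[d /= d0 Hd].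
  exists d => // h hd; have [->|h0] := eqVneq h 0.
    by rewrite scale0r addr0 subrr mul0r subrr normr0 mulr0.
  have Bh : ball (0 : R) d h by rewrite -ball_normE /= sub0r normrN.
  have /ltW := Hd _ Bh h0; rewrite /GRing.scale/= -(ler_pM2r (_ : 0 < `|h|)) ?normr_gt0//.
  rewrite -normrM mulrBl mulrAC mulVf//.
  by rewrite mul1r distrC [_ + x]addrC [l * h]mulrC.
have cv : h^-1 *: (g (h *: v + x) - g x) @[h --> 0^'] --> l.
  apply/cvgrPdist_le => e e0; have [d d0 Hd] := H e e0.
  apply/nbhs_ballP; exists d => //= h; rewrite -ball_normE /= sub0r normrN => hd h0.
  rewrite /GRing.scale/= -(ler_pM2r (_ : 0 < `|h|)) ?normr_gt0// -normrM mulrBl mulrAC mulVf//.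
  by rewrite mul1r distrC [_ + x]addrC [l * h]mulrC Hd.
apply: DeriveDef; first by apply/cvg_ex; exists l.
by rewrite /derive; apply: cvg_lim.
Qed.

(** Epsilon form of differentiability: the remainder is compared with |h|, so that
    no quotient has to be formed when derivatives are computed by hand. *)
Lemma is_derive_epsP (g : R -> R) (t l : R) :
  is_derive t 1 g l <->
  (forall e, 0 < e -> exists2 d, 0 < d &
     forall h, `|h| < d -> `|g (t + h) - g t - h * l| <= e * `|h|).
Proof.
split=> [/is_derive_vepsP H e e0|H].
  have [d d0 Hd] := H e e0; exists d => // h /Hd.
  by rewrite /GRing.scale/= mulr1.
apply/is_derive_vepsP => e e0; have [d d0 Hd] := H e e0; exists d => // h /Hd.
by rewrite /GRing.scale/= mulr1.
Qed.

End basics.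

(** * Integrals of continuous functions on the line *)

Section int1.
Context {R : realType}.
Notation mu := (@lebesgue_measure R).
Implicit Types (f g : R -> R) (a b c : R).

(** Integrals over a segment and over the line are real-valued; they are applied to
    continuous functions, of compact support in the case of the line. *)
Definition Ii a b f : R := \int[mu]_(t in `[a, b]) f t.

Lemma cont_int f a b : continuous f -> mu.-integrable `[a, b] (EFin \o f).
Proof.
move=> cf; apply: continuous_compact_integrable; first exact: segment_compact.
exact: continuous_subspaceT.
Qed.

Lemma IiD f g a b : continuous f -> continuous g ->
  Ii a b (fun t => f t + g t) = Ii a b f + Ii a b g.
Proof. by move=> cf cg; rewrite /Ii RintegralD//; exact: cont_int. Qed.

Lemma IiZ f k a b : continuous f -> Ii a b (fun t => k * f t) = k * Ii a b f.
Proof. by move=> cf; rewrite /Ii RintegralZl//; exact: cont_int. Qed.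

Lemma Ii_le f g a b : continuous f -> continuous g ->
  (forall t, a <= t <= b -> f t <= g t) -> Ii a b f <= Ii a b g.
Proof.
move=> cf cg fg; apply: le_Rintegral; [by []|exact: cont_int|exact: cont_int|].
by move=> t; rewrite /= in_itv/=; exact: fg.
Qed.

Lemma Ii_cst a b k : a <= b -> Ii a b (fun=> k) = k * (b - a).
Proof.
move=> ab; rewrite /Ii Rintegral_cst//= lebesgue_measure_itv /=.
case: ifPn; first by [].
rewrite lte_fin -leNgt => ba; have -> : b = a by apply/eqP; rewrite eq_le ba.
by rewrite subrr.
Qed.

Lemma Ii_abs f a b e : a <= b -> continuous f ->
  (forall t, a <= t <= b -> `|f t| <= e) -> `|Ii a b f| <= e * (b - a).
Proof.
move=> ab cf H; rewrite ler_norml -mulNr -!Ii_cst//; apply/andP; split.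
  apply: Ii_le => //; first by move=> ?; exact: cvg_cst.
  by move=> t /H; rewrite ler_norml => /andP[].
apply: Ii_le => //; first by move=> ?; exact: cvg_cst.
by move=> t /H; rewrite ler_norml => /andP[].
Qed.

Lemma Ii_prim f a x : continuous f -> a < x ->
  is_derive x (1:R) (fun x => Ii a x f) (f x).
Proof.
move=> cf ax.
have xu : x < x + 1 by rewrite ltrDl.
have [d de] := @continuous_FTC1_closed R f a x (x+1) xu (cont_int _ _ cf) ax (cf x).
apply: DeriveDef; first exact: d.
by rewrite -derive1E.
Qed.

Lemma Ii_FTC2 f F a b : a < b -> continuous f ->
  (forall x, a <= x <= b -> is_derive x (1:R) F (f x)) -> Ii a b f = F b - F a.
Proof.
move=> ab cf HF; rewrite /Ii /Rintegral (@continuous_FTC2 _ f F a b)//.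
- exact: continuous_subspaceT.
- have cF x : a <= x <= b -> {for x, continuous F}.
    move=> /HF dF; apply: differentiable_continuous; apply/derivable1_diffP.
    exact: (@ex_derive _ _ _ _ _ _ _ dF).
  split.
  + by move=> x; rewrite in_itv/= => /andP[ax xb]; apply: (@ex_derive _ _ _ _ _ _ _ (HF x _)); rewrite !ltW.
  + apply: cvg_at_right_filter; apply: cF; rewrite lexx ltW//.
  + apply: cvg_at_left_filter; apply: cF; rewrite lexx ltW//.
- move=> x; rewrite in_itv/= => /andP[ax xb].
  by rewrite derive1E (@derive_val _ _ _ _ _ _ _ (HF x _))// !ltW.
Qed.

Lemma Ii_split f a b c : continuous f -> a <= b -> b <= c ->
  Ii a c f = Ii a b f + Ii b c f.
Proof.
move=> cf; rewrite le_eqVlt => /predU1P[->|ab].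
  by rewrite {2}/Ii set_itv1 Rintegral_set1 add0r.
move=> bc; pose F x := Ii (a - 1) x f.
have dF x : a <= x -> is_derive x (1:R) F (f x).
  by move=> ax; apply: Ii_prim => //; apply: lt_le_trans ax; rewrite gtrBl.
move: bc; rewrite le_eqVlt => /predU1P[->|bc].
  by rewrite {3}/Ii set_itv1 Rintegral_set1 addr0.
have -> : Ii a c f = F c - F a.
  by apply: Ii_FTC2 => //; [exact: lt_trans bc|move=> x /andP[ax _]; exact: dF].
have -> : Ii a b f = F b - F a.
  by apply: Ii_FTC2 => // x /andP[ax _]; exact: dF.
have -> : Ii b c f = F c - F b.
  apply: Ii_FTC2 => // x /andP[bx _]; apply: dF; apply: le_trans bx; exact: ltW.
by rewrite [RHS]addrC addrA subrK.
Qed.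

Lemma Ii_eq f g a b : (forall t, a <= t <= b -> f t = g t) -> Ii a b f = Ii a b g.
Proof.
move=> H; apply: eq_Rintegral => t; rewrite inE/= in_itv/=; exact: H.
Qed.

Definition CcR (N : R) f := continuous f /\ forall x, N < `|x| -> f x = 0.
Definition I1 f : R := \int[mu]_(t in setT) f t.

Lemma I1E N f : (forall x, N < `|x| -> f x = 0) -> I1 f = Ii (- N) N f.
Proof.
move=> Hf; rewrite /Ii Rintegral_mkcond /I1; congr (Rintegral _ _ _).
apply/funext => x; rewrite patchE; case: ifPn => // /negP H; apply: Hf.
by rewrite ltNge ler_norml; apply/negP => xN; apply: H; rewrite inE/= in_itv/=.
Qed.

Lemma CcRW N M f : N <= M -> CcR N f -> CcR M f.
Proof. by move=> NM [cf Hf]; split => // x Mx; apply: Hf; apply: le_lt_trans Mx. Qed.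

Lemma I1_pos N f : CcR N f -> (forall x, 0 <= f x) -> forall x0, 0 < f x0 -> 0 < I1 f.
Proof.
move=> [cf Hf] f0 x0 fx0.
have /cont_epsP /(_ (f x0 / 2)) [|d d0 Hd] := cf x0; first by rewrite divr_gt0.
have d2 : 0 < d / 2 by rewrite divr_gt0.
pose M := Num.max N (`|x0| + d).
have HM x : M < `|x| -> f x = 0 by rewrite gt_max => /andP[? _]; apply: Hf.
have [l1 l2] : - M <= x0 - d / 2 /\ x0 + d/2 <= M.
  have : `|x0| + d <= M by rewrite le_max lexx orbT.
  have := ler_norm x0; have := ler_norm (- x0); rewrite normrN; lra.
rewrite (I1E HM) (@Ii_split _ _ (x0 - d/2))//; last lra.
rewrite (@Ii_split _ _ (x0 + d/2) M)//; last lra.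
have ge0 a b : a <= b -> 0 <= Ii a b f.
  move=> ab; rewrite -[0](mul0r (b - a)) -Ii_cst//; apply: Ii_le => //.
  by move=> ?; exact: cvg_cst.
have P : f x0 / 2 * d <= Ii (x0 - d / 2) (x0 + d / 2) f.
  rewrite [X in _ * X](_ : d = (x0 + d/2) - (x0 - d/2)); last lra.
  rewrite -Ii_cst; last lra.
  apply: Ii_le => //; first by move=> ?; exact: cvg_cst.
  move=> t /andP[t1 t2]; have /Hd : `|t - x0| < d by rewrite ltr_norml; apply/andP; split; lra.
  rewrite ltr_norml => /andP[]; lra.
have := ge0 _ _ l1; have := ge0 _ _ l2.
have : 0 < f x0 / 2 * d by rewrite mulr_gt0// divr_gt0.
lra.
Qed.

End int1.

(** * Positive functionals and Fubini *)

Section radon.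
Context {R : realType}.

Definition Cc m (N : R) (f : 'rV[R]_m -> R) :=
  continuous f /\ forall x, N < `|x| -> f x = 0.

(** Positive linear functionals, bounded on each ball. The integral over R^n is one
    of them, and stating continuity in a parameter and Fubini for all of them keeps
    the inductions on n short. *)
Record radon m (L : ('rV[R]_m -> R) -> R) : Prop := Radon {
  radon_lin : forall N f g a, Cc N f -> Cc N g ->
    L (fun x => a * f x + g x) = a * L f + L g ;
  radon_le : forall N f g, Cc N f -> Cc N g -> (forall x, f x <= g x) -> L f <= L g ;
  radon_bd : forall N, exists2 C, 0 <= C & forall f e, Cc N f ->
    (forall x, `|f x| <= e) -> `|L f| <= C * e }.

Section cc.
Context {m : nat}.
Implicit Types (f g : 'rV[R]_m -> R).

Lemma CcW N M f : N <= M -> Cc N f -> Cc M f.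
Proof. by move=> NM [cf Hf]; split => // x Mx; apply: Hf; apply: le_lt_trans Mx. Qed.

Lemma Cc0 N : Cc N (fun _ : 'rV[R]_m => 0).
Proof. by split=> [|//]; exact: cst_continuous. Qed.

Lemma Cc_lin N f g a : Cc N f -> Cc N g -> Cc N (fun x => a * f x + g x).
Proof.
move=> [cf Hf] [cg Hg]; split=> [x|x Nx]; last by rewrite Hf// Hg// mulr0 add0r.
by apply: ctD; [apply: ctM; [exact: ct_cst|exact: cf]|exact: cg].
Qed.

Lemma CcB N f g : Cc N f -> Cc N g -> Cc N (fun x => f x - g x).
Proof.
move=> cf cg; rewrite (_ : (fun _ => _) = (fun x => -1 * g x + f x)).
  exact: Cc_lin.
by apply/funext => x; rewrite mulN1r addrC.
Qed.

Lemma radonB (L : ('rV[R]_m -> R) -> R) N f g : radon L -> Cc N f -> Cc N g ->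
  L (fun x => f x - g x) = L f - L g.
Proof.
move=> rL cf cg; rewrite (_ : (fun _ => _) = (fun x => -1 * g x + f x)).
  by rewrite (radon_lin rL _ cg cf) mulN1r addrC.
by apply/funext => x; rewrite mulN1r addrC.
Qed.

Lemma radon0 (L : ('rV[R]_m -> R) -> R) : radon L -> L (fun=> 0) = 0.
Proof.
move=> rL; have := radonB rL (Cc0 0) (Cc0 0).
rewrite (_ : (fun _ => _) = (fun _ : 'rV[R]_m => 0)); first by rewrite subrr.
by apply/funext => x; rewrite subr0.
Qed.

Lemma radonZ (L : ('rV[R]_m -> R) -> R) N f a : radon L -> Cc N f ->
  L (fun x => a * f x) = a * L f.
Proof.
move=> rL cf; have := radon_lin rL a cf (Cc0 N).
rewrite (radon0 rL) addr0 => <-; congr L; apply/funext => x; exact/esym/addr0.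
Qed.

Lemma radon_ge0 (L : ('rV[R]_m -> R) -> R) N f : radon L -> Cc N f ->
  (forall x, 0 <= f x) -> 0 <= L f.
Proof. by move=> rL cf f0; rewrite -(radon0 rL); exact: (radon_le rL (Cc0 N) cf). Qed.

(** A functional that is bounded on each ball is continuous for uniform convergence
    with supports in a fixed ball. *)
Lemma radon_cont (V : normedModType R) (L : ('rV[R]_m -> R) -> R) N
    (u : V -> 'rV[R]_m -> R) t0 : radon L -> (forall t, Cc N (u t)) ->
  (forall e, 0 < e -> exists2 d, 0 < d & forall t, `|t - t0| < d ->
     forall x, `|u t x - u t0 x| < e) ->
  {for t0, continuous (fun t => L (u t))}.
Proof.
move=> rL cu H; apply/cont_epsP => e e0.
have [C C0 HC] := radon_bd rL N.
have [|d d0 Hd] := H (e / (C + 1)); first by rewrite divr_gt0// ltr_wpDl.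
exists d => // t /Hd {}Hd; rewrite -(radonB rL (cu t) (cu t0)).
have /le_lt_trans : `|L (fun x => u t x - u t0 x)| <= C * (e / (C + 1)).
  by apply: HC => [|x]; [exact: CcB|exact/ltW/Hd].
apply; rewrite mulrCA gtr_pMr// ltr_pdivrMr ?ltr_wpDl//; lra.
Qed.

End cc.

Lemma Cc_unif m N (f : 'rV[R]_(1 + m) -> R) t0 e : Cc N f -> 0 < e ->
  exists2 d, 0 < d & forall t, `|t - t0| < d ->
    forall x, `|f (pt t x) - f (pt t0 x)| < e.
Proof.
move=> [cf Hf] e0.
have [|d d0 Hd] := unif_slice (f := fun t x => f (pt t x)) (t0 := t0)
   (@ball0_compact R m N) _ e0.
  move=> x _ {e0}e e0; have /cont_epsP /(_ e e0)[d d0 Hd] := cf (pt t0 x).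
  by exists d => // t y tt yx; apply: Hd; rewrite ptB pt_norm_lt.
exists d => // t tt x; have [xN|Nx] := leP `|x| N; first exact: Hd.
by rewrite !Hf ?subrr ?normr0//; apply: lt_le_trans Nx _; rewrite pt_normE le_max lexx orbT.
Qed.

Lemma Cc_slice m N (f : 'rV[R]_(1 + m) -> R) t : Cc N f -> Cc N (fun x => f (pt t x)).
Proof.
move=> [cf Hf]; split=> x.
  apply/cont_epsP => e e0; have /cont_epsP /(_ e e0)[d d0 Hd] := cf (pt t x).
  by exists d => // y yx; apply: Hd; rewrite ptB pt_norm_lt// subrr normr0.
by move=> Nx; apply: Hf; apply: lt_le_trans Nx _; rewrite pt_normE le_max lexx orbT.
Qed.

Lemma Cc_slice0 m N (f : 'rV[R]_(1 + m) -> R) t : Cc N f -> N < `|t| ->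
  (fun x => f (pt t x)) = fun=> 0.
Proof.
move=> [cf Hf] Nt; apply/funext => x; apply: Hf; apply: lt_le_trans Nt _.
by rewrite pt_normE le_max lexx.
Qed.

Lemma radon_slice m L N (f : 'rV[R]_(1 + m) -> R) : radon L -> Cc N f ->
  CcR N (fun t => L (fun x => f (pt t x))).
Proof.
move=> rL cf; split=> t; last by move=> Nt; rewrite (Cc_slice0 cf Nt) (radon0 rL).
apply: (radon_cont (N := N) (u := fun t x => f (pt t x)) rL).
  by move=> u; exact: Cc_slice.
by move=> e e0; exact: (Cc_unif t cf e0).
Qed.

Lemma Cc_sliceR m N (f : 'rV[R]_(1 + m) -> R) x : Cc N f -> CcR N (fun t => f (pt t x)).
Proof.
move=> [cf Hf]; split=> t.
  apply/cont_epsP => e e0; have /cont_epsP /(_ e e0)[d d0 Hd] := cf (pt t x).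
  by exists d => // y yx; apply: Hd; rewrite ptB pt_norm_lt// subrr normr0.
by move=> Nx; apply: Hf; apply: lt_le_trans Nx _; rewrite pt_normE le_max lexx.
Qed.

Lemma Cc_Ii m N (f : 'rV[R]_(1 + m) -> R) a b : a <= b -> Cc N f ->
  Cc N (fun x => Ii a b (fun t => f (pt t x))).
Proof.
move=> ab cf; have [cf1 Hf] := cf; split => x; last first.
  move=> Nx; rewrite -[RHS](mul0r (b - a)) -Ii_cst//; apply: Ii_eq => t _.
  by apply: Hf; apply: lt_le_trans Nx _; rewrite pt_normE le_max lexx orbT.
apply/cont_epsP => e e0.
have e'0 : 0 < e / (b - a + 1) by rewrite divr_gt0// ltr_wpDl// subr_ge0.
have [|d d0 Hd] := unif_slice (f := fun x t => f (pt t x)) (t0 := x)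
   (@segment_compact R a b) _ e'0.
  move=> t _ {e'0 e0}e e0; have /cont_epsP /(_ e e0)[d d0 Hd] := cf1 (pt t x).
  by exists d => // y u tt yx; apply: Hd; rewrite ptB pt_norm_lt.
exists d => // y yx.
have cs z : continuous (fun t => f (pt t z)) by have [] := Cc_sliceR z cf.
have -> : Ii a b (fun t => f (pt t y)) - Ii a b (fun t => f (pt t x)) =
   Ii a b (fun t => -1 * f (pt t x) + f (pt t y)).
  rewrite IiD//; last by move=> t; apply: ctM; [exact: ct_cst|exact: cs].
  by rewrite IiZ// mulN1r addrC.
apply: (@le_lt_trans _ _ (e / (b - a + 1) * (b - a))).
  apply: Ii_abs => //.
    by move=> t; apply: ctD; [apply: ctM; [exact: ct_cst|exact: cs]|exact: cs].
  move=> t abt; rewrite mulN1r addrC; apply/ltW/Hd => //=.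
by rewrite mulrAC -mulrA gtr_pMr// ltr_pdivrMr ?ltr_wpDl ?subr_ge0//; lra.
Qed.

Lemma Cc_I1 m N (f : 'rV[R]_(1 + m) -> R) : 0 <= N -> Cc N f ->
  Cc N (fun x => I1 (fun t => f (pt t x))).
Proof.
move=> N0 cf; rewrite (_ : (fun x => _) = (fun x => Ii (- N) N (fun t => f (pt t x)))).
  by apply: Cc_Ii => //; lra.
by apply/funext => x; rewrite (I1E (N := N))//; have [] := Cc_sliceR x cf.
Qed.

(** Both sides, with the integral in t stopped at a variable end, have the same
    derivative in that end and vanish when it is far to the left. This avoids
    product measures: the inner functional may be the iterated integral itself. *)
Lemma fubini_radon m L N (f : 'rV[R]_(1 + m) -> R) : radon L -> 0 <= N -> Cc N f ->
  I1 (fun t => L (fun x => f (pt t x))) = L (fun x => I1 (fun t => f (pt t x))).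
Proof.
move=> rL N0 cf.
have cs z : continuous (fun t => f (pt t z)) by have [] := Cc_sliceR z cf.
pose M := N + 1; have NM : N < M by rewrite ltrDl.
pose P t x := Ii (- M - 1) t (fun t => f (pt t x)).
pose G t := L (P t).
have cP t : - M - 1 <= t -> Cc N (P t) by move=> h; exact: Cc_Ii.
have dG t : - M - 1 < t -> is_derive t (1:R) G (L (fun x => f (pt t x))).
  move=> tM; apply/is_derive_epsP => e e0.
  have [C C0 HC] := radon_bd rL N.
  have e'0 : 0 < e / (C + 1) by rewrite divr_gt0// ltr_wpDl.
  have [d d0 Hd] := Cc_unif t cf e'0.
  exists (Num.min d (t + M + 1)); first by rewrite lt_min d0/=; lra.
  move=> h; rewrite lt_min => /andP[hd hM].
  have htM : - M - 1 <= t + h.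
    by have := ler_norm (- h); rewrite normrN; lra.
  have tM' := ltW tM.
  rewrite /G -(radonB rL (cP _ htM) (cP _ tM')) -(radonZ h rL (Cc_slice t cf)).
  have c1 := CcB (cP _ htM) (cP _ tM').
  have c2 : Cc N (fun x => h * f (pt t x)).
    have := Cc_lin h (Cc_slice t cf) (@Cc0 m N).
    by under eq_fun do rewrite addr0.
  rewrite -(radonB rL c1 c2).
  apply: (@le_trans _ _ (C * (e / (C + 1) * `|h|))); last first.
    rewrite mulrA ler_wpM2r// mulrCA ger_pMr//.
    by rewrite ler_pdivrMr ?ltr_wpDl//; lra.
  apply: HC; first exact: CcB.
  move=> x; pose g s := f (pt s x) - f (pt t x).
  have cg : continuous g.
    by move=> s; apply: ctD; [exact: cs|exact: ct_cst].
  have gI a b : a <= b -> Ii a b g = Ii a b (fun t => f (pt t x)) - (b - a) * f (pt t x).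
    move=> ab; rewrite /g IiD//; last by move=> ?; exact: ct_cst.
    by rewrite Ii_cst// mulNr mulrC.
  have [h0|h0] := leP 0 h.
    rewrite /P (Ii_split (b := t) (c := t + h)) ?lerDl// [X in X - P t x]addrC addrK.
    have tth : t <= t + h by rewrite lerDl.
    have := gI t (t + h) tth; rewrite [t + h - t]addrC addKr => <-.
    rewrite [X in _ * X]ger0_norm//.
    rewrite [X in _ <= _ * X](_ : h = t + h - t); last by rewrite addrC addKr.
    apply: Ii_abs => // s /andP[s1 s2]; apply/ltW/Hd.
    by move: hd; rewrite ger0_norm// => hd; rewrite ger0_norm; lra.
  have tth : t + h <= t by lra.
  have -> : P (t + h) x - P t x - h * f (pt t x) = - Ii (t + h) t g.
    rewrite gI// /P (Ii_split (a := - M - 1) (b := t + h) (c := t))//; ring.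
  have -> : `|h| = t - (t + h) by rewrite ltr0_norm//; ring.
  rewrite normrN; apply: Ii_abs => // s /andP[s1 s2]; apply/ltW/Hd.
  by move: hd; rewrite ltr0_norm// => hd; rewrite ltr_norml; apply/andP; split; lra.
have cL := CcRW (ltW NM) (radon_slice rL cf).
have Mle : - M <= M by lra.
rewrite (I1E (N := M)); last by have [] := cL.
have MltM : - M < M by rewrite /M; lra.
have -> : Ii (- M) M (fun t => L (fun x => f (pt t x))) = G M - G (- M).
  apply: Ii_FTC2 => //; first by have [] := cL.
  by move=> t /andP[t1 _]; apply: dG; lra.
have -> : G (- M) = 0.
  rewrite /G (_ : P (- M) = fun=> 0) ?(radon0 rL)//; apply/funext => x.
  rewrite /P -[RHS](mul0r (- M - (- M - 1))) -Ii_cst; last lra.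
  apply: Ii_eq => t /andP[t1 t2]; have [_ Hf] := Cc_sliceR x cf; apply: Hf.
  by rewrite /M in t2; rewrite ltr0_norm; lra.
rewrite subr0 /G; congr L; apply/funext => x; rewrite /P.
rewrite (@Ii_split _ _ (- M - 1) (- M))//; [|lra].
rewrite (_ : Ii (- M - 1) (- M) _ = 0).
  by rewrite add0r (I1E (N := M))//; have [] := CcRW (ltW NM) (Cc_sliceR x cf).
rewrite -[RHS](mul0r (- M - (- M - 1))) -Ii_cst; last lra.
apply: Ii_eq => t /andP[t1 t2]; have [_ Hf] := Cc_sliceR x cf; apply: Hf.
by rewrite /M in t2; rewrite ltr0_norm; lra.
Qed.

Lemma I1_le N (f g : R -> R) : 0 <= N -> CcR N f -> CcR N g ->
  (forall x, f x <= g x) -> I1 f <= I1 g.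
Proof. by move=> N0 [cf Hf] [cg Hg] fg; rewrite (I1E Hf) (I1E Hg); apply: Ii_le. Qed.

Lemma integralRn_rec m (f : 'rV[R]_(1 + m) -> R) :
  integralRn f = I1 (fun t => integralRn (fun x => f (pt t x))).
Proof. by []. Qed.

Lemma radon_integralRn m : radon (@integralRn R m).
Proof.
elim: m => [|m IH].
  split.
  - by [].
  - by move=> N f g _ _ /(_ 0).
  - by move=> N; exists 1 => // f e _ /(_ 0); rewrite mul1r.
have pN N (f : 'rV[R]_(1 + m) -> R) : Cc N f -> Cc (Num.max N 0) f.
  by move=> cf; apply: CcW cf; rewrite le_max lexx.
have N0 N : 0 <= Num.max N 0 :> R by rewrite le_max lexx orbT.
split.
- move=> N f g a /pN cf /pN cg; rewrite !integralRn_rec.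
  set K := Num.max N 0 in cf cg.
  have K0 : 0 <= K by exact: N0.
  have [c1 h1] := radon_slice IH cf; have [c2 h2] := radon_slice IH cg.
  have [c3 h3] := radon_slice IH (Cc_lin a cf cg).
  rewrite (I1E h1) (I1E h2) (I1E h3) -IiZ// -IiD//.
    apply: Ii_eq => t _; exact: (radon_lin IH a (Cc_slice t cf) (Cc_slice t cg)).
  by move=> t; apply: ctM; [exact: ct_cst|exact: c1].
- move=> N f g /pN cf /pN cg fg; rewrite !integralRn_rec.
  apply: (I1_le (N0 N) (radon_slice IH cf) (radon_slice IH cg)) => t.
  exact: (radon_le IH (Cc_slice t cf) (Cc_slice t cg)).
- move=> N; have [C C0 HC] := radon_bd IH (Num.max N 0).
  have K0 := N0 N; exists (C * (2 * Num.max N 0)); first by rewrite mulr_ge0// mulr_ge0.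
  move=> f e /pN cf fe; rewrite integralRn_rec.
  have [c1 h1] := radon_slice IH cf; rewrite (I1E h1).
  rewrite -mulrA [2 * _ * e]mulrC mulrA.
  rewrite [2 * _](_ : _ = Num.max N 0 - - Num.max N 0); last by ring.
  apply: Ii_abs => //; first lra.
  by move=> t _; apply: HC; [exact: Cc_slice|].
Qed.

Lemma integralRn_pos m N (f : 'rV[R]_m -> R) : Cc N f -> (forall x, 0 <= f x) ->
  forall x0, 0 < f x0 -> 0 < integralRn f.
Proof.
elim: m N f => [|m IH] N f cf f0 x0 fx0.
  by rewrite /= (_ : 0 = x0)//; apply/rowP => -[].
rewrite integralRn_rec.
apply: (@I1_pos _ N _ (radon_slice (@radon_integralRn m) cf) _ (hd x0)).
  by move=> t; apply: (radon_ge0 (@radon_integralRn m) (Cc_slice t cf)).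
apply: (IH _ _ (Cc_slice (hd x0) cf) _ (tl x0)); first by [].
by rewrite (pt_hd_tl x0).
Qed.

End radon.

(** * Differentials, Schur complements and substitution *)

Section diffat.
Context {R : realType}.

(** Differentiability with prescribed differential, as an estimate. *)
Definition diffat (V W : normedModType R) (f : V -> W) (x : V) (L : V -> W) :=
  forall e, 0 < e -> exists2 d, 0 < d &
    forall h, `|h| < d -> `|f (x + h) - f x - L h| <= e * `|h|.

Lemma diffat_lip (V W : normedModType R) (f : V -> W) x L C : 0 <= C ->
  (forall h, `|L h| <= C * `|h|) -> diffat f x L ->
  exists2 d, 0 < d & forall h, `|h| < d -> `|f (x + h) - f x| <= (C + 1) * `|h|.
Proof.
move=> C0 HL df; have [d d0 Hd] := df 1 ltr01; exists d => // h hd.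
rewrite -[f _ - _](subrK (L h)) mulrDl; apply: (le_trans (ler_normD _ _)).
by rewrite addrC lerD// Hd.
Qed.

(** A pointwise Lipschitz estimate near one point is enough for continuity there. *)
Lemma lip_cont (V W : normedModType R) (f : V -> W) x C d : 0 <= C -> 0 < d ->
  (forall h, `|h| < d -> `|f (x + h) - f x| <= C * `|h|) -> continuous_at x f.
Proof.
move=> C0 d0 H; apply/cont_epsP => e e0.
exists (Num.min d (e / (C + 1))); first by rewrite lt_min d0 divr_gt0// ltr_wpDl.
move=> y; rewrite lt_min => /andP[yd]; rewrite ltr_pdivlMr ?ltr_wpDl// => ye.
have := H _ yd; rewrite addrCA subrr addr0 => /le_lt_trans; apply.
apply: le_lt_trans ye; rewrite mulrC ler_wpM2l//; lra.
Qed.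

Lemma mx_coord_le m n (A : 'M[R]_(m, n)) i j : `|A i j| <= `|A|.
Proof.
rewrite -[`|A|]/(mx_norm A) mx_normrE.
by apply: (@le_bigmax _ _ _ 0 (fun ij => `|A ij.1 ij.2|) (i, j)).
Qed.

Lemma mulmx_le m n (h : 'rV[R]_m) (A : 'M[R]_(m, n)) :
  `|h *m A| <= (m%:R * `|A|) * `|h|.
Proof.
apply/row_norm_le => [|j]; first by rewrite !mulr_ge0.
rewrite mxE; apply: le_trans (ler_norm_sum _ _ _) _.
rewrite (_ : _ * _ = \sum_(i < m) `|h| * `|A|).
  by apply: ler_sum => i _; rewrite normrM ler_pM ?coord_le ?mx_coord_le.
by rewrite sumr_const card_ord -mulr_natl; ring.
Qed.

Lemma diffat_mx_cont m n (F : 'rV[R]_m -> 'rV[R]_n) x (A : 'M[R]_(m, n)) :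
  diffat F x (fun h => h *m A) -> continuous_at x F.
Proof.
move=> dF; have [|d d0 Hd] := diffat_lip (C := m%:R * `|A|) _ (fun h => mulmx_le h A) dF.
  by rewrite mulr_ge0.
apply: lip_cont Hd => //; by rewrite addr_ge0// mulr_ge0.
Qed.

Lemma dotv_le n (x y : 'rV[R]_n) : dotv x y <= n%:R * (`|x| * `|y|).
Proof.
rewrite /dotv (_ : _ * _ = \sum_(i < n) `|x| * `|y|).
  apply: ler_sum => i _; apply: le_trans (ler_norm _) _.
  by rewrite normrM ler_pM ?coord_le.
by rewrite sumr_const card_ord mulr_natl.
Qed.

Lemma dotv_abs n (x y : 'rV[R]_n) : `|dotv x y| <= n%:R * (`|x| * `|y|).
Proof.
rewrite ler_norml dotv_le andbT lerNl; have := dotv_le x (- y); rewrite normrN.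
by apply: le_trans; rewrite /dotv -sumrN ler_sum// => i _; rewrite mxE mulrN.
Qed.

Lemma dotv_pt n (z w : 'rV[R]_(1 + n)) : dotv z w = hd z * hd w + dotv (tl z) (tl w).
Proof.
rewrite /dotv big_split_ord /= big_ord1 /hd /tl !mxE; congr (_ + _).
by apply: eq_bigr => i _; rewrite !mxE.
Qed.

Lemma ct_mx m n (V : normedModType R) (f : V -> 'M[R]_(m, n)) x :
  (forall i j, continuous_at x (fun y => f y i j)) -> continuous_at x f.
Proof.
move=> H; apply/cont_epsP => e e0.
have H' : forall ij : 'I_m * 'I_n, {d | 0 < d & forall y, `|y - x| < d ->
    `|f y ij.1 ij.2 - f x ij.1 ij.2| < e}.
  move=> ij; apply: cid2; exact: (cont_epsP _ _).1 (H ij.1 ij.2) e e0.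
exists (\big[Num.min/1]_ij s2val (H' ij)).
  by elim/big_ind: _ => // [a b a0 b0|ij _]; [by rewrite lt_min a0 b0|exact: (s2valP (H' ij))].
move=> y yd; rewrite -[`|_|]/(mx_norm _) mx_normrE.
apply/bigmax_ltP; split => // ij _; rewrite !mxE.
apply: (s2valP' (H' ij)); apply: lt_le_trans yd _.
by have := @bigmin_le _ _ _ (1:R) ij (fun ij => s2val (H' ij)).
Qed.

Lemma ct_coord m n (V : normedModType R) (f : V -> 'M[R]_(m, n)) x i j :
  continuous_at x f -> continuous_at x (fun y => f y i j).
Proof.
move=> /cont_epsP cf; apply/cont_epsP => e e0; have [d d0 Hd] := cf e e0.
exists d => // y /Hd; apply: le_lt_trans.
by have := mx_coord_le (f y - f x) i j; rewrite !mxE.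
Qed.

Lemma ct_det n (V : normedModType R) (f : V -> 'M[R]_n) x :
  continuous_at x f -> continuous_at x (fun y => \det (f y)).
Proof.
move=> cf; apply: ct_sum => s; apply: ctM; first exact: ct_cst.
by apply: ct_prod => i; exact: ct_coord.
Qed.

Lemma ct_pt n (V : normedModType R) (f : V -> R) (g : V -> 'rV[R]_n) x :
  continuous_at x f -> continuous_at x g -> continuous_at x (fun y => pt (f y) (g y)).
Proof.
move=> /cont_epsP cf /cont_epsP cg; apply/cont_epsP => e e0.
have [d d0 Hd] := cf e e0; have [d' d'0 Hd'] := cg e e0.
exists (Num.min d d'); rewrite ?lt_min ?d0// => y; rewrite lt_min => /andP[y1 y2].
by rewrite ptB pt_norm_lt ?Hd ?Hd'.
Qed.

Lemma ct_hd n (z : 'rV[R]_(1 + n)) : continuous_at z (@hd R n).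
Proof.
apply/cont_epsP => e e0; exists e => // y; rewrite -hdB; exact/le_lt_trans/hd_le.
Qed.
Lemma ct_tl n (z : 'rV[R]_(1 + n)) : continuous_at z (@tl R n).
Proof.
apply/cont_epsP => e e0; exists e => // y; rewrite -tlB; exact/le_lt_trans/tl_le.
Qed.
Lemma ct_id (V : normedModType R) (x : V) : continuous_at x id.
Proof. exact: cvg_id. Qed.

(** Block decomposition of the derivative of a map of R^(1+n): [j00] is its (s,s)
    entry. Eliminating the first variable multiplies the determinant by [j00] and
    leaves the Schur complement as the derivative in the remaining variables. *)
Definition j00 n (J : 'M[R]_(1 + n)) : R := ulsubmx J 0 0.
Definition schur n (J : 'M[R]_(1 + n)) : 'M[R]_n :=
  drsubmx J - (j00 J)^-1 *: (dlsubmx J *m ursubmx J).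

Lemma det_schur n (J : 'M[R]_(1 + n)) : j00 J != 0 -> \det J = j00 J * \det (schur J).
Proof.
move=> J0; pose P : 'M[R]_(1 + n) := block_mx 1%:M 0 (- ((j00 J)^-1 *: dlsubmx J)) 1%:M.
have dP : \det P = 1 by rewrite det_lblock !det1 mulr1.
have : \det (P *m J) = j00 J * \det (schur J).
  rewrite -[J in P *m J]submxK /P mulmx_block !mul1mx !mul0mx !addr0.
  have ulE : ulsubmx J = (j00 J)%:M by rewrite [LHS]mx11_scalar.
  rewrite ulE mul_mx_scalar scalerN scalerA divff// scale1r addNr.
  by rewrite det_ublock det_scalar1 mulNmx -scalemxAl addrC.
by rewrite det_mulmx dP mul1r.
Qed.

Lemma hd_mulmx n (h : 'rV[R]_(1 + n)) (J : 'M[R]_(1 + n)) :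
  hd (h *m J) = hd h * j00 J + (tl h *m dlsubmx J) 0 0.
Proof.
rewrite -{1}(hsubmxK h) -{1}(submxK J) mul_row_block /hd row_mxKl mxE.
by rewrite mxE big_ord1.
Qed.

Lemma tl_mulmx n (h : 'rV[R]_(1 + n)) (J : 'M[R]_(1 + n)) :
  tl (h *m J) = hd h *: ursubmx J + tl h *m drsubmx J.
Proof.
rewrite -{1}(hsubmxK h) -{1}(submxK J) mul_row_block /tl row_mxKr.
by rewrite [lsubmx h]mx11_scalar mul_scalar_mx.
Qed.

End diffat.

Section subst1.
Context {R : realType}.

(** The substitution u = phi(t) for an increasing surjection, through a primitive of
    h: both integrals are increments of it. *)
Lemma substitution1 (phi dphi psi h : R -> R) (N M : R) : 0 <= N ->
  (forall t, is_derive t (1:R) phi (dphi t)) -> continuous dphi ->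
  (forall s t, s < t -> phi s < phi t) ->
  (forall t, phi (psi t) = t) -> CcR M h ->
  (forall t, N < `|t| -> h (phi t) = 0) ->
  I1 (fun t => h (phi t) * dphi t) = I1 h.
Proof.
move=> N0 dp cdp incr psiK [ch Hh] HN.
have cphi : continuous phi.
  move=> t; apply: differentiable_continuous; apply/derivable1_diffP.
  exact: (@ex_derive _ _ _ _ _ _ _ (dp t)).
pose N' := N + 1.
pose K := Num.max M (Num.max `|phi N'| `|phi (- N')|).
have HK t : K < `|t| -> h t = 0.
  by rewrite gt_max => /andP[? _]; exact: Hh.
have [k1 k2] : - K <= phi (- N') /\ phi N' <= K.
  have := ler_norm (phi N'); have := ler_norm (- phi (- N')); rewrite normrN.
  have : `|phi N'| <= K by rewrite !le_max lexx orbT.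
  have : `|phi (- N')| <= K by rewrite !le_max lexx !orbT.
  lra.
have kk : phi (- N') < phi N' by apply: incr; rewrite /N'; lra.
rewrite (I1E HK) (Ii_split (b := phi (- N')) (c := K))//; last lra.
rewrite (Ii_split (a := phi (- N')) (b := phi N'))//; last exact: ltW.
have out a b : a <= b -> (forall t, a <= t <= b -> h t = 0) -> Ii a b h = 0.
  by move=> ab H; rewrite (Ii_eq H) Ii_cst// mul0r.
have hz t : t <= phi (- N') \/ phi N' <= t -> h t = 0.
  rewrite -(psiK t) => H; apply: HN; rewrite ltNge; apply/negP; rewrite ler_norml => /andP[l1 l2].
  case: H => H; [have : phi (- N') < phi (psi t) by apply: incr; rewrite /N'; lra|
                 have : phi (psi t) < phi (N') by apply: incr; rewrite /N'; lra]; lra.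
rewrite (out _ _ k1) => [|t /andP[_ ?]]; last by apply: hz; left.
rewrite (out _ _ k2) => [|t /andP[? _]]; last by apply: hz; right.
rewrite add0r addr0.
rewrite (I1E (N := N')); last first.
  by move=> t Nt; rewrite HN ?mul0r//; apply: lt_trans Nt; rewrite /N'; lra.
pose P x := Ii (phi (- N') - 1) x h.
have dP x : phi (- N') <= x -> is_derive x (1:R) P (h x).
  by move=> hx; apply: Ii_prim => //; lra.
have -> : Ii (phi (- N')) (phi N') h = P (phi N') - P (phi (- N')).
  by apply: Ii_FTC2 => // x /andP[? _]; exact: dP.
apply: (@Ii_FTC2 _ (fun t => h (phi t) * dphi t) (P \o phi)).
- rewrite /N'; lra.
- by move=> t; apply: ctM; [apply: (ct_comp (f := phi) (g := h)); [exact: cphi|exact: ch]|exact: cdp].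
- move=> t /andP[t1 t2]; have pt : phi (- N') <= phi t.
    by move: t1; rewrite le_eqVlt => /predU1P[->//|/incr/ltW].
  have dPt := dP _ pt; have dt := dp t.
  exact: is_derive1_comp.
Qed.

End subst1.

(** * Change of variables for strongly monotone maps *)

Section cv.
Context {R : realType}.

(** A C^1 map [F] with derivative [J], acting on rows, that is strongly monotone with
    constant [c]. Such maps are bijective with a Lipschitz inverse, and the class is
    stable under elimination of one variable, which is what the induction in
    [change_of_variables] needs. *)
Record monoC1 n (c : R) (F : 'rV[R]_n -> 'rV[R]_n) (J : 'rV[R]_n -> 'M[R]_n) : Prop := MonoC1 {
  mc_diff : forall x, diffat F x (fun h => h *m J x) ;
  mc_cont : forall x, continuous_at x J ;
  mc_mono : forall x y, c * `|x - y| ^+ 2 <= dotv (F x - F y) (x - y) }.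

(** Strong monotonicity and the Cauchy-Schwarz inequality: the inverse is
    Lipschitz. The factor [n] compares the sup norm with the scalar product. *)
Lemma mono_lip n c (F : 'rV[R]_n -> 'rV[R]_n) x y : 0 < c ->
  c * `|x - y| ^+ 2 <= dotv (F x - F y) (x - y) ->
  `|x - y| <= n%:R / c * `|F x - F y|.
Proof.
move=> c0 H; have [->|] := eqVneq `|x - y| 0; first by rewrite mulr_ge0// divr_ge0// ltW.
rewrite eq_sym => /eqP xy0; have {}xy0 : 0 < `|x - y|.
  by rewrite lt_neqAle normr_ge0 andbT; apply/eqP.
have := le_trans H (dotv_le _ _).
rewrite expr2 !mulrA ler_pM2r// => H'.
by rewrite mulrAC ler_pdivlMr// mulrC.
Qed.

Lemma ct_hdF n (V : normedModType R) (F : V -> 'rV[R]_(1 + n)) x : continuous_at x F ->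
  continuous_at x (fun y => hd (F y)).
Proof. by move=> cF; apply: (ct_comp (g := @hd R n)) => //; exact: ct_hd. Qed.

Lemma j00_cont n (V : normedModType R) (f : V -> 'M[R]_(1 + n)) v :
  continuous_at v f -> continuous_at v (fun v => j00 (f v)).
Proof.
move=> cf; apply: (ct_eq (g := fun y => f y (lshift n 0) (lshift n 0))).
  by move=> y; rewrite /j00 !mxE.
exact: ct_coord.
Qed.

Section elim1.
Context {n : nat} (c : R) (F : 'rV[R]_(1 + n) -> 'rV[R]_(1 + n))
  (J : 'rV[R]_(1 + n) -> 'M[R]_(1 + n)).
Hypothesis c0 : 0 < c.
Hypothesis FJ : monoC1 c F J.

Lemma monoC1_cont z : continuous_at z F.
Proof. exact: diffat_mx_cont (mc_diff FJ z). Qed.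

(** Strong monotonicity along the first coordinate axis: for fixed x, the first
    component of [F] is an increasing bijection of the line. *)
Lemma hdF_mono x s t : c * (s - t) ^+ 2 <= (hd (F (pt s x)) - hd (F (pt t x))) * (s - t).
Proof.
have := mc_mono FJ (pt s x) (pt t x).
rewrite dotv_pt hdB tlB !ptB hd_pt tl_pt subrr.
rewrite (_ : dotv _ 0 = 0) ?addr0; last first.
  by rewrite /dotv big1// => i _; rewrite [X in _ * X]mxE mulr0.
by rewrite pt_normE normr0 max_l// real_normK// num_real.
Qed.

Lemma hdF_incr x s t : s < t -> hd (F (pt s x)) < hd (F (pt t x)).
Proof.
move=> st; have := hdF_mono x t s; have ts : 0 < t - s by rewrite subr_gt0.
rewrite expr2 mulrA ler_pM2r// => H; rewrite -subr_gt0; apply: lt_le_trans H.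
exact: mulr_gt0.
Qed.

Lemma hdF_deriv x t : is_derive t (1:R) (fun t => hd (F (pt t x))) (j00 (J (pt t x))).
Proof.
apply/is_derive_epsP => e e0; have [d d0 Hd] := mc_diff FJ (pt t x) e0.
exists d => // h h_d; have := Hd (pt h 0); rewrite pt_normE normr0 max_l//.
move=> /(_ h_d); rewrite ptD addr0; apply: le_trans.
rewrite (_ : _ - _ = hd (F (pt (t + h) x) - F (pt t x) - pt h 0 *m J (pt t x))).
  exact: hd_le.
by rewrite !hdB hd_mulmx hd_pt tl_pt mul0mx; congr (_ - _); rewrite [X in _ + X]mxE addr0.
Qed.

Lemma hdF_cont x t : continuous_at t (fun t => hd (F (pt t x))).
Proof.
apply: ct_hdF; apply: (ct_comp (f := fun t => pt t x)); last exact: monoC1_cont.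
by apply: ct_pt; [exact: ct_id|exact: ct_cst].
Qed.

Lemma j00_ge z : c <= j00 (J z).
Proof.
rewrite -(pt_hd_tl z); set t := hd z; set x := tl z.
apply/ler_addgt0Pr => e e0.
have /is_derive_epsP /(_ e e0)[d d0 Hd] := hdF_deriv x t.
have dd : d / 2 < d by rewrite ltr_pdivrMr// mulr_natr mulr2n ltrDl.
have := Hd (d / 2); rewrite gtr0_norm ?divr_gt0// => /(_ dd).
have := hdF_mono x (t + d / 2) t; rewrite [t + _ - t]addrC addKr.
set D := _ - _ => H1; rewrite ler_norml => /andP[_ H2].
have d2 : 0 < d / 2 by rewrite divr_gt0.
move: H1; rewrite expr2 mulrA ler_pM2r// => H1.
rewrite -(ler_pM2r d2) mulrDl; move: H2; lra.
Qed.

Lemma hdF_surj x y : exists t, hd (F (pt t x)) = y.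
Proof.
pose f t := hd (F (pt t x)).
pose K := (`|y - f 0| / c) + 1.
have K0 : 0 < K by rewrite ltr_wpDl// divr_ge0// ltW.
have cK : `|y - f 0| <= c * K.
  by rewrite /K mulrDr mulr1 mulrCA divff ?gt_eqF// mulr1 lerDl ltW.
have H1 : c * K <= f K - f 0.
  by have := hdF_mono x K 0; rewrite subr0 expr2 mulrA ler_pM2r.
have H2 : c * K <= f 0 - f (- K).
  by have := hdF_mono x 0 (- K); rewrite sub0r opprK expr2 mulrA ler_pM2r.
move: cK; rewrite ler_norml => /andP[k1 k2].
have KK : - K <= K by lra.
have cf : {within `[- K, K], continuous f}.
  by apply: continuous_subspaceT => t; exact: hdF_cont.
have yy : Num.min (f (- K)) (f K) <= y <= Num.max (f (- K)) (f K).
  by rewrite ge_min le_max; apply/andP; split; apply/orP; [left|right]; lra.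
by have [t _ <-] := IVT KK cf yy; exists t.
Qed.

Definition invhd (y : R) (x : 'rV[R]_n) : R := projT1 (cid (hdF_surj x y)).

Lemma invhdK y x : hd (F (pt (invhd y x) x)) = y.
Proof. exact: projT2 (cid (hdF_surj x y)). Qed.

Lemma hdFK t x : invhd (hd (F (pt t x))) x = t.
Proof.
have H := invhdK (hd (F (pt t x))) x; apply/eqP; rewrite eq_le !leNgt; apply/andP; split.
  by apply/negP => /(hdF_incr x); rewrite H ltxx.
by apply/negP => /(hdF_incr x); rewrite H ltxx.
Qed.

Lemma invhd_lip y y' x x' : `|invhd y' x' - invhd y x| <=
  (`|y' - y| + `|hd (F (pt (invhd y x) x')) - hd (F (pt (invhd y x) x))|) / c.
Proof.
have := hdF_mono x' (invhd y' x') (invhd y x); rewrite invhdK.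
set D := invhd y' x' - invhd y x => H.
have [->|D0] := eqVneq D 0; first by rewrite normr0 divr_ge0// ?addr_ge0// ltW.
rewrite ler_pdivlMr// mulrC -(ler_pM2r (_ : 0 < `|D|)) ?normr_gt0//.
have -> : c * `|D| * `|D| = c * D ^+ 2 by rewrite -mulrA -expr2 real_normK// num_real.
apply: le_trans H _; apply: le_trans (ler_norm _) _; rewrite normrM ler_wpM2r//.
rewrite invhdK (_ : y' - _ = (y' - y) - (hd (F (pt (invhd y x) x')) - y)); last ring.
exact: ler_normB.
Qed.

Lemma invhd_cont z : continuous_at z (fun z : 'rV[R]_(1 + n) => invhd (hd z) (tl z)).
Proof.
apply/cont_epsP => e e0.
set y := hd z; set x := tl z.
have ce : 0 < c * e / 2 by rewrite divr_gt0// mulr_gt0.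
have /cont_epsP /(_ _ ce)[d d0 Hd] : continuous_at x (fun x' => hd (F (pt (invhd y x) x'))).
  apply: ct_hdF; apply: (ct_comp (f := fun x' => pt (invhd y x) x')); last exact: monoC1_cont.
  by apply: ct_pt; [exact: ct_cst|exact: ct_id].
exists (Num.min d (c * e / 2)); first by rewrite lt_min d0.
move=> z'; rewrite lt_min => /andP[z1 z2].
apply: le_lt_trans (invhd_lip _ _ _ _) _; rewrite ltr_pdivrMr//.
have h1 : `|hd z' - y| < c * e / 2 by rewrite -hdB; apply: le_lt_trans (hd_le _) _.
have h2 := Hd (tl z'); rewrite -tlB in h2.
have {}h2 := h2 (le_lt_trans (tl_le _) z1); lra.
Qed.

Definition invhd_pt (y : R) (x : 'rV[R]_n) := pt (invhd y x) x.
(** After the substitution t = invhd y x the first component of [F] is the new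
    coordinate y, and this is the remaining component as a map of x. *)
Definition slice_map y x := tl (F (invhd_pt y x)).
Definition slice_jac y x := schur (J (invhd_pt y x)).

Lemma invhd_pt_cont z : continuous_at z (fun z : 'rV[R]_(1 + n) => invhd_pt (hd z) (tl z)).
Proof. by apply: ct_pt; [exact: invhd_cont|exact: ct_tl]. Qed.

Lemma schur_cont (V : normedModType R) (f : V -> 'M[R]_(1 + n)) v :
  continuous_at v f -> j00 (f v) != 0 -> continuous_at v (fun v => schur (f v)).
Proof.
move=> cf f0; have cij i j : continuous_at v (fun y => f y i j) by exact: ct_coord.
apply: ct_mx => i j.
apply: (ct_eq (g := fun y => f y (rshift 1 i) (rshift 1 j) - (j00 (f y))^-1 *
    \sum_k (f y (rshift 1 i) (lshift n k)) * f y (lshift n k) (rshift 1 j))).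
  by move=> y; rewrite /schur !mxE; congr (_ - _ * _); apply: eq_bigr => k _; rewrite !mxE.
apply: ctB => //; apply: ctM; last by apply: ct_sum => k; exact: ctM.
apply: ctV => //; exact: j00_cont.
Qed.

Lemma j00_neq0 z : j00 (J z) != 0.
Proof. by rewrite gt_eqF// (lt_le_trans c0)// j00_ge. Qed.

Lemma slice_jac_cont z : continuous_at z (fun z : 'rV[R]_(1 + n) => slice_jac (hd z) (tl z)).
Proof.
apply: schur_cont; last exact: j00_neq0.
apply: (ct_comp (f := fun z : 'rV[R]_(1 + n) => invhd_pt (hd z) (tl z))); first exact: invhd_pt_cont.
exact: mc_cont FJ _.
Qed.

(** On the graph of [invhd y] the first components of [F] agree, so that they do not
    contribute to the scalar product: the monotonicity constant is inherited. The
    derivative is found by eliminating the increment of [invhd] from the first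
    component of the linearization, which produces the Schur complement. *)
Lemma slice_monoC1 y : monoC1 c (slice_map y) (slice_jac y).
Proof.
split.
- move=> x e e0; set z := invhd_pt y x; set A := J z.
  pose C := (1 + n)%:R * `|A|.
  have C0 : 0 <= C by rewrite mulr_ge0.
  have [d1 d10 Hd1] := diffat_lip C0 (fun h => mulmx_le h A) (mc_diff FJ z).
  pose C' := (C + 1) / c + 1; have C'0 : 0 < C' by rewrite ltr_wpDl// divr_ge0// ?addr_ge0// ltW.
  have HX h : `|h| < d1 -> `|pt (invhd y (x + h) - invhd y x) h| <= C' * `|h|.
    move=> hd1; apply: pt_norm_le; last first.
      by rewrite /C' mulrDl mul1r lerDr mulr_ge0// divr_ge0// ?addr_ge0// ltW.
    apply: le_trans (invhd_lip _ _ _ _) _; rewrite subrr normr0 add0r -hdB.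
    apply: (@le_trans _ _ ((C + 1) * `|h| / c)); last first.
      have -> : C' * `|h| = (C + 1) * `|h| / c + `|h| by rewrite /C'; ring.
      by rewrite lerDl.
    apply: ler_wpM2r; first by rewrite invr_ge0 ltW.
    rewrite -/z; apply: le_trans (hd_le _) _.
    have := Hd1 (pt 0 h); rewrite pt_normE normr0 max_r//= /z /invhd_pt ptD addr0.
    exact.
  pose E := 1 + `|j00 A|^-1 * (n%:R * `|ursubmx A|) .
  have u0 : 0 <= `|ursubmx A| by [].
  pose K := 1 + `|ursubmx A| / `|j00 A|.
  have K0 : 0 < K by rewrite ltr_pwDl// divr_ge0.
  have [d2 d20 Hd2] := mc_diff FJ z (divr_gt0 (divr_gt0 e0 C'0) K0).
  exists (Num.min d1 (d2 / C')); first by rewrite lt_min d10 divr_gt0.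
  move=> h; rewrite lt_min => /andP[hd1]; rewrite ltr_pdivlMr// => hd2.
  set k := invhd y (x + h) - invhd y x; set w := pt k h.
  have wn : `|w| <= C' * `|h| by exact: HX.
  have wd : `|w| < d2 by apply: le_lt_trans wn _; rewrite mulrC.
  have := Hd2 _ wd; set r := F (z + w) - F z - w *m A => Hr.
  have zw : z + w = invhd_pt y (x + h) by rewrite /z /w /invhd_pt ptD /k addrC subrK.
  have r1 : hd r = - (k * j00 A + (h *m dlsubmx A) 0 0).
    by rewrite /r !hdB zw /z /invhd_pt !invhdK subrr sub0r hd_mulmx hd_pt tl_pt.
  have key : h *m slice_jac y x = k *: ursubmx A + h *m drsubmx A + ((j00 A)^-1 * hd r) *: ursubmx A.
    rewrite /slice_jac -/z -/A /schur mulmxBr -scalemxAr mulmxA [h *m dlsubmx A]mx11_scalar.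
    rewrite mul_scalar_mx scalerA r1 mulrN mulrDr mulrCA mulVf ?j00_neq0// mulr1.
    by rewrite scaleNr [(k + _) *: _]scalerDl opprD [k *: _ + _]addrC -addrA addNKr.
  have -> : slice_map y (x + h) - slice_map y x - h *m slice_jac y x = tl r - ((j00 A)^-1 * hd r) *: ursubmx A.
    by rewrite key opprD addrA /r !tlB zw tl_mulmx hd_pt tl_pt /slice_map -/z.
  have rb : `|r| * K <= e * `|h|.
    have -> : e * `|h| = e / C' / K * (C' * `|h|) * K by field; rewrite !gt_eqF.
    apply: ler_wpM2r; first exact: ltW.
    apply: le_trans Hr _; apply: ler_wpM2l => //.
    by rewrite divr_ge0 ?divr_ge0// ltW.
  apply: le_trans (ler_normB _ _) _; rewrite normrZ normrM normfV; apply: le_trans rb.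
  rewrite /K mulrDr mulr1 lerD ?tl_le// (_ : _ * _ * _ = `|hd r| * (`|ursubmx A| / `|j00 A|)).
    by rewrite ler_wpM2r ?hd_le// divr_ge0.
  by ring.
- move=> x; have H := @slice_jac_cont (pt y x).
  rewrite (_ : slice_jac y = fun x => slice_jac (hd (pt y x)) (tl (pt y x))); last first.
    by apply/funext => u; rewrite hd_pt tl_pt.
  apply: (ct_comp (f := fun x => pt y x) (g := fun z => slice_jac (hd z) (tl z))) => //.
  by apply: ct_pt; [exact: ct_cst|exact: ct_id].
- move=> x x'; have := mc_mono FJ (invhd_pt y x) (invhd_pt y x').
  have -> : dotv (F (invhd_pt y x) - F (invhd_pt y x')) (invhd_pt y x - invhd_pt y x') = dotv (slice_map y x - slice_map y x') (x - x').
    by rewrite dotv_pt hdB {1 2}/invhd_pt !invhdK subrr mul0r add0r tlB /slice_map {3 4}/invhd_pt ptB tl_pt.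
  apply: le_trans; apply: ler_wpM2l; first exact: ltW.
  by rewrite ler_sqr ?nnegrE// /invhd_pt ptB pt_normE le_max lexx orbT.
Qed.

End elim1.

Lemma ball_bound n (V : normedModType R) (F : 'rV[R]_n -> V) (N : R) :
  (forall z, continuous_at z F) -> exists2 B, 0 <= B & forall z, `|z| <= N -> `|F z| <= B.
Proof.
move=> monoC1_cont; have := @compact_bounded _ _ (F @` [set z | `|z| <= N]).
case.
  apply: continuous_compact; last exact: ball0_compact.
  by apply: continuous_subspaceT => z; exact: monoC1_cont.
move=> M [_ HM]; exists (`|M| + 1); first by rewrite addr_ge0.
move=> z zN; apply: (HM (`|M| + 1)); last by exists z.
by apply: le_lt_trans (ler_norm _) _; rewrite ltrDl.
Qed.

(** Induction on the dimension: the first variable is substituted on each line with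
    the other variables fixed, and the remaining map is handled by the induction
    hypothesis with the new first coordinate as a parameter. The determinant
    factors accordingly by [det_schur]. *)
Theorem change_of_variables n c (F : 'rV[R]_n -> 'rV[R]_n) (J : 'rV[R]_n -> 'M[R]_n) :
  0 < c -> monoC1 c F J ->
  exists G, (forall y, F (G y) = y) /\
    forall N (H : 'rV[R]_n -> R), 0 <= N -> Cc N H ->
    integralRn (fun x => H x * \det (J x)) = integralRn (fun y => H (G y)).
Proof.
elim: n c F J => [|n IH] c F J c0 FJ.
  exists id; split=> [y|N H _ _]; first by apply/rowP => -[].
  by rewrite /= det_mx00 mulr1.
have /choice[G HG] : forall y, exists G, (forall y', slice_map c0 FJ y (G y') = y') /\
    forall N (H : 'rV[R]_n -> R), 0 <= N -> Cc N H ->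
    integralRn (fun x => H x * \det (slice_jac c0 FJ y x)) = integralRn (fun y => H (G y)).
  by move=> y; exact: (IH _ _ _ c0 (slice_monoC1 c0 FJ y)).
exists (fun z => invhd_pt c0 FJ (hd z) (G (hd z) (tl z))); split=> [z|N H N0 cH].
  apply: (@ptP R n); first by rewrite /invhd_pt invhdK.
  exact: (HG (hd z)).1.
have rn := @radon_integralRn R n.
have cHd : Cc N (fun x => H x * \det (J x)).
  have [c1 h1] := cH; split => x.
    by apply: ctM; [exact: c1|apply: ct_det; exact: mc_cont FJ _].
  by move=> /h1 ->; rewrite mul0r.
rewrite integralRn_rec (fubini_radon rn N0 cHd).
have [B B0 HB] := ball_bound N (monoC1_cont FJ).
pose k (z : 'rV[R]_(1 + n)) := H (invhd_pt c0 FJ (hd z) (tl z)) * \det (slice_jac c0 FJ (hd z) (tl z)).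
pose M := Num.max N B.
have M0 : 0 <= M by rewrite le_max N0.
have ck : Cc M k.
  split=> z.
    apply: ctM; last by apply: ct_det; exact: slice_jac_cont.
    apply: (ct_comp (f := fun z => invhd_pt c0 FJ (hd z) (tl z)) (g := H)); first exact: invhd_pt_cont.
    exact: cH.1.
  move=> zM; rewrite /k (cH.2 _) ?mul0r// ltNge; apply/negP => ZN.
  move: zM; rewrite ltNge => /negP; apply.
  rewrite -(pt_hd_tl z) pt_normE ge_max; apply/andP; split; rewrite le_max; apply/orP.
    by right; rewrite -(invhdK c0 FJ (hd z) (tl z)); apply: le_trans (hd_le _) (HB _ ZN).
  by left; apply: le_trans ZN; rewrite /invhd_pt pt_normE le_max lexx orbT.
have -> : integralRn (fun x => I1 (fun t => H (pt t x) * \det (J (pt t x)))) =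
    integralRn (fun x => I1 (fun y => k (pt y x))).
  congr integralRn; apply/funext => x.
  transitivity (I1 (fun t => k (pt (hd (F (pt t x))) x) * j00 (J (pt t x)))).
    congr I1; apply/funext => t; rewrite /k hd_pt tl_pt /slice_jac /invhd_pt hdFK.
    by rewrite -mulrA; congr (_ * _); rewrite mulrC -det_schur// (j00_neq0 c0 FJ).
  apply: (@substitution1 R (fun t => hd (F (pt t x))) (fun t => j00 (J (pt t x)))
    (fun y => invhd c0 FJ y x) (fun y => k (pt y x)) N M) => //.
  - by move=> t; apply: (hdF_deriv FJ).
  - move=> t; apply: j00_cont.
    apply: (ct_comp (f := fun t => pt t x)); last exact: mc_cont FJ _.
    by apply: ct_pt; [exact: ct_id|exact: ct_cst].
  - by move=> s t; apply: (hdF_incr c0 FJ).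
  - by move=> t; rewrite invhdK.
  - exact: Cc_sliceR.
  - move=> t tN; rewrite /k hd_pt tl_pt /invhd_pt hdFK (cH.2 _) ?mul0r//.
    by apply: lt_le_trans tN _; rewrite pt_normE le_max lexx.
rewrite -(fubini_radon rn M0 ck) integralRn_rec.
congr I1; apply/funext => y.
rewrite [in RHS](_ : (fun x => _) = fun x => H (invhd_pt c0 FJ y (G y x))); last first.
  by apply/funext => x; rewrite hd_pt tl_pt.
rewrite [in LHS](_ : (fun x => _) = fun x => H (invhd_pt c0 FJ y x) * \det (slice_jac c0 FJ y x)); last first.
  by apply/funext => x; rewrite /k hd_pt tl_pt.
apply: ((HG y).2 N (fun x => H (invhd_pt c0 FJ y x))) => //; split=> x.
  apply: (ct_comp (f := fun x => invhd_pt c0 FJ y x) (g := H)); last exact: cH.1.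
  rewrite (_ : invhd_pt c0 FJ y = fun x => invhd_pt c0 FJ (hd (pt y x)) (tl (pt y x))); last first.
    by apply/funext => u; rewrite hd_pt tl_pt.
  apply: (ct_comp (f := fun x => pt y x) (g := fun z => invhd_pt c0 FJ (hd z) (tl z))).
    by apply: ct_pt; [exact: ct_cst|exact: ct_id].
  exact: invhd_pt_cont.
move=> xN; apply: cH.2; apply: lt_le_trans xN _.
by rewrite /invhd_pt pt_normE le_max lexx orbT.
Qed.

End cv.

(** * Functions of class C^2 and convexity *)

Section c1.
Context {R : realType}.

(** The mean value theorem from 0 to [v] for both signs of [v]. *)
Lemma mvt_sym (phi dphi : R -> R) (v : R) :
  (forall t, `|t| <= `|v| -> is_derive t (1:R) phi (dphi t)) ->
  exists2 t, `|t| <= `|v| & phi v - phi 0 = dphi t * v.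
Proof.
move=> H.
have ct t : `|t| <= `|v| -> {for t, continuous phi}.
  move=> /H dt; apply: differentiable_continuous; apply/derivable1_diffP.
  exact: (@ex_derive _ _ _ _ _ _ _ dt).
have cw a b : (forall t, a <= t <= b -> `|t| <= `|v|) -> {within `[a, b], continuous phi}.
  move=> ab; apply: continuous_in_subspaceT => t; rewrite inE/= in_itv/= => /ab; exact: ct.
have [v0|v0] := leP 0 v.
  have ab t : 0 <= t <= v -> `|t| <= `|v|.
    by move=> /andP[t0 tv]; rewrite !ger0_norm.
  have HD t : t \in `]0, v[ -> is_derive t (1:R) phi (dphi t).
    by rewrite in_itv/= => /andP[t0 tv]; apply: H; apply: ab; rewrite !ltW.
  have [t] := MVT_segment v0 HD (cw _ _ ab).
  rewrite in_itv/= => /ab tv; rewrite subr0 => E; by exists t.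
have ab t : v <= t <= 0 -> `|t| <= `|v|.
  by move=> /andP[t0 tv]; rewrite ler0_norm// ltr0_norm// lerN2.
have HD t : t \in `]v, 0[ -> is_derive t (1:R) phi (dphi t).
  by rewrite in_itv/= => /andP[t0 tv]; apply: H; apply: ab; rewrite !ltW.
have [t] := MVT_segment (ltW v0) HD (cw _ _ ab).
rewrite in_itv/= => /ab tv; rewrite sub0r mulrN => E; exists t => //.
by rewrite -[LHS]opprB E opprK.
Qed.

Lemma open_epsP (V : normedModType R) (E : set V) x : open E -> E x ->
  exists2 d, 0 < d & forall y, `|y - x| < d -> E y.
Proof.
move=> oE Ex; have /nbhs_ballP[d /= d0 Hd] := open_nbhs_nbhs (conj oE Ex).
by exists d => // y yx; apply: Hd; rewrite -ball_normE /= distrC.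
Qed.

(** Continuous partial derivatives give differentiability: the increment is split
    into steps along the coordinate axes, each treated by the mean value theorem. *)
Lemma C1_diffat m (E : set 'rV[R]_m) (h : 'rV[R]_m -> R) x : open E -> Ck 1 E h -> E x ->
  diffat h x (fun v => \sum_i v 0 i * partial i h x).
Proof.
move=> oE [_ Hh] Ex e e0.
have [dE dE0 HdE] := open_epsP oE Ex.
pose e' := e / (m%:R + 1); have e'0 : 0 < e' by rewrite divr_gt0// ltr_wpDl.
have /cont_epsP /(_ _ e'0)[d d0 Hd] : continuous_at x (fun y => \row_i partial i h y).
  apply: ct_mx => i j; apply: (ct_eq (g := partial j h)); first by move=> y; rewrite mxE.
  exact: ((Hh j).2.1 x Ex).
exists (Num.min dE d); first by rewrite lt_min dE0.
move=> v; rewrite lt_min => /andP[vE vd].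
pose tr k : 'rV[R]_m := \row_i (if (i < k)%N then v 0 i else 0).
have trle k : `|tr k| <= `|v|.
  apply/row_norm_le => // i; rewrite mxE; case: ifP => _; first exact: coord_le.
  by rewrite normr0.
have H k : (k <= m)%N ->
  `|h (x + tr k) - h x - \sum_(i < m | (i < k)%N) v 0 i * partial i h x| <= k%:R * (e' * `|v|).
  elim: k => [_|k IH km].
    rewrite big_pred0// (_ : tr 0%N = 0) ?addr0 ?subrr ?subr0 ?normr0 ?mul0r//.
    by apply/rowP => i; rewrite !mxE ltn0.
  pose ik := Ordinal km.
  have trS : tr k.+1 = tr k + v 0 ik *: delta_mx 0 ik.
    apply/rowP => i; rewrite !mxE ltnS leq_eqVlt eqxx/=.
    have [->|ik'] := eqVneq i ik; first by rewrite /= eqxx ltnn add0r mulr1.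
    rewrite mulr0 addr0; suff -> : (i == k :> nat) = false by [].
    by apply/negbTE; apply: contra ik' => /eqP ik'; apply/eqP/val_inj.
  pose y t := x + tr k + t *: delta_mx 0 ik.
  have ynear t : `|t| <= `|v 0 ik| -> `|y t - x| <= `|v|.
    move=> tv; have -> : y t - x = tr k + t *: delta_mx 0 ik by apply/rowP => i; rewrite !mxE; ring.
    apply/row_norm_le => // i; rewrite !mxE eqxx/=.
    have [->|ik'] := eqVneq i ik; first by rewrite /= ltnn add0r mulr1 (le_trans tv)// coord_le.
    rewrite mulr0 addr0; case: ifP => _; rewrite ?normr0 ?coord_le//.
  have dy t : `|t| <= `|v 0 ik| -> is_derive t (1:R) (fun t => h (y t)) (partial ik h (y t)).
    move=> tv; have Ey : E (y t) by apply: HdE; apply: le_lt_trans (ynear _ tv) _.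
    have dh := (Hh ik).1 _ Ey.
    have /is_derive_vepsP H : is_derive (y t) (delta_mx 0 ik) h (partial ik h (y t)).
      by apply: DeriveDef.
    apply/is_derive_epsP => a a0; have [b b0 Hb] := H a a0; exists b => // u /Hb.
    by rewrite /y scalerDl addrA.
  have [t tv E1] := mvt_sym dy.
  have -> : h (x + tr k.+1) = h (y 0) + partial ik h (y t) * v 0 ik.
    by rewrite -E1 [RHS]addrC subrK /y trS addrA.
  rewrite (bigD1 ik) ?ltnS ?leqnn//=.
  rewrite (eq_bigl (fun i : 'I_m => (i < k)%N)); last first.
    move=> i; rewrite ltnS leq_eqVlt; have [->|ik'] := eqVneq i ik; first by rewrite /= ltnn andbF.
    rewrite andbT; suff -> : (i == k :> nat) = false by [].
    by apply/negbTE; apply: contra ik' => /eqP ik'; apply/eqP/val_inj.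
  have -> : y 0 = x + tr k by rewrite /y scale0r addr0.
  set S := \sum_(i | _) _; have {}IH := IH (ltnW km).
  rewrite (_ : _ - _ = (h (x + tr k) - h x - S) + v 0 ik * (partial ik h (y t) - partial ik h x)); last by ring.
  apply: le_trans (ler_normD _ _) _; rewrite -natr1 mulrDl mul1r; apply: lerD; first exact: IH.
  rewrite normrM mulrC; apply: ler_pM => //; last exact: coord_le.
  apply/ltW; have /Hd : `|y t - x| < d by apply: le_lt_trans (ynear _ tv) _.
  by apply: le_lt_trans; have := coord_le ((\row_i partial i h (y t)) - (\row_i partial i h x)) ik; rewrite !mxE.
have := H m (leqnn m).
rewrite (_ : tr m = v); last by apply/rowP => i; rewrite mxE ltn_ord.
rewrite (eq_bigl xpredT); last by move=> i; rewrite ltn_ord.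
move/le_trans; apply; rewrite mulrA ler_wpM2r// /e' mulrCA ger_pMr//.
by rewrite ler_pdivrMr ?ltr_wpDl//; lra.
Qed.

Definition gradv m (g : 'rV[R]_m -> R) (z : 'rV[R]_m) : 'rV[R]_m := \row_j partial j g z.

Lemma CkW m k (E : set 'rV[R]_m) h : Ck k.+1 E h -> Ck k E h.
Proof.
elim: k h => [|k IH] h [ch H]; split => // i; split; first exact: (H i).1.
exact: IH (H i).2.
Qed.

Lemma grad_diffat m (E : set 'rV[R]_m) g z : open E -> Ck 2 E g -> E z ->
  diffat (gradv g) z (fun h => h *m hessian g z).
Proof.
move=> oE [_ Hg] Ez e e0.
have H i := C1_diffat oE (Hg i).2 Ez e0.
have {}H : forall i, {d | 0 < d & forall h : 'rV[R]_m, `|h| < d ->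
    `|partial i g (z + h) - partial i g z - \sum_j h 0 j * partial j (partial i g) z| <= e * `|h|}.
  by move=> i; apply: cid2.
exists (\big[Num.min/1]_i s2val (H i)).
  by elim/big_ind: _ => // [a b a0 b0|i _]; [rewrite lt_min a0 b0|exact: (s2valP (H i))].
move=> h hd; apply/row_norm_le => [|i]; first by rewrite mulr_ge0// ltW.
rewrite !mxE (eq_bigr (fun j => h 0 j * partial j (partial i g) z)); last first.
  by move=> j _; rewrite /hessian mxE.
apply: (s2valP' (H i)); apply: lt_le_trans hd _.
by have := @bigmin_le _ _ _ (1:R) i (fun i => s2val (H i)).
Qed.

Lemma hess_cont m (E : set 'rV[R]_m) g z : Ck 2 E g -> E z -> continuous_at z (hessian g).
Proof.
move=> [_ Hg] Ez; apply: ct_mx => i j.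
apply: (ct_eq (g := partial i (partial j g))); first by move=> y; rewrite mxE.
exact: (((Hg j).2.2 i).2.1 z Ez).
Qed.

Definition cvx m (E : set 'rV[R]_m) (g : 'rV[R]_m -> R) := forall x y t, E x -> E y ->
  0 <= t <= 1 -> g (x + t *: (y - x)) <= g x + t * (g y - g x).

Lemma convex_functionP m (E : set 'rV[R]_m) g : convex_function E g <-> cvx E g.
Proof.
split=> [H x y t Ex Ey /andP[t0 t1]|H t x y xE yE].
  have u0 : 0 <= 1 - t by lra.
  have u1 : 1 - t <= 1 by lra.
  have := H (Itv01 u0 u1) x y (mem_set Ex) (mem_set Ey).
  rewrite /conv/= /conv/= /GRing.scale/= /unstable.onem.
  rewrite (_ : scalemx _ x + _ = x + scalemx t (y - x)).
    move=> /le_trans; apply; rewrite le_eqVlt; apply/orP; left; apply/eqP; ring.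
  by apply/rowP => i; rewrite !mxE; ring.
have := H x y (1 - t%:num) (set_mem xE) (set_mem yE).
have t0 : 0 <= 1 - t%:num <= 1 by rewrite subr_ge0 gerBl le1/= ge0.
move=> /(_ t0).
rewrite /conv/= /conv/= /GRing.scale/= /unstable.onem.
rewrite (_ : scalemx _ x + _ = x + scalemx (1 - t%:num) (y - x)).
  move=> /le_trans; apply; rewrite le_eqVlt; apply/orP; left; apply/eqP; ring.
by apply/rowP => i; rewrite !mxE; ring.
Qed.

(** A differentiable convex function lies above its tangent planes. *)
Lemma cvx_grad m (E : set 'rV[R]_m) g z w L : cvx E g -> E z -> E w ->
  (forall a h, L (a *: h) = a * L h) -> diffat g z L -> g z + L (w - z) <= g w.
Proof.
move=> cg Ez Ew LZ dg; apply/ler_addgt0Pr => e e0.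
pose N := `|w - z| + 1; have N0 : 0 < N by rewrite ltr_wpDl.
have [d d0 Hd] := dg _ (divr_gt0 e0 N0).
pose t := Num.min 1 (d / 2 / N).
have t0 : 0 < t by rewrite lt_min ltr01 !divr_gt0.
have t1 : 0 <= t <= 1 by rewrite ltW//= ge_min lexx.
have tn : t * `|w - z| <= t * N by apply: ler_wpM2l; [exact: ltW|rewrite lerDl].
have td : `|t *: (w - z)| < d.
  rewrite normrZ gtr0_norm//; apply: le_lt_trans tn _.
  have : t <= d / 2 / N by rewrite ge_min lexx orbT.
  rewrite ler_pdivlMr//; lra.
have := Hd _ td; rewrite LZ => H1; have H2 := cg z w t Ez Ew t1.
have {}H1 : t * L (w - z) - t * e <= g (z + t *: (w - z)) - g z.
  have : e / N * `|t *: (w - z)| <= t * e.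
    rewrite normrZ gtr0_norm//; apply: (@le_trans _ _ (e / N * (t * N))).
      by apply: ler_wpM2l => //; rewrite divr_ge0// ltW.
    by rewrite le_eqVlt; apply/orP; left; apply/eqP; field; rewrite gt_eqF.
  by move: H1; rewrite ler_norml => /andP[H1 _]; lra.
rewrite -(ler_pM2l t0); lra.
Qed.

Lemma diffat_dotv m (E : set 'rV[R]_m) g z : open E -> Ck 2 E g -> E z ->
  diffat g z (fun h => dotv (gradv g z) h).
Proof.
move=> oE /CkW Cg Ez; 
move=> e e0; have [d d0 Hd] := C1_diffat oE Cg Ez e0; exists d => // h /Hd.
rewrite (_ : dotv _ _ = \sum_i h 0 i * partial i g z)//.
by rewrite /dotv; apply: eq_bigr => i _; rewrite mxE mulrC.
Qed.

Lemma dotvZr m (x : 'rV[R]_m) a h : dotv x (a *: h) = a * dotv x h.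
Proof. by rewrite /dotv mulr_sumr; apply: eq_bigr => i _; rewrite mxE; ring. Qed.
Lemma dotvDr m (x : 'rV[R]_m) h k : dotv x (h + k) = dotv x h + dotv x k.
Proof. by rewrite /dotv -big_split; apply: eq_bigr => i _; rewrite mxE /=; ring. Qed.
Lemma dotvBr m (x : 'rV[R]_m) h k : dotv x (h - k) = dotv x h - dotv x k.
Proof. by rewrite -scaleN1r dotvDr dotvZr mulN1r. Qed.
Lemma dotvC m (x y : 'rV[R]_m) : dotv x y = dotv y x.
Proof. by rewrite /dotv; apply: eq_bigr => i _; rewrite mulrC. Qed.
Lemma dotvDl m (x h k : 'rV[R]_m) : dotv (h + k) x = dotv h x + dotv k x.
Proof. by rewrite dotvC dotvDr !(dotvC x). Qed.
Lemma dotvBl m (x h k : 'rV[R]_m) : dotv (h - k) x = dotv h x - dotv k x.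
Proof. by rewrite dotvC dotvBr !(dotvC x). Qed.
Lemma dotvZl m (x : 'rV[R]_m) a h : dotv (a *: h) x = a * dotv h x.
Proof. by rewrite dotvC dotvZr (dotvC x). Qed.

Lemma dotv_ge m (x : 'rV[R]_m) : `|x| ^+ 2 <= dotv x x.
Proof.
case: m x => [|m] x.
  by rewrite (_ : x = 0) ?normr0 ?expr0n/= ?/dotv ?big_ord0//; apply/rowP => -[].
have d0 : 0 <= dotv x x by rewrite sumr_ge0// => i _; exact: sqr_ge0.
rewrite -(@ler_sqrt R) // sqrtr_sqr ger0_norm//.
apply/row_norm_le => [|i]; first exact: sqrtr_ge0.
rewrite -sqrtr_sqr ler_sqrt// /dotv (bigD1 i)//= expr2 lerDl sumr_ge0// => j _.
exact: sqr_ge0.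
Qed.

Lemma cvx_gradv m (E : set 'rV[R]_m) g z w : open E -> cvx E g -> Ck 2 E g -> E z -> E w ->
  g z + dotv (gradv g z) (w - z) <= g w.
Proof.
move=> oE cg Cg Ez Ew.
apply: (cvx_grad (L := fun h => dotv (gradv g z) h) cg Ez Ew); last exact: diffat_dotv Cg Ez.
by move=> a h; exact: dotvZr.
Qed.

(** The gradient of a convex function is monotone: add the two tangent inequalities. *)
Lemma cvx_grad_mono m (E : set 'rV[R]_m) g z w : open E -> cvx E g -> Ck 2 E g -> E z -> E w ->
  0 <= dotv (gradv g z - gradv g w) (z - w).
Proof.
move=> oE cg Cg Ez Ew; have := cvx_gradv oE cg Cg Ez Ew; have := cvx_gradv oE cg Cg Ew Ez.
have -> : w - z = (-1) *: (z - w) by rewrite scaleN1r opprB.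
rewrite dotvBl dotvZr; lra.
Qed.

End c1.

(** * The Monge-Ampere integral on the strip, slice by slice *)

Section stripdefs.
Context {R : realType}.

Lemma open_eps (V : normedModType R) (E : set V) :
  (forall x, E x -> exists2 d, 0 < d & forall y, `|y - x| < d -> E y) -> open E.
Proof.
move=> H; rewrite openE => x /H [d d0 Hd]; apply/nbhs_ballP; exists d => //= y.
by rewrite -ball_normE /= distrC; exact: Hd.
Qed.

Lemma open_open_strip n : open (@open_strip R n).
Proof.
apply: open_eps => z; rewrite /open_strip/= -/(hd z) => /andP[z0 z1].
exists (Num.min (hd z) (1 - hd z)); first by rewrite lt_min z0; lra.
move=> y; rewrite lt_min /open_strip/= -/(hd y) => /andP[y1 y2].
have := hd_le (y - z); rewrite hdB => hh.
have := le_lt_trans hh y1; have := le_lt_trans hh y2; rewrite !ltr_norml.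
move=> /andP[a1 a2] /andP[b1 b2]; apply/andP; split; lra.
Qed.

(** These boxes exhaust the open strip; every compact subset lies in one. *)
Definition Kbox n (d N : R) : set 'rV[R]_(1 + n) :=
  [set z | d <= hd z <= 1 - d /\ `|z| <= N].

Lemma Kbox_compact n d N : compact (@Kbox n d N).
Proof.
apply: (subclosed_compact _ (@ball0_compact R (1 + n) N)); last by move=> z [].
have -> : @Kbox n d N = (@hd R n @^-1` [set r | d <= r]) `&` (@hd R n @^-1` [set r | r <= 1 - d])
    `&` ((fun z => `|z|) @^-1` [set r | r <= N]).
  by apply/seteqP; split => z; [move=> [/andP[]]|move=> [[h1 h2] h3]; split=> //; apply/andP].
apply: closedI; [apply: closedI|].
- by apply: closed_comp; [move=> z _; exact: ct_hd|exact: closed_ge].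
- by apply: closed_comp; [move=> z _; exact: ct_hd|exact: closed_le].
- apply: closed_comp; last exact: closed_le.
  by move=> z _; apply: (@ct_norm R _ _ id); exact: ct_id.
Qed.

Lemma Kbox_sub n d N : 0 < d -> @Kbox n d N `<=` @open_strip R n.
Proof. by move=> d0 z [/andP[z1 z2] _]; rewrite /open_strip/= -/(hd z); apply/andP; split; lra. Qed.

Lemma compact_Kbox n K : compact K -> K `<=` @open_strip R n ->
  exists d N, [/\ 0 < d, 0 <= N & K `<=` @Kbox n d N].
Proof.
move=> cK KO; have [K0|/set0P Kz0] := eqVneq K set0.
  by exists 1, 0; split => //; rewrite K0; exact: sub0set.
have ch : {within K, continuous (@hd R n)} by apply: continuous_subspaceT => z; exact: ct_hd.
have [a Ka Ha] := compact_EVT_min Kz0 cK ch.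
have [b Kb Hb] := compact_EVT_max Kz0 cK ch.
have cn : {within K, continuous (fun z : 'rV[R]_(1 + n) => `|z|)}.
  by apply: continuous_subspaceT => z; apply: (@ct_norm R _ _ id); exact: ct_id.
have [c Kc Hc] := compact_EVT_max Kz0 cK cn.
exists (Num.min (hd a) (1 - hd b)), `|c|; split => //.
  have := KO _ (set_mem Ka); have := KO _ (set_mem Kb); rewrite /open_strip/= -!/(hd _) lt_min.
  by move=> /andP[_ ?] /andP[-> _] /=; lra.
move=> z Kz; have zK := mem_set Kz; split; last exact: Hc.
have := Ha _ zK; have := Hb _ zK; move=> h1 h2; apply/andP; split.
  by rewrite ge_min h2.
have : Num.min (hd a) (1 - hd b) <= 1 - hd b by rewrite ge_min lexx orbT.
lra.
Qed.

Lemma compact_bd (V W : normedModType R) (K : set V) (F : V -> W) : compact K ->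
  (forall z, K z -> continuous_at z F) -> exists2 B, 0 <= B & forall z, K z -> `|F z| <= B.
Proof.
move=> cK cF; have [K0|/set0P Kz0] := eqVneq K set0.
  by exists 0 => // z; rewrite K0.
have ch : {within K, continuous (fun z => `|F z|)}.
  by apply: continuous_in_subspaceT => z /set_mem Kz; apply: ct_norm; exact: cF.
have [b Kb Hb] := compact_EVT_max Kz0 cK ch.
by exists `|F b| => // z Kz; apply: Hb; exact: mem_set.
Qed.

Definition tests n d N (chi : 'rV[R]_(1 + n) -> R) :=
  continuous chi /\ forall z, ~ Kbox d N z -> chi z = 0.

Lemma test_tests n chi : test_function (@open_strip R n) chi ->
  exists d N, [/\ 0 < d, 0 <= N & tests d N chi].
Proof.
move=> [cc [K [cK KO K0]]]; have [d [N [d0 N0 KB]]] := compact_Kbox cK KO.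
by exists d, N; split => //; split => // z zB; apply: K0 => /KB.
Qed.

Lemma tests_test n d N chi : 0 < d -> tests d N chi -> test_function (@open_strip R n) chi.
Proof.
move=> d0 [cc H]; split => //; exists (Kbox d N); split => //; first exact: Kbox_compact.
exact: Kbox_sub.
Qed.

Lemma tests_Cc n d N chi : @tests n d N chi -> Cc N chi.
Proof.
move=> [cc H]; split => // z Nz; apply: H => -[_]; rewrite leNgt Nz//.
Qed.

Lemma testsM n d N chi (f : 'rV[R]_(1 + n) -> R) : 0 < d -> tests d N chi ->
  (forall z, open_strip z -> continuous_at z f) -> tests d N (fun z => chi z * f z).
Proof.
move=> d0 [cc H] cf; split=> [z|z /H ->]; last by rewrite mul0r.
have [Oz|nOz] := pselect (open_strip z); first by apply: ctM; [exact: cc|exact: cf].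
apply/cont_epsP => e e0; exists d => // y yz.
suff h w : `|w - z| < d -> chi w = 0.
  by rewrite !h ?subrr ?normr0 ?mul0r// ?subrr ?normr0.
move=> wz; apply: H => -[/andP[w1 w2] _]; apply: nOz.
have := le_lt_trans (hd_le _) wz; rewrite hdB ltr_norml /open_strip/= -/(hd z) => /andP[a1 a2].
apply/andP; split; lra.
Qed.

End stripdefs.

Section strip.
Context {R : realType} {n : nat}.
Variables (kap : R) (P : 'rV[R]_(1 + n) -> 'rV[R]_(1 + n)) (H : 'rV[R]_(1 + n) -> 'M[R]_(1 + n)).
Notation Om := (@open_strip R n).

(** The properties of P = grad (g + kappa |x|^2 / 2) and H = P' that the slicing argument
    uses: monotone on the strip, with constant [kap] in the x directions only. *)
Record stripF : Prop := StripF {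
  sf_diff : forall z, Om z -> diffat P z (fun h => h *m H z) ;
  sf_cont : forall z, Om z -> continuous_at z H ;
  sf_mono : forall z w, Om z -> Om w ->
    kap * `|tl (z - w)| ^+ 2 <= dotv (P z - P w) (z - w) }.

Hypothesis k0 : 0 < kap.
Hypothesis sf : stripF.

Lemma Om_pt s x : 0 < s < 1 -> Om (pt s x).
Proof. by move=> s01; rewrite /open_strip/= -/(hd (pt s x)) hd_pt. Qed.

Lemma P_cont z : Om z -> continuous_at z P.
Proof. by move=> Oz; exact: diffat_mx_cont (sf_diff sf Oz). Qed.

(** For points in the same slice the s-components do not enter the scalar product, so
    the x-component of [P] is strongly monotone in x. *)
Lemma strip_monoC1 s : 0 < s < 1 ->
  monoC1 kap (fun x => tl (P (pt s x))) (fun x => drsubmx (H (pt s x))).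
Proof.
move=> s01; split=> [x|x|x y].
- move=> e e0; have [d d0 Hd] := sf_diff sf (Om_pt x s01) e0.
  exists d => // h hd; have := Hd (pt 0 h); rewrite pt_normE normr0 max_r//.
  move=> /(_ hd); apply: le_trans; apply: le_trans (tl_le _).
  by rewrite !tlB tl_mulmx hd_pt tl_pt scale0r add0r ptD addr0.
- apply: ct_mx => i j.
  apply: (ct_eq (g := fun x => H (pt s x) (rshift 1 i) (rshift 1 j))).
    by move=> y; rewrite !mxE.
  apply: ct_coord; apply: (ct_comp (f := fun x => pt s x) (g := H)).
    by apply: ct_pt; [exact: ct_cst|exact: ct_id].
  exact: sf_cont (Om_pt x s01).
- have := sf_mono sf (Om_pt x s01) (Om_pt y s01).
  by rewrite dotv_pt !ptB hd_pt tl_pt subrr mulr0 add0r tlB.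
Qed.

Lemma dr_unit z : Om z -> drsubmx (H z) \in unitmx.
Proof.
move=> Oz; rewrite -row_free_unit; apply: inj_row_free => v vA.
apply/eqP; rewrite -normr_eq0; apply/negPn/negP => v0.
have {}v0 : 0 < `|v| by rewrite lt_neqAle eq_sym v0 normr_ge0.
have [dO dO0 HO] := open_epsP (@open_open_strip R n) Oz.
have e0 : 0 < kap / (n%:R + 1) / 2 by rewrite !divr_gt0// ltr_wpDl.
have [d d0 Hd] := sf_diff sf Oz e0.
pose t := Num.min d dO / 2 / `|v|.
have m0 : 0 < Num.min d dO by rewrite lt_min d0.
have t0 : 0 < t by rewrite !divr_gt0.
have wn : `|pt 0 (t *: v)| = Num.min d dO / 2.
  by rewrite pt_normE normr0 max_r// normrZ gtr0_norm// /t mulfVK// gt_eqF.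
have wl : `|pt 0 (t *: v)| < Num.min d dO by rewrite wn; lra.
move: (wl); rewrite lt_min => /andP[wd wO].
have := Hd _ wd; set w := pt 0 (t *: v); set r := _ - _ => Hr.
have Ow : Om (z + w) by apply: HO; rewrite [z + w]addrC addrK.
have := sf_mono sf Ow Oz; rewrite [z + w]addrC addrK.
have tlr : tl (P (w + z) - P z) = tl r.
  rewrite /r [RHS]tlB tl_mulmx /w hd_pt tl_pt scale0r add0r -scalemxAl vA scaler0 subr0.
  by rewrite [z + _]addrC.
rewrite dotv_pt tlr /w hd_pt tl_pt mulr0 add0r -/w => M.
have := le_trans M (dotv_le _ _); rewrite normrZ gtr0_norm//.
have : `|tl r| <= kap / (n%:R + 1) / 2 * (t * `|v|).
  apply: le_trans (tl_le _) _; apply: le_trans Hr _.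
  by rewrite /w pt_normE normr0 max_r// normrZ gtr0_norm.
have tv : 0 < t * `|v| by rewrite mulr_gt0.
set a := t * `|v| in tv * => h1 h2.
have {h1 h2} : kap * a ^+ 2 <= n%:R * (kap / (n%:R + 1) / 2 * a * a).
  apply: le_trans h2 _; apply: ler_wpM2l => //; apply: ler_wpM2r => //; exact: ltW.
have -> : n%:R * (kap / (n%:R + 1) / 2 * a * a) = (kap * a ^+ 2) * (n%:R / (n%:R + 1) / 2) by ring.
have p0 : 0 < kap * a ^+ 2 by rewrite mulr_gt0// exprn_gt0.
rewrite ler_pMr// leNgt => /negP; apply.
by rewrite ltr_pdivrMr// ltr_pdivrMr ?ltr_wpDl//; have := ler0n R n; lra.
Qed.

Lemma G_exists : exists G : R -> 'rV[R]_n -> 'rV[R]_n, forall s, 0 < s < 1 ->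
  (forall y, tl (P (pt s (G s y))) = y) /\
  forall N (h : 'rV[R]_n -> R), 0 <= N -> Cc N h ->
    integralRn (fun x => h x * \det (drsubmx (H (pt s x)))) =
    integralRn (fun y => h (G s y)).
Proof.
have : forall s, exists G : 'rV[R]_n -> 'rV[R]_n, 0 < s < 1 ->
  (forall y, tl (P (pt s (G y))) = y) /\
  forall N (h : 'rV[R]_n -> R), 0 <= N -> Cc N h ->
    integralRn (fun x => h x * \det (drsubmx (H (pt s x)))) =
    integralRn (fun y => h (G y)).
  move=> s; have [s01|] := boolP (0 < s < 1); last by exists id.
  have [G [G1 G2]] := change_of_variables k0 (strip_monoC1 s01).
  by exists G => _; split.
by move=> /choice[G HG]; exists G.
Qed.

(** The point x of the slice s at which the x-component of [P] takes the value y; for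
    a gradient P it minimizes g(s,.) + kappa |.|^2 / 2 - <.,y>. *)
Definition Xs : R -> 'rV[R]_n -> 'rV[R]_n := projT1 (cid G_exists).

Lemma XsK s y : 0 < s < 1 -> tl (P (pt s (Xs s y))) = y.
Proof. by move=> s01; exact: (projT2 (cid G_exists) s s01).1. Qed.

Lemma Xs_int s N (h : 'rV[R]_n -> R) : 0 < s < 1 -> 0 <= N -> Cc N h ->
    integralRn (fun x => h x * \det (drsubmx (H (pt s x)))) =
    integralRn (fun y => h (Xs s y)).
Proof. by move=> s01; exact: (projT2 (cid G_exists) s s01).2. Qed.

(** The s-component of [P] along the curve of constant x-component y. In terms of the
    Legendre transform in x it is minus the s-derivative of the transform at y. *)
Definition tau (y : 'rV[R]_n) (s : R) := hd (P (pt s (Xs s y))).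
(** The Schur complement of the x-block, as a quotient of determinants. *)
Definition Ws z := \det (H z) / \det (drsubmx (H z)).

Lemma Xs_lip s s' y y' : 0 < s < 1 -> 0 < s' < 1 ->
  `|Xs s y - Xs s' y'| <= n%:R / kap *
     (`|y - y'| + `|tl (P (pt s' (Xs s' y'))) - tl (P (pt s (Xs s' y')))|).
Proof.
move=> s01 s'01.
have M := mc_mono (strip_monoC1 s01) (Xs s y) (Xs s' y').
apply: le_trans (mono_lip (F := fun x => tl (P (pt s x))) k0 M) _.
apply: ler_wpM2l; first by rewrite divr_ge0// ltW.
rewrite !XsK// (_ : y - _ = (y - y') + (y' - tl (P (pt s (Xs s' y'))))).
  exact: ler_normD.
by rewrite addrA subrK.
Qed.

Lemma Xs_cont z : Om z -> continuous_at z (fun z => Xs (hd z) (tl z)).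
Proof.
move=> Oz; apply/cont_epsP => e e0.
have [dO dO0 HO] := open_epsP (@open_open_strip R n) Oz.
pose x := Xs (hd z) (tl z).
have C0 : 0 < n%:R / kap + 1 by rewrite ltr_wpDl// divr_ge0// ltW.
have e20 : 0 < e / 2 / (n%:R / kap + 1) by rewrite !divr_gt0.
have /cont_epsP /(_ _ e20)[d d0 Hd] : continuous_at (hd z) (fun s => tl (P (pt s x))).
  apply: (ct_comp (f := fun s => P (pt s x)) (g := @tl R n)); last exact: ct_tl.
  apply: (ct_comp (f := fun s => pt s x) (g := P)).
    by apply: ct_pt; [exact: ct_id|exact: ct_cst].
  apply: P_cont; exact: Om_pt.
exists (Num.min dO (Num.min d (e / 2 / (n%:R / kap + 1)))).
  by rewrite !lt_min dO0 d0.
move=> w; rewrite !lt_min => /and3P[w1 w2 w3].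
have Ow := HO _ w1.
apply: le_lt_trans (Xs_lip _ _ _ _) _ => //.
have h1 := le_lt_trans (tl_le _) w3; rewrite tlB in h1.
have := Hd (hd w); rewrite -hdB => /(_ (le_lt_trans (hd_le _) w2)).
rewrite distrC => h2; have h := ltrD h1 h2.
apply: (@le_lt_trans _ _ ((n%:R / kap) * (e / (n%:R / kap + 1)))).
  apply: ler_wpM2l; first by rewrite divr_ge0// ltW.
  rewrite (_ : e / _ = e / 2 / (n%:R / kap + 1) + e / 2 / (n%:R / kap + 1)); last by lra.
  exact: ltW.
by rewrite mulrCA gtr_pMr// ltr_pdivrMr// mul1r ltrDl.
Qed.

Lemma ZXs_cont z : Om z -> continuous_at z (fun z => pt (hd z) (Xs (hd z) (tl z))).
Proof. by move=> Oz; apply: ct_pt; [exact: ct_hd|exact: Xs_cont]. Qed.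

Lemma Ws_cont z : Om z -> continuous_at z Ws.
Proof.
move=> Oz; apply: ctM; first by apply: ct_det; exact: sf_cont.
apply: ctV; first by rewrite -unitfE -unitmxE; exact: dr_unit.
apply: ct_det; apply: ct_mx => i j.
apply: (ct_eq (g := fun z => H z (rshift 1 i) (rshift 1 j))); first by move=> w; rewrite !mxE.
by apply: ct_coord; exact: sf_cont.
Qed.

(** Differentiating tl P = y along the curve gives the velocity of [Xs]; inserting it
    in the s-component leaves the Schur complement [Ws]. *)
Lemma tau_deriv (y : 'rV[R]_n) (s : R) : 0 < s < 1 ->
  is_derive s (1:R) (tau y) (Ws (pt s (Xs s y))).
Proof.
move=> s01; set x := Xs s y; set z := pt s x; have Oz : Om z by exact: Om_pt.
set A := H z; have uA := dr_unit Oz; rewrite -/A in uA.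
apply/is_derive_epsP => e e0.
pose C := (1 + n)%:R * `|A|.
have C0 : 0 <= C by rewrite mulr_ge0.
have [d1 d10 Hd1] := diffat_lip C0 (fun h => mulmx_le h A) (sf_diff sf Oz).
pose C' := n%:R / kap * (C + 1) + 1.
have C'1 : 1 <= C' by rewrite lerDr mulr_ge0 ?divr_ge0 ?addr_ge0// ltW.
have C'0 : 0 < C' by apply: lt_le_trans C'1.
pose B := invmx (drsubmx A) *m dlsubmx A.
pose K := 1 + n%:R * `|B|.
have K0 : 0 < K by rewrite ltr_pwDl// mulr_ge0.
have [d2 d20 Hd2] := sf_diff sf Oz (divr_gt0 (divr_gt0 e0 C'0) K0).
exists (Num.min (Num.min s (1 - s)) (Num.min d1 (d2 / C'))).
  by rewrite !lt_min d10 divr_gt0//; have /andP[-> ?] := s01; rewrite /= andbT; lra.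
move=> k; rewrite !lt_min => /andP[/andP[ks1 ks2] /andP[kd1]].
rewrite ltr_pdivlMr// => kd2.
have sk01 : 0 < s + k < 1.
  by move: ks1 ks2; rewrite !ltr_norml => /andP[? ?] /andP[? ?]; apply/andP; split; lra.
set v := Xs (s + k) y - x.
have vn : `|pt k v| <= C' * `|k|.
  apply: pt_norm_le; first by rewrite ler_peMl.
  apply: le_trans (Xs_lip _ _ _ _) _ => //; rewrite subrr normr0 add0r -/x -/z.
  rewrite distrC.
  apply: (@le_trans _ _ (n%:R / kap * ((C + 1) * `|k|))); last first.
    by rewrite mulrA ler_wpM2r// lerDl.
  apply: ler_wpM2l; first by rewrite divr_ge0// ltW.
  rewrite -tlB; apply: le_trans (tl_le _) _; have := Hd1 (pt k 0).
  by rewrite pt_normE normr0 max_l// ptD addr0; apply.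
have vd : `|pt k v| < d2 by apply: le_lt_trans vn _; rewrite mulrC.
have := Hd2 _ vd; set r := _ - _ => Hr.
have zv : z + pt k v = pt (s + k) (Xs (s + k) y) by rewrite /z ptD /v [x + _]addrC subrK.
have tlr : tl r = - (k *: ursubmx A + v *m drsubmx A).
  by rewrite /r !tlB zv !XsK// subrr sub0r tl_mulmx hd_pt tl_pt.
have vE : v = - ((k *: ursubmx A + tl r) *m invmx (drsubmx A)).
  apply: (can_inj (mulmxK uA)); rewrite mulNmx mulmxKV// tlr.
  by rewrite opprD opprK addKr.
have hdr : hd r = tau y (s + k) - tau y s - (k * j00 A + (v *m dlsubmx A) 0 0).
  by rewrite /r !hdB zv hd_mulmx hd_pt tl_pt.
have WE : Ws z = j00 A - (ursubmx A *m B) 0 0.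
  rewrite /Ws -/A; apply: (mulIf (x := \det (drsubmx A))).
    by rewrite -unitfE -unitmxE.
  rewrite divfK; last by rewrite -unitfE -unitmxE.
  pose Q : 'M[R]_(1 + n) := block_mx 1%:M (- (ursubmx A *m invmx (drsubmx A))) 0 1%:M.
  have dQ : \det Q = 1 by rewrite det_ublock !det1 mulr1.
  rewrite -[LHS]mul1r -dQ -det_mulmx -[A in Q *m A]submxK /Q mulmx_block !mul1mx !mul0mx !add0r.
  rewrite !mulNmx mulmxKV// subrr det_lblock; congr (_ * _).
  by rewrite det_mx11 -mulmxA -/B /j00 mxE; congr (_ + _); rewrite mxE.
have -> : tau y (s + k) - tau y s - k * Ws z = hd r - (tl r *m B) 0 0.
  rewrite hdr WE vE mulNmx -mulmxA -/B mulmxDl -scalemxAl.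
  have eN (M : 'M[R]_1) : (- M) 0 0 = - M 0 0 by rewrite mxE.
  have eD (M N : 'M[R]_1) : (M + N) 0 0 = M 0 0 + N 0 0 by rewrite mxE.
  have eZ a (M : 'M[R]_1) : (a *: M) 0 0 = a * M 0 0 by rewrite mxE.
  by rewrite eN eD eZ; ring.
apply: (@le_trans _ _ (`|r| * K)).
  rewrite /K mulrDr mulr1; apply: le_trans (ler_normB _ _) _; apply: lerD; first exact: hd_le.
  apply: le_trans (coord_le _ _) _; apply: le_trans (mulmx_le _ _) _.
  by rewrite mulrC ler_wpM2r ?mulr_ge0// tl_le.
have -> : e * `|k| = e / C' / K * (C' * `|k|) * K by field; rewrite !gt_eqF.
apply: ler_wpM2r; first exact: ltW.
apply: le_trans Hr _; apply: ler_wpM2l => //.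
by rewrite divr_ge0 ?divr_ge0// ltW.
Qed.

(** Monotonicity of [P] between two points with the same x-component. *)
Lemma tau_nondecr (y : 'rV[R]_n) (s s' : R) : 0 < s < 1 -> 0 < s' < 1 -> s <= s' -> tau y s <= tau y s'.
Proof.
move=> s01 s'01; rewrite le_eqVlt => /predU1P[->//|ss].
have := sf_mono sf (Om_pt (Xs s' y) s'01) (Om_pt (Xs s y) s01).
rewrite dotv_pt !tlB !XsK// subrr !hdB !hd_pt !tl_pt.
rewrite [dotv 0 _](_ : _ = 0) ?addr0; last first.
  by rewrite /dotv big1// => i _; rewrite mxE mul0r.
move=> M; have : 0 <= (tau y s' - tau y s) * (s' - s).
  by apply: le_trans M; rewrite mulr_ge0 ?exprn_ge0// ltW.
by rewrite pmulr_lge0 ?subr_gt0// subr_ge0.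
Qed.

(** The integrand chi(s, X(s,y)) tau_y'(s), as a function of (s, y). *)
Definition kern chi z := chi (pt (hd z) (Xs (hd z) (tl z))) * Ws (pt (hd z) (Xs (hd z) (tl z))).

Lemma kern_tests d N chi : 0 < d -> 0 <= N -> tests d N chi ->
  exists M, [/\ 0 <= M, Cc M (kern chi) & forall z, ~ d <= hd z <= 1 - d -> kern chi z = 0].
Proof.
move=> d0 N0 tc; have [B B0 HB] := compact_bd (@Kbox_compact R n d N)
  (fun z Kz => P_cont (Kbox_sub d0 Kz)).
have tcw := testsM d0 tc Ws_cont.
have z0 z : ~ d <= hd z <= 1 - d -> kern chi z = 0.
  by move=> nz; apply: tcw.2 => -[]; rewrite hd_pt.
exists (Num.max B 1); split => //; first by rewrite le_max B0.
split=> z.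
  have [Oz|nOz] := pselect (open_strip z).
    apply: (ct_comp (f := fun z => pt (hd z) (Xs (hd z) (tl z))) (g := fun z => chi z * Ws z)).
      exact: ZXs_cont.
    exact: tcw.1.
  apply/cont_epsP => e e0; exists d => // y yz.
  suff h w : `|w - z| < d -> kern chi w = 0 by rewrite !h ?subrr ?normr0.
  move=> wz; apply: z0 => /andP[w1 w2]; apply: nOz.
  have := le_lt_trans (hd_le _) wz; rewrite hdB ltr_norml /open_strip/= -/(hd z) => /andP[a1 a2].
  apply/andP; split; lra.
move=> zM; rewrite /kern (tc.2 _) ?mul0r// => Kz.
move: zM; rewrite ltNge => /negP; apply; rewrite -(pt_hd_tl z) pt_normE ge_max.
have := Kz; rewrite /Kbox/= hd_pt => -[/andP[z1 z2] _]; apply/andP; split; rewrite le_max.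
  by apply/orP; right; rewrite ler_norml; apply/andP; split; lra.
have s01 : 0 < hd z < 1 by apply/andP; split; lra.
by apply/orP; left; rewrite -{1}(XsK (tl z) s01); apply: le_trans (tl_le _) (HB _ Kz).
Qed.

(** Change of variables y = tl P(s,x) in each slice; the determinant of the slice map
    is that of the x-block of [H], and the quotient that remains is [Ws]. *)
Theorem strip_formula d N chi : 0 < d -> 0 <= N -> tests d N chi ->
  integralRn (fun z => chi z * \det (H z)) =
  integralRn (fun y => I1 (fun s => kern chi (pt s y))).
Proof.
move=> d0 N0 tc; have [M [M0 cM kz]] := kern_tests d0 N0 tc.
rewrite -(fubini_radon (@radon_integralRn R n) M0 cM) integralRn_rec.
congr I1; apply/funext => s.
have [s01|ns] := boolP (0 < s < 1); last first.
  have h1 x : chi (pt s x) = 0.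
    by apply: tc.2 => -[]; rewrite hd_pt => /andP[a b] _; move/negP: ns; apply; apply/andP; split; lra.
  congr integralRn; apply/funext => x; rewrite h1 mul0r kz// hd_pt => /andP[a b].
  by move/negP: ns; apply; apply/andP; split; lra.
have tcw := testsM d0 tc Ws_cont.
apply: (etrans _ (etrans (Xs_int s01 N0 (Cc_slice s (tests_Cc tcw))) _)).
  congr integralRn; apply/funext => x; rewrite -mulrA; congr (_ * _).
  by rewrite /Ws divfK// -unitfE -unitmxE dr_unit//; exact: Om_pt.
by congr integralRn; apply/funext => x; rewrite /kern hd_pt tl_pt.
Qed.

End strip.

(** * Gradients of convex functions on the strip and their limits *)

Section cluster_point.
Context {R : realType}.

(** Cluster points suffice where convergent subsequences would be
    extracted: inequalities pass to them ([acc_le]). *)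
Definition cluster_point m (w : nat -> 'rV[R]_m) w0 :=
  forall e J, 0 < e -> exists2 j, (J <= j)%N & `|w j - w0| < e.

Lemma acc_exists m (w : nat -> 'rV[R]_m) N : (forall j, `|w j| <= N) -> exists w0, cluster_point w w0.
Proof.
move=> wN; have := @ball0_compact R m N (w @ \oo) _.
case.
  by exists 0%N => // j _; exact: wN.
move=> w0 [_ cl]; exists w0 => e J e0.
have hw : (w @ \oo) (w @` [set j | (J <= j)%N]) by exists J => // j /= Jj; exists j.
have [v [[j Jj <-] wv]] := cl _ _ hw (nbhs_norm_lt w0 e0).
by exists j.
Qed.

Lemma acc_le m (w : nat -> 'rV[R]_m) w0 (phi : 'rV[R]_m -> R) c : cluster_point w w0 ->
  continuous_at w0 phi ->
  (forall e, 0 < e -> exists J, forall j, (J <= j)%N -> phi (w j) <= c + e) ->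
  phi w0 <= c.
Proof.
move=> ac /cont_epsP cp H; apply/ler_addgt0Pr => e e0.
have e2 : 0 < e / 2 by rewrite divr_gt0.
have [J HJ] := H _ e2; have [d d0 Hd] := cp _ e2.
have [j Jj wj] := ac d J d0; have := HJ _ Jj; have := Hd _ wj.
rewrite ltr_norml => /andP[h1 h2]; lra.
Qed.

Lemma ct_lsub n1 n2 (w : 'rV[R]_(n1 + n2)) : continuous_at w (@lsubmx R 1 n1 n2).
Proof.
apply: ct_mx => i j; apply: (ct_eq (g := fun w : 'rV[R]_(n1 + n2) => w i (lshift n2 j))).
  by move=> y; rewrite mxE.
by apply: ct_coord; exact: ct_id.
Qed.
Lemma ct_rsub n1 n2 (w : 'rV[R]_(n1 + n2)) : continuous_at w (@rsubmx R 1 n1 n2).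
Proof.
apply: ct_mx => i j; apply: (ct_eq (g := fun w : 'rV[R]_(n1 + n2) => w i (rshift n1 j))).
  by move=> y; rewrite mxE.
by apply: ct_coord; exact: ct_id.
Qed.

Lemma ct_dotv (V : normedModType R) m (f g : V -> 'rV[R]_m) x :
  continuous_at x f -> continuous_at x g -> continuous_at x (fun y => dotv (f y) (g y)).
Proof. by move=> cf cg; apply: ct_sum => i; apply: ctM; exact: ct_coord. Qed.

Lemma ctBv (V W : normedModType R) (f g : V -> W) x : continuous_at x f -> continuous_at x g ->
  continuous_at x (fun y => f y - g y).
Proof. by move=> cf cg; apply: cvgB. Qed.

Lemma norm_row_mx a b (x : 'rV[R]_a) (y : 'rV[R]_b) N : `|x| <= N -> `|y| <= N -> `|row_mx x y| <= N.
Proof.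
move=> xN yN; have N0 : 0 <= N by exact: le_trans xN.
apply/row_norm_le => // i; rewrite mxE.
by case: splitP => j _; apply: (row_norm_le _ N0).2.
Qed.

End cluster_point.

Section pk.
Context {R : realType} {n : nat}.
Local Notation Om := (@open_strip R n).
Implicit Types (g f : 'rV[R]_(1 + n) -> R) (kap : R).

(** The gradient and the Hessian of g + kap |x|^2 / 2. The quadratic term is in x only:
    it makes the slice maps strongly monotone. *)
Definition Pk kap g z := gradv g z + pt 0 (kap *: tl z).
Definition Hk kap g z : 'M[R]_(1 + n) := hessian g z + block_mx 0 0 0 (kap%:M).

Lemma mul_block0 kap (h : 'rV[R]_(1 + n)) :
  h *m (block_mx 0 0 0 (kap%:M) : 'M[R]_(1 + n)) = pt 0 (kap *: tl h).
Proof.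
rewrite -{1}(hsubmxK h) mul_row_block !mulmx0 !add0r mul_mx_scalar /pt /tl.
by congr row_mx; apply/rowP => i; rewrite !mxE mul0rn.
Qed.

Lemma dotv_pt0 (a : 'rV[R]_n) (w : 'rV[R]_(1 + n)) : dotv (pt 0 a) w = dotv a (tl w).
Proof. by rewrite dotv_pt hd_pt tl_pt mul0r add0r. Qed.

Lemma Om_open : open Om. Proof. exact: open_open_strip. Qed.

Lemma stripF_Pk kap g : 0 < kap -> Ck 2 Om g -> cvx Om g -> stripF kap (Pk kap g) (Hk kap g).
Proof.
move=> k0 Cg cg; split=> [z Oz|z Oz|z w Oz Ow].
- move=> e e0; have [d d0 Hd] := grad_diffat Om_open Cg Oz e0.
  exists d => // h /Hd; rewrite /Pk /Hk mulmxDr mul_block0.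
  rewrite (_ : gradv g (z + h) + _ - _ - _ = gradv g (z + h) - gradv g z - h *m hessian g z)//.
  rewrite tlD scalerDr -{1}[0]addr0 -ptD.
  move: (gradv g _) (gradv g z) (pt 0 _) (pt 0 _) (h *m _) => a b c d' m.
  by apply/rowP => i; rewrite !mxE; ring.
- apply: ct_mx => i j.
  apply: (ct_eq (g := fun z => hessian g z i j + (block_mx 0 0 0 (kap%:M) : 'M[R]_(1 + n)) i j)).
    by move=> y; rewrite /Hk mxE.
  by apply: ctD; [apply: ct_coord; exact: hess_cont Cg Oz|exact: ct_cst].
- have M := cvx_grad_mono Om_open cg Cg Oz Ow.
  have -> : Pk kap g z - Pk kap g w = (gradv g z - gradv g w) + pt 0 (kap *: tl (z - w)).
    rewrite /Pk tlB scalerBr -{3}[0]subr0 -ptB.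
    move: (gradv g _) (gradv g z) (pt 0 _) (pt 0 _) => a b c d'.
    by apply/rowP => i; rewrite !mxE; ring.
  rewrite dotvDl dotv_pt0 dotvZl.
  by rewrite -[X in X <= _]add0r lerD// ler_wpM2l ?dotv_ge// ltW.
Qed.

(** The determinant of the perturbed Hessian is polynomial in kap with coefficients
    continuous on the support of chi. *)
Lemma MA_limit d N chi g e : 0 < d -> tests d N chi -> Ck 2 Om g -> 0 < e ->
  exists2 k0, 0 < k0 & forall kap, `|kap| < k0 ->
    `|integralRn (fun z => chi z * \det (Hk kap g z)) - MA_C2 g chi| < e.
Proof.
move=> d0 tc Cg e0.
pose u (k : R) z := chi z * \det (Hk k g z).
have cH w : Om (tl w) -> continuous_at w (fun w : 'rV[R]_(1 + (1 + n)) => Hk (hd w) g (tl w)).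
  move=> Ow; apply: ct_mx => i j.
  apply: (ct_eq (g := fun w : 'rV[R]_(1 + (1 + n)) => hessian g (tl w) i j +
      hd w * (block_mx 0 0 0 (1%:M) : 'M[R]_(1 + n)) i j)).
    move=> y; rewrite /Hk mxE; congr (_ + _).
    have -> : block_mx 0 0 0 (hd y)%:M = (hd y) *: (block_mx 0 0 0 (1%:M) : 'M[R]_(1 + n)).
      by rewrite scale_block_mx !scaler0 scalemx1.
    by rewrite mxE.
  apply: ctD; last by apply: ctM; [exact: ct_hd|exact: ct_cst].
  apply: ct_coord; apply: (ct_comp (f := @tl R (1 + n)) (g := hessian g)); first exact: ct_tl.
  exact: hess_cont Cg Ow.
have cu k : Cc N (u k).
  apply: tests_Cc; apply: (testsM d0 tc) => z Oz.
  apply: (ct_eq (g := fun z => \det (Hk (hd (pt k z)) g (tl (pt k z))))) => [w|].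
    by rewrite hd_pt tl_pt.
  apply: (ct_det (f := fun z => Hk (hd (pt k z)) g (tl (pt k z)))).
  have cz : continuous_at z (fun z => pt k z) by apply: ct_pt; [exact: ct_cst|exact: ct_id].
  have Ow : Om (tl (pt k z)) by rewrite tl_pt.
  exact: (ct_comp cz (cH _ Ow)).
have : {for 0, continuous (fun k => integralRn (u k))}.
  apply: (radon_cont (N := N)); [exact: radon_integralRn|exact: cu|].
  move=> {}e {}e0.
  have [|r r0 Hr] := unif_slice (f := u) (t0 := 0) (@Kbox_compact R n d N) _ e0.
    move=> z Kz {}e {}e0; have Oz := Kbox_sub d0 Kz.
    have /cont_epsP /(_ e e0)[r r0 Hr] :
        continuous_at (pt 0 z) (fun w : 'rV[R]_(1 + (1 + n)) => u (hd w) (tl w)).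
      apply: ctM; last by apply: ct_det; apply: cH; rewrite tl_pt.
      by apply: (ct_comp (f := @tl R (1 + n)) (g := chi)); [exact: ct_tl|exact: tc.1].
    exists r => // t y tr yr; have := Hr (pt t y); rewrite ptB !hd_pt !tl_pt.
    by apply; exact: pt_norm_lt.
  exists r => // t tr z; have [Kz|nKz] := pselect (Kbox d N z); first exact: Hr.
  by rewrite /u tc.2// !mul0r subrr normr0.
move/cont_epsP => /(_ e e0)[r r0 Hr]; exists r => // k kr.
have := Hr k; rewrite subr0 => /(_ kr); congr (`|_ - _| < _).
rewrite /MA_C2; congr integralRn; apply/funext => z; rewrite /u /Hk.
rewrite (_ : block_mx _ _ _ _ = 0) ?addr0//.
by rewrite [X in block_mx _ _ _ X](_ : _ = 0) ?block_mx0//; apply/matrixP => i j; rewrite !mxE mul0rn.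
Qed.

(** The tangent inequality for g + kap |x|^2 / 2; the quadratic term at w is kept on the
    right, the one at z has the right sign. *)
Lemma Pk_supp kap g z w : 0 <= kap -> Ck 2 Om g -> cvx Om g -> Om z -> Om w ->
  g z + dotv (Pk kap g z) (w - z) <= g w + kap * dotv (tl w) (tl w).
Proof.
move=> k0 Cg cg Oz Ow; have := cvx_gradv Om_open cg Cg Oz Ow.
rewrite /Pk dotvDl dotv_pt0 dotvZl tlB dotvBr.
have : 0 <= dotv (tl w - tl z) (tl w - tl z) by apply: le_trans (dotv_ge _); rewrite exprn_ge0.
rewrite !(dotvBl, dotvBr) (dotvC (tl w) (tl z)) => h.
have h2 : 0 <= dotv (tl w) (tl w) by apply: le_trans (dotv_ge _); rewrite exprn_ge0.
have h3 : 0 <= dotv (tl z) (tl z) by apply: le_trans (dotv_ge _); rewrite exprn_ge0.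
have : kap * (dotv (tl z) (tl w) - dotv (tl z) (tl z)) <= kap * dotv (tl w) (tl w).
  by apply: ler_wpM2l => //; lra.
lra.
Qed.

Lemma dotv_delta m (x : 'rV[R]_m) a i : dotv x (a *: delta_mx 0 i) = a * x 0 i.
Proof.
rewrite dotvZr; congr (_ * _); rewrite /dotv (bigD1 i)//= mxE !eqxx mulr1 big1 ?addr0// => j ji.
by rewrite mxE (negbTE ji) andbF mulr0.
Qed.

Lemma hd_shift_bounds (z w : 'rV[R]_(1 + n)) r : `|w| <= r -> hd z - r <= hd (z + w) <= hd z + r.
Proof.
by move=> wr; have := le_trans (hd_le w) wr; rewrite ler_norml hdD => /andP[? ?]; apply/andP; split; lra.
Qed.

(** A convex function bounded by M on a box has gradient at most 2 M / r at distance r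
    from its boundary; test the tangent inequality at z + r e_i and z - r e_i. *)
Lemma gradv_bound g d N M z : 0 < d -> Ck 2 Om g -> cvx Om g ->
  (forall z, Kbox (d / 2) (N + 1) z -> `|g z| <= M) -> Kbox d N z ->
  `|gradv g z| <= 2 * M / Num.min (d / 2) 1.
Proof.
move=> d0 Cg cg gM Kz; set r := Num.min _ _.
have r0 : 0 < r by rewrite lt_min divr_gt0// ltr01.
have rd : r <= d / 2 by rewrite ge_min lexx.
have r1 : r <= 1 by rewrite ge_min lexx orbT.
have Oz := Kbox_sub d0 Kz; have [/andP[z1 z2] zN] := Kz.
have Kz' : Kbox (d / 2) (N + 1) z by split; [apply/andP; split|]; lra.
have M0 : 0 <= M by apply: le_trans (gM _ Kz').
apply/row_norm_le => [|i]; first by rewrite divr_ge0 ?mulr_ge0// ltW.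
have H a : `|a| = r -> a * gradv g z 0 i <= 2 * M.
  move=> ar; have wn : `|a *: (delta_mx 0 i : 'rV[R]_(1 + n))| <= r.
    apply/row_norm_le => [|j]; first exact: ltW.
    rewrite !mxE eqxx/= normrM ar; apply: ler_piMr; first exact: ltW.
    by case: (j == i); rewrite ?normr1 ?normr0.
  have Kw : Kbox (d / 2) (N + 1) (z + a *: delta_mx 0 i).
    have /andP[h1 h2] := hd_shift_bounds z wn; split; first by apply/andP; split; lra.
    by apply: le_trans (ler_normD _ _) _; apply: lerD => //; exact: le_trans r1.
  have Ow := Kbox_sub (divr_gt0 d0 (ltr0n R 2)) Kw.
  have := cvx_gradv Om_open cg Cg Oz Ow; rewrite [_ + _ - z]addrC addKr dotv_delta.
  have := gM _ Kw; have := gM _ Kz'; rewrite !ler_norml => /andP[? ?] /andP[? ?]; lra.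
have h1 := H r (gtr0_norm r0); have h2 := H (- r); rewrite normrN gtr0_norm// in h2.
have {}h2 := h2 erefl.
rewrite ler_pdivlMr// -[X in _ * X]gtr0_norm// -normrM ler_norml; apply/andP; split; lra.
Qed.

Definition subgrad f z p := forall w, Om w -> f z + dotv p (w - z) <= f w.

(** Locally uniform convergence on the strip. *)
Definition lu_cvg (g : nat -> 'rV[R]_(1 + n) -> R) f := forall d N e, 0 < d -> 0 < e ->
  exists J, forall j, (J <= j)%N -> forall z, Kbox d N z -> `|g j z - f z| < e.

(** A limit of gradients is a subgradient of the limit: pass to the limit in [Pk_supp].
    The points and the gradients are read off one sequence [w] through
    the continuous maps [pz] and [pp], so that several of them may cluster
    simultaneously. *)
Lemma acc_subgrad (g : nat -> 'rV[R]_(1 + n) -> R) f (kap : nat -> R) (k : nat -> nat)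
    (m : nat) (w : nat -> 'rV[R]_m) w0 (pz pp : 'rV[R]_m -> 'rV[R]_(1 + n)) d N :
  0 < d -> (forall j, Ck 2 Om (g j)) -> (forall j, cvx Om (g j)) -> lu_cvg g f ->
  (forall z, Om z -> continuous_at z f) ->
  (forall j, (j <= k j)%N) -> (forall j, 0 <= kap j) ->
  (forall e, 0 < e -> exists J, forall j, (J <= j)%N -> kap j <= e) ->
  cluster_point w w0 -> continuous_at w0 pz -> continuous_at w0 pp ->
  (forall j, Kbox d N (pz (w j))) -> (forall j, pp (w j) = Pk (kap j) (g (k j)) (pz (w j))) ->
  Kbox d N (pz w0) /\ subgrad f (pz w0) (pp w0).
Proof.
move=> d0 Cg cg gf cf jk kap0 kapc aw cz cp Kz pE.
have chz : continuous_at w0 (fun w => hd (pz w)).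
  by apply: (ct_comp (f := pz) (g := @hd R n)) => //; exact: ct_hd.
have Kz0 : Kbox d N (pz w0).
  split; last first.
    apply: (acc_le (phi := fun w => `|pz w|) aw) => [|e e0]; first exact: ct_norm.
    by exists 0%N => j _; have [_ h] := Kz j; lra.
  apply/andP; split.
    rewrite -lerN2; apply: (acc_le (phi := fun w => - hd (pz w)) aw) => [|e e0]; first exact: ctN.
    by exists 0%N => j _; have [/andP[h _] _] := Kz j; lra.
  apply: (acc_le (phi := fun w => hd (pz w)) aw) => // e e0.
  by exists 0%N => j _; have [/andP[_ h] _] := Kz j; lra.
split => // y Oy; rewrite -subr_le0.
apply: (acc_le (phi := fun w => f (pz w) + dotv (pp w) (y - pz w) - f y) aw) => [|e e0].
  apply: ctB; last exact: ct_cst.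
  apply: ctD.
    apply: (ct_comp (f := pz) (g := f)) => //; apply: cf; exact: Kbox_sub Kz0.
  by apply: ct_dotv => //; apply: ctBv => //; exact: ct_cst.
have e3 : 0 < e / 3 by rewrite divr_gt0.
have [J1 H1] := gf d N _ d0 e3.
have sy : [set y] `<=` Om by move=> z ->.
have cy : compact [set y] by exact: compact_set1.
have [d' [N' [d'0 _ KB]]] := compact_Kbox cy sy.
have [J2 H2] := gf d' N' _ d'0 e3.
have D0 : 0 <= dotv (tl y) (tl y) by apply: le_trans (dotv_ge _); rewrite exprn_ge0.
have [J3 H3] := kapc (e / 3 / (dotv (tl y) (tl y) + 1)) (divr_gt0 e3 (ltr_wpDl D0 ltr01)).
exists (maxn J1 (maxn J2 J3)) => j; rewrite !geq_max => /and3P[j1 j2 j3].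
have := H1 _ (leq_trans j1 (jk j)) _ (Kz j).
have := H2 _ (leq_trans j2 (jk j)) _ (KB _ erefl).
have := Pk_supp (kap0 j) (Cg (k j)) (cg (k j)) (Kbox_sub d0 (Kz j)) Oy; rewrite -pE.
have : kap j * dotv (tl y) (tl y) <= e / 3.
  apply: (@le_trans _ _ (e / 3 / (dotv (tl y) (tl y) + 1) * dotv (tl y) (tl y))).
    by apply: ler_wpM2r => //; exact: H3.
  rewrite mulrAC -mulrA ger_pMr// ler_pdivrMr ?ltr_wpDl//; lra.
rewrite !ltr_norml => h1 h2 /andP[h3 h4] /andP[h5 h6]; lra.
Qed.

End pk.

(** * The slice integral of the Monge-Ampere kernel *)

Section kernbounds.
Context {R : realType} {n : nat}.
Variables (kap : R) (P : 'rV[R]_(1 + n) -> 'rV[R]_(1 + n)) (H : 'rV[R]_(1 + n) -> 'M[R]_(1 + n)).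
Hypothesis k0 : 0 < kap.
Hypothesis sf : stripF kap P H.
Variables (d N : R) (chi : 'rV[R]_(1 + n) -> R).
Hypothesis d0 : 0 < d.
Hypothesis N0 : 0 <= N.
Hypothesis tc : tests d N chi.
Hypothesis chi0 : forall z, 0 <= chi z.
Local Notation X := (Xs k0 sf).
Local Notation tau := (tau k0 sf).
Local Notation kern := (kern k0 sf chi).

Lemma Ws_ge0 (y : 'rV[R]_n) (s : R) : 0 < s < 1 -> 0 <= Ws H (pt s (X s y)).
Proof.
move=> s01; have /is_derive_epsP dt := tau_deriv k0 sf y s01.
apply/ler_addgt0Pr => e e0; have [r r0 Hr] := dt e e0.
pose h := Num.min r (1 - s) / 2.
have m0 : 0 < Num.min r (1 - s) by rewrite lt_min r0/=; lra.
have h0 : 0 < h by rewrite divr_gt0.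
have [m1 m2] : Num.min r (1 - s) <= r /\ Num.min r (1 - s) <= 1 - s.
  by rewrite !ge_min !lexx orbT.
have hr : `|h| < r by rewrite gtr0_norm// /h; lra.
have sh : 0 < s + h < 1 by rewrite /h; apply/andP; split; lra.
have := tau_nondecr k0 sf y s01 sh; rewrite lerDl => /(_ (ltW h0)).
have := Hr h hr; rewrite (gtr0_norm h0) ler_norml => /andP[h1 h2] h3.
by rewrite -(pmulr_rge0 _ h0) mulrDr [h * e]mulrC; lra.
Qed.

Lemma kern_ge0 z : 0 <= kern z.
Proof.
have [_ [_ _ kz]] := kern_tests k0 sf d0 N0 tc.
have [s01|ns] := boolP (0 < hd z < 1); first by rewrite mulr_ge0// Ws_ge0.
rewrite kz// => /andP[a b]; move/negP: ns; apply; have := d0 => dd; apply/andP; split; lra.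
Qed.

Lemma kern_CcR y : exists2 M, 1 <= M & CcR M (fun s => kern (pt s y)).
Proof.
have [M [M0 cM kz]] := kern_tests k0 sf d0 N0 tc; exists (Num.max M 1); first by rewrite le_max lexx orbT.
by apply: CcRW (Cc_sliceR y cM); rewrite le_max lexx.
Qed.

Lemma kern_out y s : ~ d <= s <= 1 - d -> kern (pt s y) = 0.
Proof. by have [_ [_ _ kz]] := kern_tests k0 sf d0 N0 tc; move=> ns; apply: kz; rewrite hd_pt. Qed.

(** The mean value theorem for the function s |-> integral of the kernel - M tau_y(s). *)
Lemma kern_ftc y (a b M : R) : 0 < a -> a <= b -> b < 1 ->
  exists2 c, a <= c <= b & Ii a b (fun s => kern (pt s y)) - M * (tau y b - tau y a) =
     (chi (pt c (X c y)) - M) * Ws H (pt c (X c y)) * (b - a).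
Proof.
move=> a0 ab b1; have [K K1 [ck Hk]] := kern_CcR y.
pose D s := Ii (-1) s (fun s => kern (pt s y)) - M * tau y s.
have dD (s : R) : 0 < s < 1 -> is_derive s (1:R) D (kern (pt s y) - M * Ws H (pt s (X s y))).
  move=> s01; apply: is_deriveB; first by apply: Ii_prim => //; lra.
  by have := tau_deriv k0 sf y s01 => dt; apply: is_deriveZ.
have cD (s : R) : a <= s <= b -> {for s, continuous D}.
  move=> sab; apply: differentiable_continuous; apply/derivable1_diffP.
  by apply: (@ex_derive _ _ _ _ _ _ _ (dD s _)); lra.
have dDo (s : R) : s \in `]a, b[ -> is_derive s (1:R) D (kern (pt s y) - M * Ws H (pt s (X s y))).
  by rewrite in_itv/= => /andP[? ?]; apply: dD; lra.
have cDw : {within `[a, b], continuous D}.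
  by apply: continuous_in_subspaceT => s; rewrite inE/= in_itv/=; exact: cD.
have [c] := MVT_segment ab dDo cDw; rewrite in_itv/= => cab E.
exists c => //; rewrite mulrBl; move: E; rewrite /kern hd_pt tl_pt => <-.
by rewrite /D (Ii_split (a := -1) (b := a) (c := b))//; [ring|lra].
Qed.

(** The slice integral is at most sup chi times the increment of tau_y between the first
    and the last s at which the curve meets the support of chi. The curve may leave
    the support in between; monotonicity of tau_y makes this harmless. By hypothesis
    the increment between two points of the support is at most eta. *)
Lemma kern_upper y M eta : (forall z, chi z <= M) ->
  0 <= eta ->
  (forall z z', Kbox d N z -> Kbox d N z' -> tl (P z) = tl (P z') -> hd (P z) - hd (P z') <= eta) ->
  I1 (fun s => kern (pt s y)) <= M * eta.
Proof.
move=> chiM eta0 Heta; have dd := d0; have [K K1 [ck Hk]] := kern_CcR y.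
have M0 : 0 <= M by apply: le_trans (chi0 0) (chiM 0).
pose S := [set s | d <= s <= 1 - d /\ chi (pt s (X s y)) != 0].
have SK s : S s -> Kbox d N (pt s (X s y)).
  by move=> [_ cs]; apply: contrapT => nK; move: cs; rewrite tc.2// eqxx.
have [S0|/set0P[s0 Ss0]] := eqVneq S set0.
  rewrite (I1E Hk) (Ii_eq (g := fun=> 0)) ?Ii_cst ?mul0r ?mulr_ge0//; first lra.
  move=> s _; have [sd|] := pselect (d <= s <= 1 - d); last exact: kern_out.
  rewrite /kern hd_pt tl_pt; have [->|c0] := eqVneq (chi (pt s (X s y))) 0.
    by rewrite mul0r.
  by have : S s by []; rewrite S0.
have S01 s : S s -> d <= s <= 1 - d by case.
have hsup : has_sup S by split; [exists s0|exists (1 - d) => s /S01 /andP[]].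
have hinf : has_inf S by split; [exists s0|exists d => s /S01 /andP[]].
set a := inf S; set b := sup S.
have da : d <= a by apply: lb_le_inf; [exists s0|move=> s /S01 /andP[]].
have bd : b <= 1 - d by apply: ge_sup; [exists s0|move=> s /S01 /andP[]].
have Sab s : S s -> a <= s <= b.
  move=> Ss; apply/andP; split; first by apply: ge_inf => //; exact: hinf.2.
  by apply: ub_le_sup => //; exact: hsup.2.
have ab : a <= b by have /andP[] := Sab _ Ss0; apply: le_trans.
have kout s : ~ a <= s <= b -> kern (pt s y) = 0.
  move=> ns; have [sd|] := pselect (d <= s <= 1 - d); last exact: kern_out.
  rewrite /kern hd_pt tl_pt; have [->|c0] := eqVneq (chi (pt s (X s y))) 0.
    by rewrite mul0r.
  by exfalso; apply/ns/Sab.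
have tle : tau y b - tau y a <= eta.
  apply/ler_addgt0Pr => e e0; have e2 : 0 < e / 2 by rewrite divr_gt0.
  have ctau s : 0 < s < 1 -> {for s, continuous (tau y)}.
    move=> s01; apply: differentiable_continuous; apply/derivable1_diffP.
    exact: (@ex_derive _ _ _ _ _ _ _ (tau_deriv k0 sf y s01)).
  have a01 : 0 < a < 1 by lra.
  have b01 : 0 < b < 1 by lra.
  have /cont_epsP /(_ _ e2)[ra ra0 Ha] := ctau a a01.
  have /cont_epsP /(_ _ e2)[rb rb0 Hb] := ctau b b01.
  have [sa Ssa sa1] := inf_adherent ra0 hinf.
  have [sb Ssb sb1] := sup_adherent rb0 hsup.
  rewrite -/a in sa1; rewrite -/b in sb1.
  have /andP[a1 a2] := Sab _ Ssa; have /andP[b1 b2] := Sab _ Ssb.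
  have sa01 : 0 < sa < 1 by lra.
  have sb01 : 0 < sb < 1 by lra.
  have := Heta _ _ (SK _ Ssb) (SK _ Ssa); rewrite !XsK// => /(_ erefl).
  have : `|sa - a| < ra by rewrite ger0_norm; lra.
  move=> /Ha; rewrite ltr_norml => /andP[u1 u2].
  have : `|sb - b| < rb by rewrite ler0_norm; lra.
  move=> /Hb; rewrite ltr_norml => /andP[v1 v2].
  rewrite -/(tau y sb) -/(tau y sa); lra.
have K1' : - K <= a /\ b <= K by split; lra.
rewrite (I1E Hk) (Ii_split (b := a) (c := K))//; [|by case: K1'|lra].
rewrite (Ii_split (a := a) (b := b) (c := K))//; last by case: K1'.
have [a0 b1] : 0 < a /\ b < 1 by split; lra.
have kz t v : (forall e, 0 < e -> exists2 s, `|s - t| < e & ~ a <= s <= b) -> v = t ->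
    kern (pt v y) = 0.
  move=> Ht ->; apply/eqP; rewrite -normr_eq0; apply/negPn/negP => k1.
  have {}k1 : 0 < `|kern (pt t y)| by rewrite lt_neqAle eq_sym k1/=.
  have /cont_epsP /(_ _ k1)[r r0 Hr] := ck t.
  by have [s st ns] := Ht r r0; have := Hr s st; rewrite kout// sub0r normrN ltxx.
have ka : kern (pt a y) = 0.
  apply: (kz a) => // e e0; exists (a - e / 2); last by move=> /andP[]; lra.
  by rewrite addrC addKr normrN gtr0_norm//; lra.
have kb : kern (pt b y) = 0.
  apply: (kz b) => // e e0; exists (b + e / 2); last by move=> /andP[]; lra.
  by rewrite addrC addKr gtr0_norm//; lra.
have Zout u v : u <= v -> (v <= a) || (b <= u) -> Ii u v (fun s => kern (pt s y)) <= 0.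
  move=> uv Huv; rewrite (Ii_eq (g := fun=> 0)) ?Ii_cst ?mul0r// => s /andP[us sv].
  have [->//|sa] := eqVneq s a; have [->//|sb] := eqVneq s b.
  apply: kout => /andP[as_ sb_]; case/orP: Huv => Huv.
    by move: sa; rewrite eq_le (le_trans sv Huv) as_.
  by move: sb; rewrite eq_le sb_ (le_trans Huv us).
have [c cab E] := kern_ftc y M a0 ab b1.
have W0 : 0 <= Ws H (pt c (X c y)) by apply: Ws_ge0; lra.
have cM : chi (pt c (X c y)) - M <= 0 by rewrite subr_le0.
have : (chi (pt c (X c y)) - M) * Ws H (pt c (X c y)) * (b - a) <= 0.
  by apply: mulr_le0_ge0; [apply: mulr_le0_ge0|lra].
rewrite -E => E'.
have z1 : Ii (- K) a (fun s => kern (pt s y)) <= 0 by apply: Zout; rewrite ?lexx ?orbT//; lra.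
have z2 : Ii b K (fun s => kern (pt s y)) <= 0 by apply: Zout; rewrite ?lexx ?orbT//; lra.
have : M * (tau y b - tau y a) <= M * eta by apply: ler_wpM2l.
lra.
Qed.

(** Where chi = 1 the kernel is the derivative of tau_y; elsewhere it is nonnegative. *)
Lemma kern_lower y (s1 s2 : R) : 0 < s1 -> s1 <= s2 -> s2 < 1 ->
  (forall s, s1 <= s <= s2 -> chi (pt s (X s y)) = 1) ->
  tau y s2 - tau y s1 <= I1 (fun s => kern (pt s y)).
Proof.
move=> s10 s12 s21 c1; have [K K1 [ck Hk]] := kern_CcR y.
rewrite (I1E Hk) (Ii_split (b := s1) (c := K))//; [|lra|lra].
rewrite (Ii_split (a := s1) (b := s2) (c := K))//; last lra.
have ge0 u v : u <= v -> 0 <= Ii u v (fun s => kern (pt s y)).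
  move=> uv; rewrite -[0](mul0r (v - u)) -Ii_cst//; apply: Ii_le => //.
    by move=> ?; exact: ct_cst.
  by move=> t _; exact: kern_ge0.
have [c cab E] := kern_ftc y 1 s10 s12 s21.
rewrite c1// subrr !mul0r in E.
have z1 : 0 <= Ii (- K) s1 (fun s => kern (pt s y)) by apply: ge0; lra.
have z2 : 0 <= Ii s2 K (fun s => kern (pt s y)) by apply: ge0; lra.
lra.
Qed.

End kernbounds.

(** * Vanishing of the Monge-Ampere measure, and a lower bound *)

Section ma.
Context {R : realType} {n : nat}.
Local Notation Om := (@open_strip R n).
Implicit Types (f : 'rV[R]_(1 + n) -> R) (g : nat -> 'rV[R]_(1 + n) -> R).

Lemma unif_cvgP (K : set 'rV[R]_(1 + n)) g f : {uniform K, g @ \oo --> f} <->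
  (forall e, 0 < e -> exists J, forall j, (J <= j)%N -> forall z, K z -> `|g j z - f z| < e).
Proof.
split=> [H e e0|H P].
  have /H [J _ HJ] : nbhs (f : {uniform` K -> R}) [set h | forall z, K z -> `|h z - f z| < e].
    apply/uniform_nbhs; exists [set uv | ball uv.1 e uv.2]; split.
      by rewrite -entourage_ballE; exists e.
    by move=> h Hh z Kz; have := Hh z Kz; rewrite /= -ball_normE /= distrC.
  by exists J => j Jj; exact: (HJ j Jj).
move/uniform_nbhs => [E [/= + EP]]; rewrite -entourage_ballE => -[e /= e0 eE].
have [J HJ] := H e e0; exists J => // j /= Jj; apply: EP => z Kz; apply: eE => /=.
by rewrite -ball_normE /= distrC; exact: HJ.
Qed.

Lemma lu_cvg_Kbox g f : (forall K, compact K -> K `<=` Om -> {uniform K, g @ \oo --> f}) -> lu_cvg g f.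
Proof.
move=> H d N e d0 e0; have := H _ (@Kbox_compact R n d N) (Kbox_sub d0).
by move/unif_cvgP => /(_ e e0).
Qed.

Lemma Pk_bound g f d N : 0 < d -> (forall j, Ck 2 Om (g j)) -> (forall j, cvx Om (g j)) ->
  lu_cvg g f -> (forall z, Om z -> continuous_at z f) ->
  exists B J, 0 <= B /\ forall j, (J <= j)%N -> forall k, 0 <= k <= 1 -> forall z, Kbox d N z ->
    `|Pk k (g j) z| <= B.
Proof.
move=> d0 Cg cg gf cf; have d2 : 0 < d / 2 by rewrite divr_gt0.
have [M M0 HM] := compact_bd (@Kbox_compact R n (d / 2) (N + 1)) (fun z Kz => cf z (Kbox_sub d2 Kz)).
have [J HJ] := gf (d / 2) (N + 1) 1 d2 ltr01.
have m0 : 0 < Num.min (d / 2) 1 by rewrite lt_min d2 ltr01.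
exists (2 * (M + 1) / Num.min (d / 2) 1 + `|N|), J; split.
  by rewrite addr_ge0// divr_ge0 ?mulr_ge0 ?addr_ge0// ltW.
move=> j Jj k /andP[k0 k1] z Kz; apply: le_trans (ler_normD _ _) _; apply: lerD.
  apply: (gradv_bound d0 (Cg j) (cg j) _ Kz) => w Kw.
  rewrite -[g j w](subrK (f w)); apply: le_trans (ler_normD _ _) _; rewrite addrC.
  by apply: lerD; [exact: HM|exact/ltW/HJ].
rewrite pt_normE normr0 max_r// normrZ ger0_norm//.
have [_ zN] := Kz; apply: (@le_trans _ _ `|tl z|); first exact: ler_piMl.
by apply: le_trans (tl_le _) _; apply: le_trans zN (ler_norm _).
Qed.

(** In terms of the Legendre transform in x: all subgradients over one y have the same
    slope in s. This is the weak form of MA f = 0 used for convex functions that are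
    only continuous. *)
Definition rigid f := forall z z' p p', Om z -> Om z' -> subgrad f z p -> subgrad f z' p' ->
  tl p = tl p' -> hd p = hd p'.

(** By contradiction: otherwise pairs of points with the same x-gradient and
    s-gradients at distance at least eta exist for arbitrarily large indices; a
    common cluster point would give two subgradients of f violating rigidity. *)
Lemma close_grad g f d N eta : 0 < d -> (forall j, Ck 2 Om (g j)) -> (forall j, cvx Om (g j)) ->
  lu_cvg g f -> (forall z, Om z -> continuous_at z f) -> rigid f -> 0 < eta ->
  exists J k0, 0 < k0 /\ forall j, (J <= j)%N -> forall k, 0 < k < k0 -> forall z z',
   Kbox d N z -> Kbox d N z' -> tl (Pk k (g j) z) = tl (Pk k (g j) z') ->
   hd (Pk k (g j) z) - hd (Pk k (g j) z') <= eta.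
Proof.
move=> d0 Cg cg gf cf rf eta0; apply: contrapT => NH.
have [B [JB [B0 HB]]] := Pk_bound N d0 Cg cg gf cf.
have bad : forall j : nat, exists t : nat * R * ('rV[R]_(1 + n) * 'rV[R]_(1 + n)),
   [/\ (maxn j JB <= t.1.1)%N, 0 < t.1.2 < j.+1%:R^-1, Kbox d N t.2.1 /\ Kbox d N t.2.2,
       tl (Pk t.1.2 (g t.1.1) t.2.1) = tl (Pk t.1.2 (g t.1.1) t.2.2) &
       eta < hd (Pk t.1.2 (g t.1.1) t.2.1) - hd (Pk t.1.2 (g t.1.1) t.2.2)].
  move=> j; apply: contrapT => Nj; apply: NH; exists (maxn j JB), j.+1%:R^-1.
  split; first by rewrite invr_gt0.
  move=> i ji k kk z z' Kz Kz' E; rewrite leNgt; apply/negP => Ht.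
  by apply: Nj; exists (i, k, (z, z')).
move/choice : bad => [t Ht].
pose k j := (t j).1.1; pose kap j := (t j).1.2.
pose z j := (t j).2.1; pose z' j := (t j).2.2.
pose p j := Pk (kap j) (g (k j)) (z j); pose p' j := Pk (kap j) (g (k j)) (z' j).
pose w j := row_mx (row_mx (z j) (z' j)) (row_mx (p j) (p' j)).
have jk j : (j <= k j)%N by have [] := Ht j; rewrite geq_max => /andP[].
have JBk j : (JB <= k j)%N by have [] := Ht j; rewrite geq_max => /andP[].
have kap0 j : 0 < kap j by have [_ /andP[]] := Ht j.
have kap1 j : kap j <= j.+1%:R^-1 by have [_ /andP[_ /ltW]] := Ht j.
have kap01 j : 0 <= kap j <= 1.
  rewrite ltW//=; apply: le_trans (kap1 j) _; rewrite invf_le1// ?ler1n//.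
have Kz j : Kbox d N (z j) by have [_ _ []] := Ht j.
have Kz' j : Kbox d N (z' j) by have [_ _ []] := Ht j.
have kapc e : 0 < e -> exists J, forall j, (J <= j)%N -> kap j <= e.
  move=> e0; have [J _ HJ] := near_infty_natSinv_lt (PosNum e0).
  by exists J => j Jj; apply: le_trans (kap1 j) _; apply/ltW/(HJ j Jj).
have wB j : `|w j| <= Num.max N B.
  have [NB BB] : N <= Num.max N B /\ B <= Num.max N B by rewrite !le_max !lexx orbT.
  apply: norm_row_mx; apply: norm_row_mx.
  - exact: le_trans (Kz j).2 NB.
  - exact: le_trans (Kz' j).2 NB.
  - by apply: le_trans BB; apply: HB.
  - by apply: le_trans BB; apply: HB.
have [w0 aw] := acc_exists wB.
pose c1 (w : 'rV[R]_((1 + n) + (1 + n) + ((1 + n) + (1 + n)))) := lsubmx (lsubmx w).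
pose c2 (w : 'rV[R]_((1 + n) + (1 + n) + ((1 + n) + (1 + n)))) := rsubmx (lsubmx w).
pose c3 (w : 'rV[R]_((1 + n) + (1 + n) + ((1 + n) + (1 + n)))) := lsubmx (rsubmx w).
pose c4 (w : 'rV[R]_((1 + n) + (1 + n) + ((1 + n) + (1 + n)))) := rsubmx (rsubmx w).
have cc1 : continuous_at w0 c1.
  by apply: (ct_comp (f := @lsubmx R 1 _ _) (g := @lsubmx R 1 _ _)); exact: ct_lsub.
have cc2 : continuous_at w0 c2.
  by apply: (ct_comp (f := @lsubmx R 1 _ _) (g := @rsubmx R 1 _ _)); [exact: ct_lsub|exact: ct_rsub].
have cc3 : continuous_at w0 c3.
  by apply: (ct_comp (f := @rsubmx R 1 _ _) (g := @lsubmx R 1 _ _)); [exact: ct_rsub|exact: ct_lsub].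
have cc4 : continuous_at w0 c4.
  by apply: (ct_comp (f := @rsubmx R 1 _ _) (g := @rsubmx R 1 _ _)); exact: ct_rsub.
have e1 j : c1 (w j) = z j by rewrite /c1 /w !row_mxKl.
have e2 j : c2 (w j) = z' j by rewrite /c2 /w row_mxKl row_mxKr.
have e3 j : c3 (w j) = p j by rewrite /c3 /w row_mxKr row_mxKl.
have e4 j : c4 (w j) = p' j by rewrite /c4 /w !row_mxKr.
have k0' j : 0 <= kap j by exact: ltW.
have [K1 S1] : Kbox d N (c1 w0) /\ subgrad f (c1 w0) (c3 w0).
  apply: (acc_subgrad (pz := c1) (pp := c3) d0 Cg cg gf cf jk k0' kapc aw cc1 cc3) => j.
    by rewrite e1.
  by rewrite e1 e3.
have [K2 S2] : Kbox d N (c2 w0) /\ subgrad f (c2 w0) (c4 w0).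
  apply: (acc_subgrad (pz := c2) (pp := c4) d0 Cg cg gf cf jk k0' kapc aw cc2 cc4) => j.
    by rewrite e2.
  by rewrite e2 e4.
have tE : tl (c3 w0) = tl (c4 w0).
  apply/eqP; rewrite -subr_eq0 -normr_eq0; apply/eqP/le_anti/andP; split=> //.
  apply: (acc_le (phi := fun w => `|tl (c3 w) - tl (c4 w)|) aw) => [|e e0].
    apply: ct_norm; apply: ctBv.
      by apply: (ct_comp (f := c3) (g := @tl R n)) => //; exact: ct_tl.
    by apply: (ct_comp (f := c4) (g := @tl R n)) => //; exact: ct_tl.
  exists 0%N => j _; rewrite e3 e4; have [_ _ _ E _] := Ht j.
  by rewrite /p /p' E subrr normr0 add0r ltW.
have hE := rf _ _ _ _ (Kbox_sub d0 K1) (Kbox_sub d0 K2) S1 S2 tE.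
have : hd (c4 w0) - hd (c3 w0) <= - eta.
  apply: (acc_le (phi := fun w => hd (c4 w) - hd (c3 w)) aw) => [|e e0].
    by apply: ctB; [apply: (ct_comp (f := c4) (g := @hd R n))|apply: (ct_comp (f := c3) (g := @hd R n))] => //; exact: ct_hd.
  by exists 0%N => j _; rewrite e3 e4 /p /p'; have [_ _ _ _ h] := Ht j; lra.
by rewrite hE subrr; lra.
Qed.

(** By [close_grad] each slice integral in [strip_formula] is at most sup chi times a small
    number, and it vanishes for y outside the ball that contains the gradients, so
    that the integral over y is small. *)
Lemma MA_cvg0 g f d N chi e : 0 < d -> 0 <= N -> tests d N chi -> (forall z, 0 <= chi z) ->
  (forall j, Ck 2 Om (g j)) -> (forall j, cvx Om (g j)) ->
  lu_cvg g f -> (forall z, Om z -> continuous_at z f) -> rigid f -> 0 < e ->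
  exists J, forall j, (J <= j)%N -> `|MA_C2 (g j) chi| <= e.
Proof.
move=> d0 N0 tc chi0 Cg cg gf cf rf e0.
have [M M0 HM] := compact_bd (@Kbox_compact R n d N) (fun z _ => tc.1 z).
have chiM z : chi z <= M.
  have [Kz|nKz] := pselect (Kbox d N z); last by rewrite tc.2.
  by apply: le_trans (HM _ Kz); exact: ler_norm.
have [B [JB [B0 HB]]] := Pk_bound N d0 Cg cg gf cf.
have [C C0 HC] := radon_bd (@radon_integralRn R n) B.
have CM : 0 < C * M + 1 by rewrite ltr_wpDl// mulr_ge0.
have eta0 : 0 < e / 2 / (C * M + 1) by rewrite !divr_gt0.
have [J [kk [kk0 HJ]]] := close_grad N d0 Cg cg gf cf rf eta0.
exists (maxn J JB) => j; rewrite geq_max => /andP[jJ jB].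
have e2 : 0 < e / 2 by rewrite divr_gt0.
have [k1 k10 Hk1] := MA_limit d0 tc (Cg j) e2.
pose k := Num.min (Num.min kk k1) 1 / 2.
have m0 : 0 < Num.min (Num.min kk k1) 1 by rewrite !lt_min kk0 k10 ltr01.
have [m1 m2 m3] : [/\ Num.min (Num.min kk k1) 1 <= kk, Num.min (Num.min kk k1) 1 <= k1 &
   Num.min (Num.min kk k1) 1 <= 1].
  by split; rewrite !ge_min lexx ?orbT.
have k0 : 0 < k by rewrite divr_gt0.
have kkk : 0 < k < kk by rewrite k0/= /k; lra.
have := Hk1 k; rewrite gtr0_norm// => /(_ _)H2; have {}H2 := H2 ltac:(rewrite /k; lra).
have sf := stripF_Pk k0 (Cg j) (cg j).
rewrite (strip_formula k0 sf d0 N0 tc) in H2.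
set m := (fun y => _) in H2.
have [K [K0 cK _]] := kern_tests k0 sf d0 N0 tc.
have cm : Cc K m by exact: (Cc_I1 K0 cK).
have mz y : B < `|y| -> m y = 0.
  move=> yB; rewrite /m; rewrite (_ : (fun s => _) = fun=> 0).
    by rewrite (I1E (N := 0)) // Ii_cst ?mul0r// oppr0.
  apply/funext => s; rewrite /kern hd_pt tl_pt tc.2 ?mul0r// => Kz.
  have s01 : 0 < s < 1 by have [/andP[]] := Kz; rewrite hd_pt => ? ? _; apply/andP; split; lra.
  have k01 : 0 <= k <= 1 by rewrite ltW//=; rewrite /k; lra.
  have := HB j jB k k01 _ Kz; rewrite leNgt => /negP; apply.
  by apply: lt_le_trans yB _; rewrite -{1}(XsK k0 sf y s01); exact: tl_le.
have cmB : Cc B m by split=> //; exact: cm.1.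
have m_ge0 y : 0 <= m y.
  have [K' K'1 [ck Hk']] := kern_CcR k0 sf d0 N0 tc y.
  rewrite /m (I1E Hk') -[0](mul0r (K' - - K')) -Ii_cst; last lra.
  apply: Ii_le => //; first by move=> ?; exact: ct_cst.
  by move=> t _; apply: (kern_ge0 k0 sf d0 N0 tc chi0).
have m_le y : m y <= M * (e / 2 / (C * M + 1)).
  rewrite /m; have HJ' z z' := HJ j jJ k kkk z z'.
  exact: (kern_upper k0 sf d0 N0 tc chi0 y chiM (ltW eta0) HJ').
have : `|integralRn m| <= C * (M * (e / 2 / (C * M + 1))).
  by apply: HC => // y; rewrite ger0_norm.
have : C * (M * (e / 2 / (C * M + 1))) <= e / 2.
  rewrite mulrA mulrCA ger_pMr// ler_pdivrMr//; lra.
move: H2; set a := integralRn m; set b := MA_C2 _ _; rewrite ltr_norml !ler_norml.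
by move=> /andP[h1 h2] h3 /andP[h4 h5]; apply/andP; split; lra.
Qed.

(** [MA_cvg0] for the positive and the negative part of the test function. *)
Theorem rigid_is_MA f : (forall z, Om z -> continuous_at z f) -> rigid f -> is_MA Om f (fun=> 0).
Proof.
move=> cf rf g gC gU chi tchi.
have Cg j : Ck 2 Om (g j) by case: (gC j).
have cg j : cvx Om (g j) by apply/convex_functionP; case: (gC j).
have gf := lu_cvg_Kbox gU.
have [d [N [d0 N0 tc]]] := test_tests tchi.
pose chip z := Num.max (chi z) 0; pose chin z := Num.max (- chi z) 0.
have tp : tests d N chip.
  split=> [z|z /tc.2 E]; last by rewrite /chip E maxxx.
  by apply: (ct_eq (g := fun z => (chi z + `|chi z|) / 2)) => [w|];
    [rewrite /chip maxr_absE subr0 addr0|apply: ctM; [apply: ctD; [|apply: ct_norm]; exact: tc.1|exact: ct_cst]].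
have tn : tests d N chin.
  split=> [z|z /tc.2 E]; last by rewrite /chin E oppr0 maxxx.
  by apply: (ct_eq (g := fun z => (- chi z + `|chi z|) / 2)) => [w|];
    [rewrite /chin maxr_absE subr0 addr0 normrN|apply: ctM; [apply: ctD; [apply: ctN|apply: ct_norm]; exact: tc.1|exact: ct_cst]].
have p0 z : 0 <= chip z by rewrite /chip le_max lexx orbT.
have n0 z : 0 <= chin z by rewrite /chin le_max lexx orbT.
have chiE z : chi z = chip z - chin z.
  by rewrite /chip /chin !maxr_absE !subr0 !addr0 normrN; lra.
have MAE j : MA_C2 (g j) chi = MA_C2 (g j) chip - MA_C2 (g j) chin.
  have cdet z : Om z -> continuous_at z (fun z => \det (hessian (g j) z)).
    by move=> Oz; apply: ct_det; exact: hess_cont (Cg j) Oz.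
  rewrite /MA_C2 -(radonB (@radon_integralRn R (1 + n)) (tests_Cc (testsM d0 tp cdet)) (tests_Cc (testsM d0 tn cdet))).
  by congr integralRn; apply/funext => z; rewrite chiE mulrBl.
apply/cvgrPdist_le => e e0; have e2 : 0 < e / 2 by rewrite divr_gt0.
have [J1 H1] := MA_cvg0 d0 N0 tp p0 Cg cg gf cf rf e2.
have [J2 H2] := MA_cvg0 d0 N0 tn n0 Cg cg gf cf rf e2.
exists (maxn J1 J2) => // j /=; rewrite geq_max => /andP[/H1 h1 /H2 h2].
by rewrite sub0r normrN MAE [e]splitr; apply: le_trans (ler_normB _ _) _; exact: lerD.
Qed.

(** A tent of height 1 over the ball of radius r around y0, the density of slopes used for
    the lower bound of the mass. *)
Definition bump m (y0 : 'rV[R]_m) r y := Num.max 0 (1 - `|y - y0| / r).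

Lemma bump_Cc m (y0 : 'rV[R]_m) r : 0 < r -> Cc (`|y0| + r) (bump y0 r).
Proof.
move=> r0; split=> y.
  apply: (ct_eq (g := fun y => ((1 - `|y - y0| / r) + `|1 - `|y - y0| / r|) / 2)) => [w|].
    by rewrite /bump maxr_absE add0r sub0r normrN.
  have c1 : continuous_at y (fun y => 1 - `|y - y0| / r).
    apply: ctB; first exact: ct_cst.
    apply: ctM; last exact: ct_cst.
    by apply: ct_norm; apply: ctBv; [exact: ct_id|exact: ct_cst].
  by apply: ctM; [apply: ctD => //; exact: ct_norm|exact: ct_cst].
move=> yr; apply: max_l; rewrite subr_le0 ler_pdivlMr// mul1r.
have := ler_normD (y - y0) y0; rewrite subrK; lra.
Qed.

Definition bump_mass m (y0 : 'rV[R]_m) r := integralRn (bump y0 r).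
Lemma bump_mass_gt0 m (y0 : 'rV[R]_m) r : 0 < r -> 0 < bump_mass y0 r.
Proof.
move=> r0; apply: (@integralRn_pos R m _ _ (bump_Cc y0 r0) _ y0).
  by move=> y; rewrite /bump le_max lexx.
by rewrite /bump subrr normr0 mul0r subr0 max_r.
Qed.

(** For y in the ball of radius r around y0 the whole curve between the slices s1 and s2
    lies where chi = 1, and tau_y increases by at least c there. Integrating over y
    against the tent function gives the bound. *)
Lemma MA_lower (g : 'rV[R]_(1 + n) -> R) d N chi y0 r c s1 s2 kk :
  0 < d -> 0 <= N -> tests d N chi -> (forall z, 0 <= chi z) ->
  Ck 2 Om g -> cvx Om g -> 0 < r -> 0 <= c -> 0 < s1 -> s1 <= s2 -> s2 < 1 -> 0 < kk ->
  (forall k, 0 < k < kk -> forall z, s1 <= hd z <= s2 -> `|tl (Pk k g z) - y0| <= r -> chi z = 1) ->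
  (forall k, 0 < k < kk -> forall z1 z2, hd z1 = s1 -> hd z2 = s2 ->
    tl (Pk k g z1) = tl (Pk k g z2) -> `|tl (Pk k g z1) - y0| <= r ->
    c <= hd (Pk k g z2) - hd (Pk k g z1)) ->
  c * bump_mass y0 r <= MA_C2 g chi.
Proof.
move=> d0 N0 tc chi0 Cg cg r0 c0 s10 s12 s21 kk0 H1 H2.
apply/ler_addgt0Pr => e e0; have [k1 k10 Hk1] := MA_limit d0 tc Cg e0.
pose k := Num.min kk k1 / 2.
have m0 : 0 < Num.min kk k1 by rewrite lt_min kk0 k10.
have [m1 m2] : Num.min kk k1 <= kk /\ Num.min kk k1 <= k1 by rewrite !ge_min !lexx orbT.
have k0 : 0 < k by rewrite divr_gt0.
have kkk : 0 < k < kk by rewrite k0/= /k; lra.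
have kl : `|k| < k1 by rewrite gtr0_norm// /k; lra.
have := Hk1 k kl.
have sf := stripF_Pk k0 Cg cg.
rewrite (strip_formula k0 sf d0 N0 tc).
set m := (fun y => _).
have [K [K0 cK _]] := kern_tests k0 sf d0 N0 tc.
have cm : Cc K m by exact: (Cc_I1 K0 cK).
have m_ge y : c * bump y0 r y <= m y.
  have [yr|yr] := leP `|y - y0| r; last first.
    rewrite /bump max_l ?mulr0; last by rewrite subr_le0 ler_pdivlMr// mul1r ltW.
    have [K' K'1 [ck Hk']] := kern_CcR k0 sf d0 N0 tc y.
    rewrite /m (I1E Hk') -[0](mul0r (K' - - K')) -Ii_cst; last lra.
    apply: Ii_le => //; first by move=> ?; exact: ct_cst.
    by move=> t _; apply: (kern_ge0 k0 sf d0 N0 tc chi0).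
  apply: (@le_trans _ _ c).
    apply: ler_piMr => //; rewrite /bump ge_max ler01 gerBl divr_ge0// ltW//.
  have s01 s : s1 <= s <= s2 -> 0 < s < 1 by move=> /andP[? ?]; apply/andP; split; lra.
  have s1s : s1 <= s1 <= s2 by rewrite lexx.
  have s2s : s1 <= s2 <= s2 by rewrite lexx andbT.
  have c1 s : s1 <= s <= s2 -> chi (pt s (Xs k0 sf s y)) = 1.
    move=> ss; apply: (H1 k kkk); first by rewrite hd_pt.
    by rewrite XsK// s01.
  apply: le_trans (kern_lower d0 N0 tc chi0 s10 s12 s21 c1).
  by apply: (H2 k kkk); rewrite ?hd_pt// !XsK// s01.
have cb : Cc (Num.max K (`|y0| + r)) (fun y => c * bump y0 r y).
  have := Cc_lin c (bump_Cc y0 r0) (@Cc0 R n (`|y0| + r)).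
  rewrite (_ : (fun x => _ + 0) = fun y => c * bump y0 r y); last first.
    by apply/funext => x; rewrite addr0.
  by apply: CcW; rewrite le_max lexx orbT.
have cm' : Cc (Num.max K (`|y0| + r)) m by apply: CcW cm; rewrite le_max lexx.
have := radon_le (@radon_integralRn R n) cb cm' m_ge.
rewrite (radonZ c (@radon_integralRn R n) (bump_Cc y0 r0)) -/(bump_mass y0 r).
rewrite ltr_norml => h /andP[h1 h2]; lra.
Qed.

End ma.

(** * Box averages *)

Lemma ctDv (R : realType) (V W : normedModType R) (f g : V -> W) x :
  continuous_at x f -> continuous_at x g -> continuous_at x (fun y => f y + g y).
Proof. by move=> cf cg; apply: cvgD. Qed.

Section avg.
Context {R : realType} {m : nat}.
Implicit Types (f g : 'rV[R]_m -> R) (x : 'rV[R]_m) (h : R) (i j : 'I_m).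
Local Notation e_ i := (delta_mx 0 i : 'rV[R]_m).

(** The average over the segment of half-length h in the direction e_i. It preserves
    convexity and gains one derivative in the direction e_i, so that averaging twice
    in every direction makes a continuous function C^2 ([avgs_Ck]). *)
Definition avg h i f x := (2 * h)^-1 * Ii (- h) h (fun t => f (x + t *: e_ i)).

Lemma line_cont f x (v : 'rV[R]_m) : continuous f -> continuous (fun t : R => f (x + t *: v)).
Proof.
move=> cf t; apply: (ct_comp (f := fun t : R => x + t *: v) (g := f)); last exact: cf.
apply: ct_mx => i j; apply: (ct_eq (g := fun t : R => x i j + t * v i j)) => [y|].
  by rewrite !mxE.
by apply: ctD; [exact: ct_cst|apply: ctM; [exact: ct_id|exact: ct_cst]].
Qed.

Lemma unif_line f x i h e : continuous f -> 0 < e ->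
  exists2 d, 0 < d & forall v, `|v| < d -> forall t, - h <= t <= h ->
    `|f (x + v + t *: e_ i) - f (x + t *: e_ i)| < e.
Proof.
move=> cf e0; have [|d d0 Hd] := unif_slice (f := fun (v : 'rV[R]_m) (t : R) => f (x + v + t *: e_ i)) (t0 := 0)
    (@segment_compact R (- h) h) _ e0.
  move=> t _ {}e {}e0; have /cont_epsP /(_ e e0)[d d0 Hd] := cf (x + t *: e_ i).
  exists (d / 2); first by rewrite divr_gt0.
  move=> v s vd sd; rewrite addr0; apply: Hd.
  rewrite (_ : _ - _ = v + (s - t) *: e_ i); last first.
    by apply/rowP => k; rewrite !mxE; ring.
  rewrite subr0 in vd; apply: le_lt_trans (ler_normD _ _) _; rewrite [d]splitr; apply: ltr_leD => //.
  apply/ltW; apply: le_lt_trans sd; rewrite normrZ ler_piMr//.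
  apply/row_norm_le => // k; rewrite !mxE eqxx/=.
  by case: (k == i); rewrite ?normr1 ?normr0.
exists d => // v vd t ht; have := Hd v; rewrite subr0 => /(_ vd t).
by rewrite addr0; apply; rewrite /= in_itv.
Qed.

Lemma avg_le h i f g x : 0 < h -> continuous f -> continuous g ->
  (forall t, `|t| <= h -> f (x + t *: e_ i) <= g (x + t *: e_ i)) -> avg h i f x <= avg h i g x.
Proof.
move=> h0 cf cg H; rewrite /avg; apply: ler_wpM2l; first by rewrite invr_ge0 mulr_ge0// ltW.
apply: Ii_le; [exact: line_cont|exact: line_cont|].
by move=> t ht; apply: H; rewrite ler_norml.
Qed.

Lemma avg_lin h i f g a x : continuous f -> continuous g ->
  avg h i (fun y => a * f y + g y) x = a * avg h i f x + avg h i g x.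
Proof.
move=> cf cg; rewrite /avg IiD; last exact: line_cont.
  by rewrite IiZ; [ring|exact: line_cont].
by move=> t; apply: ctM; [exact: ct_cst|exact: line_cont].
Qed.

Lemma avgZ h i f a x : continuous f -> avg h i (fun y => a * f y) x = a * avg h i f x.
Proof. by move=> cf; rewrite /avg IiZ; [ring|exact: line_cont]. Qed.

Lemma avg_cst h i c x : 0 < h -> avg h i (fun=> c) x = c.
Proof.
move=> h0; rewrite /avg Ii_cst; last lra.
by field; rewrite gt_eqF.
Qed.

Lemma avg_shift h i f v x : avg h i (fun y => f (y + v)) x = avg h i f (x + v).
Proof. by rewrite /avg; congr (_ * Ii _ _ _); apply/funext => t; rewrite addrAC. Qed.

Lemma avg_abs h i f x c e : 0 < h -> continuous f ->
  (forall t, `|t| <= h -> `|f (x + t *: e_ i) - c| <= e) -> `|avg h i f x - c| <= e.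
Proof.
move=> h0 cf H; rewrite ler_distl -[c - e](@avg_cst h i _ x)// -[c + e](@avg_cst h i _ x)//.
apply/andP; split; apply: avg_le => //; try by move=> ?; exact: ct_cst.
  by move=> t /H; rewrite ler_distl => /andP[].
by move=> t /H; rewrite ler_distl => /andP[].
Qed.

Lemma avg_cont h i f : 0 < h -> continuous f -> continuous (avg h i f).
Proof.
move=> h0 cf x; apply/cont_epsP => e e0; have e2 : 0 < e / 2 by rewrite divr_gt0.
have [d d0 Hd] := unif_line x i h cf e2.
exists d => // y yx.
have -> : avg h i f y - avg h i f x = avg h i (fun z => -1 * f z + f (z + (y - x))) x.
  rewrite avg_lin//; last first.
    move=> z; apply: (ct_comp (f := fun z : 'rV[R]_m => z + (y - x)) (g := f)); last exact: cf.
    by apply: ctDv; [exact: ct_id|exact: ct_cst].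
  by rewrite avg_shift addrCA subrr addr0 mulN1r addrC.
rewrite -[X in `|X|]subr0; apply: (@le_lt_trans _ _ (e / 2)); last lra.
apply: avg_abs => // [z|t th].
  apply: ctD; first by apply: ctM; [exact: ct_cst|exact: cf].
  apply: (ct_comp (f := fun z : 'rV[R]_m => z + (y - x)) (g := f)); last exact: cf.
  by apply: ctDv; [exact: ct_id|exact: ct_cst].
rewrite subr0 mulN1r addrC [x + _ + _]addrAC; apply/ltW; apply: Hd => //.
by rewrite -ler_norml.
Qed.

(** The derivative of an average is this difference quotient ([avg_derive_same]), which
    commutes with the other averages. *)
Definition dif h i f x := (2 * h)^-1 * (f (x + h *: e_ i) - f (x - h *: e_ i)).

Lemma dif_cont h i f : continuous f -> continuous (dif h i f).
Proof.
move=> cf x; apply: ctM; first exact: ct_cst.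
apply: ctB.
  apply: (ct_comp (f := fun z : 'rV[R]_m => z + h *: e_ i) (g := f)); last exact: cf.
  by apply: ctDv; [exact: ct_id|exact: ct_cst].
apply: (ct_comp (f := fun z : 'rV[R]_m => z - h *: e_ i) (g := f)); last exact: cf.
by apply: ctBv; [exact: ct_id|exact: ct_cst].
Qed.

Lemma avg_dif h i j f : 0 < h -> continuous f -> avg h i (dif h j f) = dif h j (avg h i f).
Proof.
move=> h0 cf; apply/funext => x; rewrite /dif -!avg_shift.
have cs (v : 'rV[R]_m) : continuous (fun y : 'rV[R]_m => f (y + v)).
  move=> z; apply: (ct_comp (f := fun z : 'rV[R]_m => z + v) (g := f)); last exact: cf.
  by apply: ctDv; [exact: ct_id|exact: ct_cst].
set v := h *: _; set k := (2 * h)^-1.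
rewrite (_ : (fun y => k * (f (y + v) - f (y - v))) = (fun y => k * f (y + v) + (fun y => (- k) * f (y - v)) y)); last first.
  by apply/funext => y; ring.
rewrite avg_lin//; last first.
  by move=> z; apply: ctM; [exact: ct_cst|exact: cs].
by rewrite avgZ//; ring.
Qed.

Lemma avg_derive_same h i f x : 0 < h -> continuous f ->
  is_derive x (e_ i) (avg h i f) (dif h i f x).
Proof.
move=> h0 cf; pose phi t := f (x + t *: e_ i).
have cphi : continuous phi by exact: line_cont.
pose Phi v := Ii (- h - 1) v phi.
have dPhi v : - h - 1 < v -> is_derive v (1:R) Phi (phi v) by move=> hv; exact: Ii_prim.
have E u : `|u| < 1 -> avg h i f (x + u *: e_ i) = (2 * h)^-1 * (Phi (u + h) - Phi (u - h)).
  move=> u1; rewrite /avg; congr (_ * _).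
  rewrite (_ : (fun t => _) = fun t => phi (u + t)); last first.
    by apply/funext => t; rewrite /phi scalerDl addrA.
  apply: (@Ii_FTC2 _ _ (fun t => Phi (u + t))); first lra.
    move=> t; apply: (ct_comp (f := fun t : R => u + t) (g := phi)); last exact: cphi.
    by apply: ctD; [exact: ct_cst|exact: ct_id].
  move=> t /andP[t1 t2]; apply/is_derive_epsP => e e0.
  have hu : - h - 1 < u + t by move: u1; rewrite ltr_norml => /andP[]; lra.
  have /is_derive_epsP /(_ e e0)[d d0 Hd] := dPhi _ hu.
  by exists d => // k kd; rewrite addrA; exact: Hd.
apply/is_derive_vepsP => e e0.
have hh : - h - 1 < h by lra.
have hm : - h - 1 < - h by lra.
have eh : 0 < e * h by rewrite mulr_gt0.
have /is_derive_epsP /(_ _ eh)[d1 d10 H1] := dPhi h hh.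
have /is_derive_epsP /(_ _ eh)[d2 d20 H2] := dPhi (- h) hm.
exists (Num.min 1 (Num.min d1 d2)); first by rewrite !lt_min ltr01 d10.
move=> k; rewrite !lt_min => /and3P[k1 kd1 kd2].
have z1 : `|(0 : R)| < 1 by rewrite normr0.
have E0 := E 0 z1; rewrite scale0r addr0 !add0r in E0.
rewrite E// E0 /dif.
have -> : x - h *: e_ i = x + (- h) *: e_ i by rewrite scaleNr.
rewrite -/(phi h) -/(phi (- h)).
have a1 := H1 k kd1; have a2 := H2 k kd2.
rewrite [h + k]addrC in a1; rewrite [- h + k]addrC in a2.
have -> : (2 * h)^-1 * (Phi (k + h) - Phi (k - h)) - (2 * h)^-1 * (Phi h - Phi (- h)) -
   k * ((2 * h)^-1 * (phi h - phi (- h))) =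
   (2 * h)^-1 * ((Phi (k + h) - Phi h - k * phi h) - (Phi (k - h) - Phi (- h) - k * phi (- h))).
  by ring.
rewrite normrM gtr0_norm ?invr_gt0 ?mulr_gt0//.
rewrite mulrC ler_pdivrMr ?mulr_gt0//.
apply: le_trans (ler_normB _ _) _; apply: le_trans (lerD a1 a2) _.
by rewrite le_eqVlt; apply/orP; left; apply/eqP; ring.
Qed.

Lemma avg_derive_other h i j f df x : 0 < h -> continuous f -> continuous df ->
  (forall y, is_derive y (e_ j) f (df y)) -> is_derive x (e_ j) (avg h i f) (avg h i df x).
Proof.
move=> h0 cf cdf Hf; apply/is_derive_vepsP => e e0.
have [d d0 Hd] := unif_line x i h cdf e0.
exists d => // k kd.
have cs (v : 'rV[R]_m) : continuous (fun y : 'rV[R]_m => f (y + v)).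
  move=> z; apply: (ct_comp (f := fun z : 'rV[R]_m => z + v) (g := f)); last exact: cf.
  by apply: ctDv; [exact: ct_id|exact: ct_cst].
have cg : continuous (fun y => -1 * f y + (- k) * df y).
  by move=> z; apply: ctD; (apply: ctM; [exact: ct_cst|]); [exact: cf|exact: cdf].
have -> : avg h i f (x + k *: e_ j) - avg h i f x - k * avg h i df x =
    avg h i (fun y => 1 * f (y + k *: e_ j) + (-1 * f y + (fun y => (- k) * df y) y)) x.
  have c3 : continuous (fun y => - k * df y).
    by move=> z; apply: ctM; [exact: ct_cst|exact: cdf].
  by rewrite (@avg_lin h i _ _ 1 x (cs _) cg) (@avg_lin h i _ _ (-1) x cf c3) avgZ// avg_shift; ring.
rewrite -[X in `|X|]subr0; apply: avg_abs => //.
  move=> z; apply: ctD; first by apply: ctM; [exact: ct_cst|exact: cs].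
  apply: ctD; first by apply: ctM; [exact: ct_cst|exact: cf].
  by apply: ctM; [exact: ct_cst|exact: cdf].
move=> t th; set y := x + t *: e_ i.
have [|s sk E] := @mvt_sym R (fun u => f (y + u *: e_ j)) (fun u => df (y + u *: e_ j)) k.
  move=> u _; have /is_derive_vepsP H := Hf (y + u *: e_ j).
  apply/is_derive_epsP => a a0; have [b b0 Hb] := H a a0; exists b => // v /Hb.
  by rewrite scalerDl addrA.
rewrite scale0r addr0 in E.
have -> : 1 * f (y + k *: e_ j) + (-1 * f y + (- k * df y)) - 0 = (df (y + s *: e_ j) - df y) * k.
  by rewrite mulrBl -E; ring.
rewrite normrM ler_wpM2r//; apply/ltW.
have -> : y + s *: e_ j = x + s *: e_ j + t *: e_ i by rewrite /y addrAC.
apply: Hd; last by rewrite -ler_norml.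
apply: le_lt_trans kd; apply: le_trans sk; rewrite normrZ ler_piMr//.
apply/row_norm_le => // l; rewrite !mxE eqxx/=.
by case: (l == j); rewrite ?normr1 ?normr0.
Qed.

Definition avgs h (l : seq 'I_m) f := foldr (fun i g => avg h i g) f l.

Lemma avgs_cont h l f : 0 < h -> continuous f -> continuous (avgs h l f).
Proof. by move=> h0 cf; elim: l => [//|i l IH]; exact: avg_cont. Qed.

Lemma avgs_dif h l j f : 0 < h -> continuous f -> avgs h l (dif h j f) = dif h j (avgs h l f).
Proof.
move=> h0 cf; elim: l => [//|i l /= ->]; rewrite avg_dif//; exact: avgs_cont.
Qed.

Lemma avgs_derive h l j f x : 0 < h -> continuous f -> j \in l ->
  is_derive x (e_ j) (avgs h l f) (avgs h (rem j l) (dif h j f) x).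
Proof.
move=> h0 cf; elim: l x => [//|i l IH] x; rewrite inE /=.
have [->|ij] := eqVneq i j.
  by move=> _; rewrite avgs_dif//; apply: avg_derive_same => //; exact: avgs_cont.
move=> /= jl; apply: avg_derive_other => //.
- exact: avgs_cont.
- by apply: avgs_cont => //; exact: dif_cont.
- by move=> y; exact: IH.
Qed.

(** Each derivative in the direction e_i consumes one occurrence of i in the list of
    averages. *)
Lemma avgs_Ck k h l f : 0 < h -> continuous f -> (forall i, (k <= count_mem i l)%N) ->
  Ck k setT (avgs h l f).
Proof.
move=> h0; elim: k l f => [|k IH] l f cf Hl.
  by split=> // x _; exact: avgs_cont.
split=> [x _|i]; first exact: avgs_cont.
have il : i \in l by rewrite -has_pred1 has_count (leq_ltn_trans _ (Hl i)).
split=> [x _|]; first exact: (@ex_derive _ _ _ _ _ _ _ (avgs_derive x h0 cf il)).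
have -> : partial i (avgs h l f) = avgs h (rem i l) (dif h i f).
  by apply/funext => x; rewrite /partial (@derive_val _ _ _ _ _ _ _ (avgs_derive x h0 cf il)).
apply: IH; first exact: dif_cont.
move=> j; have := Hl j; have /permP /(_ (pred1 j)) -> := perm_to_rem il.
by rewrite /=; case: (i == j) => /=; rewrite ?add1n ?add0n ?ltnS// => /ltnW.
Qed.

Lemma CkS k (E : set 'rV[R]_m) f : Ck k setT f -> Ck k E f.
Proof.
elim: k f => [|k IH] f /=; first by move=> [cf _]; split=> // x _; exact: cf.
move=> [cf H]; split=> [x _|i]; first exact: cf.
by split=> [x _|]; [exact: (H i).1|apply: IH; exact: (H i).2].
Qed.

Lemma avgs_abs h l f x c e : 0 < h -> continuous f ->
  (forall y, `|y - x| <= (size l)%:R * h -> `|f y - c| <= e) -> `|avgs h l f x - c| <= e.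
Proof.
move=> h0 cf; elim: l x => [|i l IH] x H; first by apply: H; rewrite subrr normr0 mul0r.
apply: avg_abs => //; first exact: avgs_cont.
move=> t th; apply: IH => y yx; apply: H; rewrite /= -natr1 mulrDl mul1r.
have -> : y - x = (y - (x + t *: e_ i)) + t *: e_ i by rewrite opprD addrA subrK.
apply: le_trans (ler_normD _ _) _; apply: lerD => //.
apply: le_trans th; rewrite normrZ ler_piMr//.
apply/row_norm_le => // k; rewrite !mxE eqxx/=.
by case: (k == i); rewrite ?normr1 ?normr0.
Qed.

(** An average of translates of a convex function is convex, on a set from which the
    translates do not leave the domain. *)
Lemma avg_cvx h i f (E E' : set 'rV[R]_m) : 0 < h -> continuous f -> cvx E' f ->
  (forall x t, E x -> `|t| <= h -> E' (x + t *: e_ i)) -> cvx E (avg h i f).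
Proof.
move=> h0 cf cE EE x y t Ex Ey t01.
have cs (v : 'rV[R]_m) : continuous (fun y : 'rV[R]_m => f (y + v)).
  move=> z; apply: (ct_comp (f := fun z : 'rV[R]_m => z + v) (g := f)); last exact: cf.
  by apply: ctDv; [exact: ct_id|exact: ct_cst].
have -> : avg h i f x + t * (avg h i f y - avg h i f x) =
    avg h i (fun z => t * f (z + (y - x)) + (fun z => (1 - t) * f z) z) x.
  rewrite avg_lin//; last by move=> z; apply: ctM; [exact: ct_cst|exact: cf].
  by rewrite avgZ// avg_shift addrCA subrr addr0; ring.
rewrite -avg_shift; apply: avg_le => //.
  move=> z; apply: ctD; first by apply: ctM; [exact: ct_cst|exact: cs].
  by apply: ctM; [exact: ct_cst|exact: cf].
move=> s sh; have := cE (x + s *: e_ i) (y + s *: e_ i) t (EE _ _ Ex sh) (EE _ _ Ey sh) t01.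
have -> : y + s *: e_ i - (x + s *: e_ i) = y - x by rewrite opprD addrACA subrr addr0.
have -> : x + s *: e_ i + (y - x) = y + s *: e_ i by apply/rowP => k; rewrite !mxE; ring.
lra.
Qed.

End avg.

(** * Mollification on the strip and subgradients *)

Section moll.
Context {R : realType}.

Lemma unif_near (V : normedModType R) (K : set V) (f : V -> R) e : compact K ->
  (forall z, K z -> continuous_at z f) -> 0 < e ->
  exists2 d, 0 < d & forall z, K z -> forall w, `|w - z| < d -> `|f w - f z| < e.
Proof.
move=> cK cf e0.
have [|d d0 Hd] := unif_slice (f := fun w z : V => f (z + w)) (t0 := 0) cK _ e0.
  move=> z Kz {}e {}e0; have /cont_epsP /(_ e e0)[d d0 Hd] := cf z Kz.
  exists (d / 2); first by rewrite divr_gt0.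
  move=> w y; rewrite subr0 addr0 => wd yz; apply: Hd.
  rewrite (_ : y + w - z = (y - z) + w); last by rewrite addrAC.
  by apply: le_lt_trans (ler_normD _ _) _; lra.
exists d => // z Kz w wz; have := Hd (w - z); rewrite subr0 => /(_ wz z Kz).
by rewrite addr0 addrCA subrr addr0.
Qed.

(** A convex function bounded near a point is Lipschitz there: compare with the values
    at the ends of a chord of length 2 r through z. *)
Lemma cvx_cont m (E : set 'rV[R]_m) f z r M : cvx E f -> 0 < r ->
  (forall w, `|w - z| <= r -> E w /\ `|f w| <= M) -> continuous_at z f.
Proof.
move=> cE r0 H.
have M0 : 0 <= M by have [|_] := H z; rewrite ?subrr ?normr0 ?(ltW r0)//; exact: le_trans.
apply: (@lip_cont R _ _ f z (2 * M / r) r) => //; first by rewrite divr_ge0 ?mulr_ge0// ltW.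
move=> v vr; have [->|v0] := eqVneq v 0; first by rewrite addr0 subrr !normr0 mulr0.
have {}v0 : 0 < `|v| by rewrite normr_gt0.
pose t := `|v| / r; have t0 : 0 < t by rewrite divr_gt0.
have t1 : t <= 1 by rewrite ler_pdivrMr// mul1r ltW.
have nv : `|t^-1 *: v| <= r.
  by rewrite normrZ normfV gtr0_norm// /t invf_div mulfVK// gt_eqF.
have Hz := H z; rewrite subrr normr0 in Hz; have [Ez Mz] := Hz (ltW r0).
have [|Ep Mp] := H (z + t^-1 *: v); first by rewrite addrC addKr.
have [|En Mn] := H (z - t^-1 *: v); first by rewrite addrC addKr normrN.
have [|Ev Mv] := H (z + v); first by rewrite addrC addKr ltW.
have tt : 0 <= t <= 1 by rewrite ltW.
have := cE z (z + t^-1 *: v) t Ez Ep tt.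
rewrite [z + _ - z]addrC addKr scalerA divff ?gt_eqF// scale1r => h1.
have s0 : 0 < 1 + t by lra.
pose s := t / (1 + t).
have ss : 0 <= s <= 1.
  by rewrite /s divr_ge0 ?(ltW t0) ?(ltW s0)//= ler_pdivrMr//; lra.
have := cE (z + v) (z - t^-1 *: v) s Ev En ss.
have -> : z + v + s *: (z - t^-1 *: v - (z + v)) = z.
  have -> : z - t^-1 *: v - (z + v) = - (t^-1 + 1) *: v.
    by apply/rowP => i; rewrite !mxE; ring.
  rewrite scalerA (_ : s * - (t^-1 + 1) = -1); last by rewrite /s; field; rewrite !gt_eqF.
  by rewrite scaleN1r addrK.
move=> h2; have st : s <= t by rewrite /s ler_pdivrMr// ler_peMr ?ltW//; lra.
move: Mz Mp Mn Mv; rewrite !ler_norml => /andP[a1 a2] /andP[b1 b2] /andP[c1 c2] /andP[d1 d2].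
have e1 : t * (f (z + t^-1 *: v) - f z) <= t * (2 * M) by apply: ler_wpM2l; lra.
have e2 : s * (f (z - t^-1 *: v) - f (z + v)) <= t * (2 * M).
  apply: (@le_trans _ _ (s * (2 * M))); first by apply: ler_wpM2l; lra.
  by apply: ler_wpM2r => //; lra.
have -> : 2 * M / r * `|v| = t * (2 * M) by rewrite /t; ring.
by apply/andP; split; lra.
Qed.

Lemma cvxS m (E E' : set 'rV[R]_m) f : E `<=` E' -> cvx E' f -> cvx E f.
Proof. by move=> EE cE x y t Ex Ey; apply: cE; exact: EE. Qed.

Section strip.
Context {n : nat}.
Local Notation Om := (@open_strip R n).

Definition wstrip w : set 'rV[R]_(1 + n) := [set z | - w < hd z < 1 + w].

Lemma avgs_cvx h l f w : 0 < h -> continuous f -> cvx (wstrip (w + (size l)%:R * h)) f ->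
  cvx (wstrip w) (avgs h l f).
Proof.
move=> h0 cf; elim: l w => [|i l IH] w; first by rewrite mul0r addr0.
rewrite /= -natr1 => H; apply: (@avg_cvx R _ h i (avgs h l f) _ (wstrip (w + h))) => //.
- exact: avgs_cont.
- by apply: IH; rewrite (_ : w + h + _ = w + ((size l)%:R + 1) * h)//; ring.
- move=> x t; rewrite /wstrip/= hdD => /andP[x0 x1] th.
  have : `|hd (t *: (delta_mx 0 i : 'rV[R]_(1 + n)))| <= h.
    apply: le_trans (hd_le _) _; apply: le_trans th; rewrite normrZ ler_piMr//.
    apply/row_norm_le => // k; rewrite !mxE eqxx/=.
    by case: (k == i); rewrite ?normr1 ?normr0.
  by rewrite ler_norml => /andP[a1 a2]; apply/andP; split; lra.
Qed.

(** Averaging u needs values outside the strip. Contracting the strip towards s = 1/2 by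
    the factor 1 - 2 delta first makes u convex on a slightly wider strip; the clamp
    only serves to obtain a function continuous everywhere and does not act on that
    wider strip. *)
Theorem mollify u : cvx Om u -> (forall z, Om z -> continuous_at z u) ->
  exists g : nat -> 'rV[R]_(1 + n) -> R,
    [/\ forall k, Ck 2 Om (g k), forall k, cvx Om (g k) & lu_cvg g u].
Proof.
move=> cu ctu.
pose l := enum 'I_(1 + n) ++ enum 'I_(1 + n).
pose L : R := (size l)%:R.
(* starting at 3 makes 1 - 2 de positive *)
pose de (k : nat) : R := k.+3%:R^-1.
pose h k : R := de k / (2 * (L + 1)).
have L0 : 0 <= L by exact: ler0n.
have de0 k : 0 < de k by rewrite invr_gt0.
have de1 k : de k <= 3^-1 by rewrite lef_pV2 ?posrE// ler_nat.
have h0 k : 0 < h k by rewrite divr_gt0// mulr_gt0// ltr_wpDl.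
have Lh k : L * h k <= de k / 2.
  have -> : L * h k = de k / 2 * (L / (L + 1)) by rewrite /h invfM; ring.
  apply: ler_piMr; first by rewrite divr_ge0// ltW.
  by rewrite ler_pdivrMr ?ltr_wpDl//; lra.
pose clamp (a t : R) := Num.max a (Num.min t (1 - a)).
pose c k s := 2^-1 + (1 - 2 * de k) * (s - 2^-1).
(* s |-> c k s maps ]-de/2, 1 + de/2[ into [de/2, 1 - de/2], where the clamp is trivial *)
pose f k (z : 'rV[R]_(1 + n)) := u (pt (clamp (de k / 2) (c k (hd z))) (tl z)).
have clampP a t : a <= 1 - a -> a <= clamp a t <= 1 - a.
  by move=> ha; rewrite /clamp le_max lexx/= ge_max ha ge_min lexx orbT.
have clampE k s : - (de k / 2) < s < 1 + de k / 2 -> clamp (de k / 2) (c k s) = c k s.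
  move=> /andP[s0 s1]; have d0 := de0 k; have d1 := de1 k.
  have p : 0 < 1 - 2 * de k by lra.
  have q : 0 <= de k * de k by rewrite mulr_ge0// ltW.
  have q1 : (1 - 2 * de k) * (- (de k / 2) - 2^-1) <= (1 - 2 * de k) * (s - 2^-1).
    by apply: ler_wpM2l; lra.
  have q2 : (1 - 2 * de k) * (s - 2^-1) <= (1 - 2 * de k) * (1 + de k / 2 - 2^-1).
    by apply: ler_wpM2l; lra.
  by rewrite /clamp /c min_l ?max_r//; lra.
have Ocl k z : Om (pt (clamp (de k / 2) (c k (hd z))) (tl z)).
  rewrite /open_strip/= -/(hd (pt _ _)) hd_pt; have d0 := de0 k; have d1 := de1 k.
  have /(clampP _ (c k (hd z)))/andP[? ?] : de k / 2 <= 1 - de k / 2 by lra.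
  by apply/andP; split; lra.
have cf k : continuous (f k).
  move=> z; apply: (ct_comp (f := fun z => pt (clamp (de k / 2) (c k (hd z))) (tl z)) (g := u)); last exact: ctu.
  apply: ct_pt; last exact: ct_tl.
  have cc : continuous_at z (fun z => c k (hd z)).
    apply: ctD; first exact: ct_cst.
    by apply: ctM; [exact: ct_cst|apply: ctB; [exact: ct_hd|exact: ct_cst]].
  set a := de k / 2.
  have cm : continuous_at z (fun z => Num.min (c k (hd z)) (1 - a)).
    apply: (ct_eq (g := fun z => (c k (hd z) + (1 - a) - `|c k (hd z) - (1 - a)|) / 2)) => [y|].
      by rewrite minr_absE.
    apply: ctM; last exact: ct_cst.
    apply: ctB; first by apply: ctD => //; exact: ct_cst.
    by apply: ct_norm; apply: ctB => //; exact: ct_cst.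
  apply: (ct_eq (g := fun z => (a + Num.min (c k (hd z)) (1 - a) + `|a - Num.min (c k (hd z)) (1 - a)|) / 2)) => [y|].
    by rewrite /clamp maxr_absE.
  apply: ctM; last exact: ct_cst.
  apply: ctD; first by apply: ctD => //; exact: ct_cst.
  by apply: ct_norm; apply: ctB => //; exact: ct_cst.
exists (fun k => avgs (h k) l (f k)); split=> [k|k|d N e d0 e0].
- apply: CkS; apply: avgs_Ck => // i; rewrite count_cat.
  by rewrite !count_uniq_mem ?enum_uniq// !mem_enum.
- have -> : Om = wstrip 0.
    by apply/seteqP; split => z; rewrite /wstrip/= oppr0 addr0.
  apply: avgs_cvx => //; rewrite add0r.
  apply: (@cvxS _ _ (wstrip (de k / 2))).
    by move=> z; rewrite /wstrip/= => /andP[a b]; have := Lh k; rewrite /L => H; apply/andP; split; lra.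
  move=> x y t xs ys t01; rewrite /f.
  have cvx_hd (a b : R) : - (de k / 2) < a < 1 + de k / 2 -> - (de k / 2) < b < 1 + de k / 2 ->
     - (de k / 2) < a + t * (b - a) < 1 + de k / 2.
    move=> /andP[a1 a2] /andP[b1 b2]; have /andP[t0 t1] := t01.
    have : (1 - t) * (- (de k / 2)) + t * (- (de k / 2)) < (1 - t) * a + t * b.
      have [->|t0'] := eqVneq t 0; first lra.
      have tp : 0 < t by rewrite lt_neqAle eq_sym t0'.
      by apply: ler_ltD; [apply: ler_wpM2l; lra|rewrite ltr_pM2l].
    have : (1 - t) * a + t * b < (1 - t) * (1 + de k / 2) + t * (1 + de k / 2).
      have [->|t0'] := eqVneq t 0; first lra.
      have tp : 0 < t by rewrite lt_neqAle eq_sym t0'.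
      by apply: ler_ltD; [apply: ler_wpM2l; lra|rewrite ltr_pM2l].
    lra.
  have xys := cvx_hd _ _ xs ys.
  have h3 : hd (x + t *: (y - x)) = hd x + t * (hd y - hd x) by rewrite hdD hdZ hdB.
  have Ox := Ocl k x; have Oy := Ocl k y.
  have := cu _ _ t Ox Oy t01; rewrite h3 !clampE//.
  rewrite (_ : pt (c k (hd x)) (tl x) + t *: _ = pt (c k (hd x + t * (hd y - hd x))) (tl (x + t *: (y - x))))//.
  rewrite ptB ptZ ptD tlD tlZ tlB; congr pt; rewrite /c; ring.
- have e2 : 0 < e / 2 by rewrite divr_gt0.
  have [r r0 Hr] := unif_near (@Kbox_compact R n d N) (fun z Kz => ctu z (Kbox_sub d0 Kz)) e2.
  have r3 : 0 < r / 3 by rewrite divr_gt0.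
  have [J _ HJ] := near_infty_natSinv_lt (PosNum r3).
  exists J => j Jj z Kz; apply: (@le_lt_trans _ _ (e / 2)); last lra.
  apply: avgs_abs => // y yz; apply/ltW/Hr => //.
  have dj : de j < r / 3.
    have /= h1 := HJ j Jj; apply: le_lt_trans h1.
    by rewrite /de lef_pV2 ?posrE// ler_nat ltnW.
  have yz2 : `|y - z| <= de j / 2 by apply: le_trans yz (Lh j).
  have hy := le_trans (hd_le _) yz2; rewrite hdB in hy.
  have [/andP[z1 z2] _] := Kz; have dj0 := de0 j; have dj1 := de1 j.
  move: (hy); rewrite ler_norml => /andP[y1 y2].
  rewrite clampE; last by apply/andP; split; lra.
  rewrite -[z in _ - z]pt_hd_tl ptB; apply: pt_norm_lt; last first.
    rewrite -tlB; apply: le_lt_trans (tl_le _) _; apply: le_lt_trans yz2 _; lra.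
  rewrite /c (_ : _ - _ = (hd y - hd z) + (- 2 * de j) * (hd y - 2^-1)); last by field.
  apply: le_lt_trans (ler_normD _ _) _.
  have : `|(- 2 * de j) * (hd y - 2^-1)| <= 2 * de j.
    have n2 : - 2 * de j < 0 by lra.
    rewrite normrM (ltr0_norm n2) (_ : - (- 2 * de j) = 2 * de j); last by ring.
    apply: ler_piMr; first by rewrite mulr_ge0// ltW.
    by rewrite ler_norml; apply/andP; split; lra.
  lra.
Qed.

(** The gradients at z of a mollified sequence are bounded, and a cluster point of them
    is a subgradient. *)
Theorem subgrad_exists u z : cvx Om u -> (forall z, Om z -> continuous_at z u) -> Om z ->
  exists p, subgrad u z p.
Proof.
move=> cu ctu Oz; have [g [Cg cg gu]] := mollify cu ctu.
have cy : compact [set z] by exact: compact_set1.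
have sy : [set z] `<=` Om by move=> y ->.
have [d [N [d0 _ KB]]] := compact_Kbox cy sy.
have Kz : Kbox d N z by exact: KB.
have [B [J [B0 HB]]] := Pk_bound N d0 Cg cg gu ctu.
pose p j := Pk 0 (g (maxn j J)) z.
have [p0 ap] : exists p0, cluster_point p p0.
  apply: (@acc_exists _ _ _ B) => j; apply: HB => //; first exact: leq_maxr.
  by rewrite lexx ler01.
exists p0.
have c1 : continuous_at p0 (fun _ : 'rV[R]_(1 + n) => z) by exact: ct_cst.
have c2 : continuous_at p0 (@id 'rV[R]_(1 + n)) by exact: ct_id.
have kapc (e : R) : 0 < e -> exists J, forall j : nat, (J <= j)%N -> (0 : R) <= e.
  by move=> e0; exists 0%N => j _; exact: ltW.
have [] // := @acc_subgrad R n g u (fun=> 0) (fun j => maxn j J) _ p p0 (fun=> z) id d N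
  d0 Cg cg gu ctu (fun j => leq_maxl j J) (fun=> lexx 0) kapc ap c1 c2
  (fun=> Kz) (fun=> erefl).
Qed.

End strip.
End moll.

(** * The envelope of affine minorants solves the Dirichlet problem *)

Section core.
Context {R : realType} {n : nat}.
Local Notation Om := (@open_strip R n).
Implicit Types (x y : 'rV[R]_n) (s a b : R).

(** The affine function of (s, x) with slope y in x and values -a at (0,0), -b at (1,0). *)
Definition ell y a b s x := dotv x y - (1 - s) * a - s * b.

Definition adm (psi0 psi1 : 'rV[R]_n -> R) y a b :=
  (forall x, dotv x y - a <= psi0 x) /\ (forall x, dotv x y - b <= psi1 x).

(** [psi] is the supremum of the functions [ell] over the admissible triples, stated by
    upper bound and approximation. *)
Definition envelope psi0 psi1 (psi : R -> 'rV[R]_n -> R) := forall s x, 0 <= s <= 1 ->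
  (forall y a b, adm psi0 psi1 y a b -> ell y a b s x <= psi s x) /\
  (forall e, 0 < e -> exists y a b, adm psi0 psi1 y a b /\ psi s x - e < ell y a b s x).

Lemma joint_pt (psi : R -> 'rV[R]_n -> R) s x : joint psi (pt s x) = psi s x.
Proof. by rewrite /joint -/(hd _) -/(tl _) hd_pt tl_pt. Qed.

Lemma stripP z : @strip R n z <-> 0 <= hd z <= 1. Proof. by []. Qed.

Lemma ell_conv y a b (z w : 'rV[R]_(1 + n)) t :
  ell y a b (hd (z + t *: (w - z))) (tl (z + t *: (w - z))) =
  ell y a b (hd z) (tl z) + t * (ell y a b (hd w) (tl w) - ell y a b (hd z) (tl z)).
Proof.
rewrite hdD hdZ hdB tlD tlZ tlB /ell dotvDl dotvZl dotvBl; ring.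
Qed.

(** A supporting affine function at an interior point stays below psi up to the boundary
    of the strip: a midpoint of z and a boundary point is interior, where the
    subgradient inequality holds, and convexity carries it to the boundary. The
    values at s = 0 and s = 1 then give the admissible triple. *)
Lemma subgrad_adm psi z p : cvx (@strip R n) (joint psi) -> Om z -> subgrad (joint psi) z p ->
  exists a b, [/\ adm (psi 0) (psi 1) (tl p) a b, ell (tl p) a b (hd z) (tl z) = joint psi z
   & hd p = a - b].
Proof.
move=> cpsi Oz sp.
pose a := - (joint psi z - hd z * hd p - dotv (tl z) (tl p)).
exists a, (a - hd p).
have zS : strip z by apply/stripP; move: Oz; rewrite /open_strip/= -/(hd z) => /andP[/ltW -> /ltW ->].
have ellE w : ell (tl p) a (a - hd p) (hd w) (tl w) = joint psi z + dotv p (w - z).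
  by rewrite dotv_pt hdB tlB dotvBr /ell /a (dotvC (tl p) (tl w)) (dotvC (tl p) (tl z)); ring.
have ext w : strip w -> ell (tl p) a (a - hd p) (hd w) (tl w) <= joint psi w.
  move=> wS; rewrite ellE.
  have h01 : 0 <= (2^-1 : R) <= 1 by lra.
  have := cpsi z w 2^-1 zS wS h01; set w' := z + _ => h1.
  have Ow : Om w'.
    move: Oz wS; rewrite /open_strip/strip/= -/(hd z) -/(hd w) -/(hd w') => /andP[z1 z2] /andP[w1 w2].
    have -> : hd w' = hd z + 2^-1 * (hd w - hd z) by rewrite /w' hdD hdZ hdB.
    by apply/andP; split; lra.
  have E : w' - z = 2^-1 *: (w - z) by rewrite /w' addrC addKr.
  have h2 := sp _ Ow; rewrite E dotvZr in h2.
  move: h1 h2; set A := joint psi z; set A' := joint psi w'; set A2 := joint psi w.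
  set D := dotv p _ => h1 h2; lra.
split; last by ring.
  split=> x.
    have S0 : strip (pt 0 x) by apply/stripP; rewrite hd_pt lexx ler01.
    by have := ext _ S0; rewrite joint_pt /ell hd_pt tl_pt; lra.
  have S1 : strip (pt 1 x) by apply/stripP; rewrite hd_pt lexx ler01.
  by have := ext _ S1; rewrite joint_pt /ell hd_pt tl_pt; lra.
by rewrite ellE subrr /dotv big1 ?addr0// => i _; rewrite mxE mulr0.
Qed.

Lemma loc_bd (psiw : 'rV[R]_n -> R) x : continuous psiw ->
  exists r M, 0 < r /\ forall x', `|x' - x| <= r -> `|psiw x'| <= M.
Proof.
move=> cw; have [d d0 Hd] := (cont_epsP _ _).1 (cw x) 1 ltr01.
exists (d / 2), (`|psiw x| + 1); split; first by rewrite divr_gt0.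
move=> x' xx; have := Hd x' ltac:(lra) => h.
rewrite -[psiw x'](subrK (psiw x)) addrC; apply: le_trans (ler_normD _ _) _.
by rewrite lerD2l ltW.
Qed.

(** A convex function at bounded distance from a continuous one is locally bounded, hence
    continuous in the interior. *)
Lemma joint_cont psiw psi B : continuous psiw -> cvx (@strip R n) (joint psi) ->
  (forall s x, 0 <= s <= 1 -> `|psi s x - psiw x| <= B) ->
  forall z, Om z -> continuous_at z (joint psi).
Proof.
move=> cw cpsi HB z Oz.
have [r [M [r0 HM]]] := loc_bd (tl z) cw.
have [d d0 Hd] := open_epsP (@open_open_strip R n) Oz.
pose r' := Num.min r (d / 2).
have [r1 r2] : r' <= r /\ r' <= d / 2 by rewrite !ge_min !lexx orbT.
have r'0 : 0 < r' by rewrite lt_min r0 divr_gt0.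
apply: (@cvx_cont R _ (@strip R n) (joint psi) z r' (M + B) cpsi r'0) => w wz.
have Ow : Om w by apply: Hd; lra.
have s01 : 0 <= hd w <= 1.
  by move: Ow; rewrite /open_strip/= -/(hd w) => /andP[/ltW -> /ltW ->].
split=> //; rewrite /joint -/(hd w) -/(tl w).
have h1 := HB (hd w) (tl w) s01.
have h2 := HM (tl w); rewrite -tlB in h2.
have {}h2 := h2 (le_trans (tl_le _) (le_trans wz r1)).
rewrite -[psi _ _](subrK (psiw (tl w))) addrC; apply: le_trans (ler_normD _ _) _.
exact: lerD.
Qed.

Section data.
Variables (psiw psi0 psi1 : 'rV[R]_n -> R) (C : R).
Hypothesis cw : continuous psiw.
Hypothesis C0 : 0 <= C.
Hypothesis b0 : forall x, `|psi0 x - psiw x| <= C.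
Hypothesis b1 : forall x, `|psi1 x - psiw x| <= C.
Hypothesis c0 : cvx setT psi0.
Hypothesis c1 : cvx setT psi1.

Lemma psi01 x : psi0 x - 2 * C <= psi1 x <= psi0 x + 2 * C.
Proof.
have := b0 x; have := b1 x; rewrite !ler_norml => /andP[? ?] /andP[? ?].
by apply/andP; split; lra.
Qed.

(** Apply the interior statements on the strip to the function (s, x) |-> phi(x). *)
Lemma cvx_subgrad phi D x : cvx setT phi -> (forall x, `|phi x - psiw x| <= D) ->
  continuous phi /\ exists y, forall x', phi x + dotv y (x' - x) <= phi x'.
Proof.
move=> cphi HD.
have cphi' : cvx (@strip R n) (joint (fun=> phi)).
  move=> z w t _ _ t01; rewrite /joint -!/(tl _) tlD tlZ tlB; exact: cphi.
have HD' s x' : 0 <= s <= 1 -> `|(fun=> phi) s x' - psiw x'| <= D by move=> _; exact: HD.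
have cj := joint_cont cw cphi' HD'.
have O2 x' : Om (pt 2^-1 x').
  by rewrite /open_strip/= -/(hd (pt _ _)) hd_pt; apply/andP; split; lra.
split=> [x'|].
  apply: (ct_eq (g := fun x => joint (fun=> phi) (pt 2^-1 x))) => [v|].
    by rewrite joint_pt.
  apply: (ct_comp (f := fun x => pt 2^-1 x) (g := joint (fun=> phi))); last exact: cj.
  by apply: ct_pt; [exact: ct_cst|exact: ct_id].
have sub : Om `<=` @strip R n.
  by move=> z; rewrite /open_strip/strip/= => /andP[/ltW -> /ltW ->].
have [p Hp] := subgrad_exists (cvxS sub cphi') cj (O2 x).
exists (tl p) => x'; have := Hp _ (O2 x').
by rewrite ptB subrr dotvC dotv_pt0 dotvC !joint_pt.
Qed.

(** A subgradient of psi0 at x, completed by a value of b that is admissible because psi0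
    and psi1 differ by at most 2 C. *)
Lemma touch0 x : exists y a b, adm psi0 psi1 y a b /\ ell y a b 0 x = psi0 x.
Proof.
have [_ [y Hy]] := cvx_subgrad x c0 b0.
exists y, (dotv x y - psi0 x), (dotv x y - psi0 x + 2 * C); split; last by rewrite /ell; ring.
split=> x'; have := Hy x'; rewrite dotvBr (dotvC y x') (dotvC y x); first lra.
by have /andP[h _] := psi01 x'; lra.
Qed.

Lemma touch1 x : exists y a b, adm psi0 psi1 y a b /\ ell y a b 1 x = psi1 x.
Proof.
have [_ [y Hy]] := cvx_subgrad x c1 b1.
exists y, (dotv x y - psi1 x + 2 * C), (dotv x y - psi1 x); split; last by rewrite /ell; ring.
split=> x'; have := Hy x'; rewrite dotvBr (dotvC y x') (dotvC y x); last lra.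
by have /andP[_ h] := psi01 x'; lra.
Qed.

Section env.
Variable psi : R -> 'rV[R]_n -> R.
Hypothesis epsi : envelope psi0 psi1 psi.

Lemma env_bd0 x : psi 0 x = psi0 x.
Proof.
have z01 : 0 <= (0 : R) <= 1 by rewrite lexx ler01.
have [h1 h2] := epsi x z01; apply/eqP; rewrite eq_le; apply/andP; split.
  apply/ler_addgt0Pr => e e0; have [y [a [b [[ad _]]]]] := h2 e e0.
  by rewrite /ell; have := ad x; lra.
by have [y [a [b [ad <-]]]] := touch0 x; exact: h1.
Qed.

Lemma env_bd1 x : psi 1 x = psi1 x.
Proof.
have z01 : 0 <= (1 : R) <= 1 by rewrite lexx ler01.
have [h1 h2] := epsi x z01; apply/eqP; rewrite eq_le; apply/andP; split.
  apply/ler_addgt0Pr => e e0; have [y [a [b [[_ ad]]]]] := h2 e e0.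
  by rewrite /ell; have := ad x; lra.
by have [y [a [b [ad <-]]]] := touch1 x; exact: h1.
Qed.

(** Lowering a or b raises [ell]. As psi0 and psi1 differ by at most 2 C, an admissible
    triple may be improved to one with |a - b| <= 2 C, which makes the envelope
    Lipschitz in s. *)
Lemma adm_close y a b : adm psi0 psi1 y a b ->
  adm psi0 psi1 y (Num.min a (b + 2 * C)) (Num.min b (a + 2 * C)).
Proof.
have CC := C0; move=> [h0 h1]; split=> x; have := h0 x; have := h1 x; have /andP[p q] := psi01 x; rewrite minElt;
  case: ifP => _; lra.
Qed.

Lemma env_lip s s' x : 0 <= s <= 1 -> 0 <= s' <= 1 -> psi s x <= psi s' x + 2 * C * `|s - s'|.
Proof.
move=> s01 s'01; have CC := C0; apply/ler_addgt0Pr => e e0.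
have [_ /(_ e e0)[y [a [b [/adm_close ad h]]]]] := epsi x s01.
have [/(_ _ _ _ ad) h' _] := epsi x s'01.
move: ad h h'; rewrite /ell; set a' := Num.min a _; set b' := Num.min b _; move=> _ h h'.
have [a1 a2 b1' b2] : [/\ a' <= a, a' <= b + 2 * C, b' <= b & b' <= a + 2 * C].
  by split; rewrite ge_min lexx ?orbT.
have a3 : a' = a \/ a' = b + 2 * C by rewrite /a' minElt; case: ifP; [left|right].
have b3 : b' = b \/ b' = a + 2 * C by rewrite /b' minElt; case: ifP; [left|right].
have ab : `|a' - b'| <= 2 * C.
  rewrite ler_norml; apply/andP; split; first by case: a3 => ->; lra.
  by case: b3 => ->; lra.
have : (s - s') * (a' - b') <= 2 * C * `|s - s'|.
  by rewrite mulrC; apply: le_trans (ler_norm _) _; rewrite normrM ler_wpM2r.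
have /andP[s0 s1] := s01.
have k1 : 0 <= (1 - s) * (a - a') by rewrite mulr_ge0// subr_ge0.
have k2 : 0 <= s * (b - b') by rewrite mulr_ge0// subr_ge0.
lra.
Qed.

Lemma strip_pt s x : strip (pt s x) = (0 <= s <= 1) :> Prop.
Proof. by rewrite /strip/= -/(hd (pt s x)) hd_pt. Qed.

Lemma env_cvx : cvx (@strip R n) (joint psi).
Proof.
move=> z w t zS wS t01; have /andP[t0 t1] := t01.
have uS : 0 <= hd (z + t *: (w - z)) <= 1.
  have /stripP/andP[z0 z1] := zS; have /stripP/andP[w0 w1] := wS.
  rewrite hdD hdZ hdB.
  have p1 : 0 <= t * hd w by rewrite mulr_ge0.
  have p2 : 0 <= (1 - t) * hd z by rewrite mulr_ge0// subr_ge0.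
  have p3 : t * hd w <= t by rewrite ler_piMr.
  have p4 : (1 - t) * hd z <= 1 - t by rewrite ler_piMr// subr_ge0.
  by apply/andP; split; lra.
apply/ler_addgt0Pr => e e0; rewrite /joint -!/(hd _) -!/(tl _).
have [_ /(_ e e0)[y [a [b [ad h]]]]] := epsi (tl (z + t *: (w - z))) uS.
have [/(_ _ _ _ ad) hz _] := epsi (tl z) zS.
have [/(_ _ _ _ ad) hw _] := epsi (tl w) wS.
rewrite ell_conv in h; set Z := psi (hd z) _ in hz *; set W := psi (hd w) _ in hw *.
have q1 : t * ell y a b (hd w) (tl w) <= t * W by apply: ler_wpM2l.
have q2 : (1 - t) * ell y a b (hd z) (tl z) <= (1 - t) * Z by apply: ler_wpM2l => //; rewrite subr_ge0.
set V := psi _ _ in h *; lra.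
Qed.

Lemma env_bd s x : 0 <= s <= 1 -> `|psi s x - psiw x| <= 3 * C.
Proof.
move=> s01; have CC := C0; have z01 : 0 <= (0 : R) <= 1 by rewrite lexx ler01.
have h1 := env_lip x s01 z01; have h2 := env_lip x z01 s01.
rewrite sub0r normrN env_bd0 in h2; rewrite subr0 env_bd0 in h1.
have s1 : 2 * C * `|s| <= 2 * C.
  by have /andP[s0 s1] := s01; rewrite ger0_norm// ler_piMr// mulr_ge0.
have := b0 x; rewrite !ler_norml => /andP[? ?]; apply/andP; split; lra.
Qed.

(** For a common x-slope y, the triple made of the two minima is admissible, and its [ell]
    is at least both functions that touch the envelope. At a point with 0 < s < 1 both
    coefficients of (a, b) are nonzero, so that touching forces equality of a and of b. *)
Lemma env_rigid : rigid (joint psi).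
Proof.
move=> z z' p p' Oz Oz' sp sp' pp.
have [a [b [ad E ->]]] := subgrad_adm env_cvx Oz sp.
have [a' [b' [ad' E' ->]]] := subgrad_adm env_cvx Oz' sp'.
have bdr a'' b'' y : adm (psi 0) (psi 1) y a'' b'' -> adm psi0 psi1 y a'' b''.
  by move=> [h0 h1]; split=> x; rewrite -?env_bd0 -?env_bd1.
move/bdr : ad => ad; move/bdr : ad' => ad'; rewrite -pp in ad' E'.
have adm_min : adm psi0 psi1 (tl p) (Num.min a a') (Num.min b b').
  have [h1 h2] := ad; have [h1' h2'] := ad'.
  by split=> x; rewrite minElt; case: ifP => _ //.
have key u v w : Om w -> ell (tl p) u v (hd w) (tl w) = joint psi w ->
    Num.min a a' <= u -> Num.min b b' <= v -> u = Num.min a a' /\ v = Num.min b b'.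
  move=> Ow Ew ha hb; have /andP[w0 w1] : 0 < hd w < 1 by exact: Ow.
  have w01 : 0 <= hd w <= 1 by rewrite !ltW.
  have [/(_ _ _ _ adm_min) h _] := epsi (tl w) w01.
  have {}h : ell (tl p) (Num.min a a') (Num.min b b') (hd w) (tl w) <= ell (tl p) u v (hd w) (tl w).
    by rewrite Ew.
  move: h ha hb; set A := Num.min _ _; set B := Num.min _ _; rewrite /ell => h ha hb.
  have k1 : 0 <= (1 - hd w) * (u - A) by rewrite mulr_ge0// subr_ge0// ltW.
  have k2 : 0 <= hd w * (v - B) by rewrite mulr_ge0 ?subr_ge0// ltW.
  have k3 : (1 - hd w) * (u - A) + hd w * (v - B) <= 0 by lra.
  have e1 : (1 - hd w) * (u - A) = 0 by lra.
  have e2 : hd w * (v - B) = 0 by lra.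
  split.
    by move/eqP: e1; rewrite mulf_eq0 subr_eq0 (gt_eqF w1)/= subr_eq0 => /eqP.
  by move/eqP: e2; rewrite mulf_eq0 (gt_eqF w0)/= subr_eq0 => /eqP.
have [-> ->] : a = Num.min a a' /\ b = Num.min b b'.
  by apply: (key a b z) => //; rewrite ge_min lexx.
have [e1 e2] : a' = Num.min a a' /\ b' = Num.min b b'.
  by apply: (key a' b' z') => //; rewrite ge_min lexx orbT.
by rewrite -e1 -e2.
Qed.

Lemma env_cont_bd (psi' : 'rV[R]_n -> R) (s0 : R) x : continuous psi' -> 0 <= s0 <= 1 ->
  (forall x, psi s0 x = psi' x) ->
  joint psi z @[z --> within (@strip R n) (nbhs (row_mx s0%:M x : 'rV[R]_(1 + n)))] --> psi' x.
Proof.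
move=> c' s01 E; have CC := C0; apply/cvgrPdist_lt => e e0.
have e2 : 0 < e / 2 by rewrite divr_gt0.
have [d d0 Hd] := (cont_epsP _ _).1 (c' x) _ e2.
have D0 : 0 < 2 * C + 1 by rewrite ltr_wpDl// mulr_ge0.
have r0 : 0 < Num.min d (e / 2 / (2 * C + 1)) by rewrite lt_min d0 divr_gt0.
have NB := nbhs_norm_lt (pt s0 x) r0.
rewrite /within /=; apply: filterS NB.
move=> z /=; rewrite lt_min => /andP[z1 z2] zS.
have hz : `|hd z - s0| < e / 2 / (2 * C + 1).
  by have := hd_le (z - pt s0 x); rewrite hdB hd_pt => /le_lt_trans; apply.
have tz : `|tl z - x| < d.
  by have := tl_le (z - pt s0 x); rewrite tlB tl_pt => /le_lt_trans; apply.
have := Hd _ tz; rewrite ltr_norml => /andP[h1 h2].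
have l1 := env_lip (tl z) zS s01; have l2 := env_lip (tl z) s01 zS.
rewrite distrC in l2; rewrite -/(hd z) !E in l1 l2.
have h3 : 2 * C * `|hd z - s0| <= e / 2.
  apply: (@le_trans _ _ (2 * C * (e / 2 / (2 * C + 1)))).
    by apply: ler_wpM2l; [rewrite mulr_ge0|exact: ltW].
  by rewrite mulrCA ger_pMr// ler_pdivrMr//; lra.
rewrite /joint -/(hd z) -/(tl z) ltr_norml; apply/andP; split; lra.
Qed.

Theorem envelope_solution : HRMA_solution psiw psi0 psi1 psi.
Proof.
have [cp0 _] := cvx_subgrad 0 c0 b0; have [cp1 _] := cvx_subgrad 0 c1 b1.
split.
- by apply/convex_functionP; exact: env_cvx.
- apply: rigid_is_MA; last exact: env_rigid.
  exact: joint_cont cw env_cvx env_bd.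
- exact: env_bd0.
- exact: env_bd1.
- by move=> x; apply: env_cont_bd => //; [rewrite lexx ler01|exact: env_bd0].
- by move=> x; apply: env_cont_bd => //; [rewrite lexx ler01|exact: env_bd1].
- by exists (3 * C) => s x; exact: env_bd.
Qed.

End env.
End data.
End core.

(** * Every solution is the envelope *)

Section uniq.
Context {R : realType} {n : nat}.
Local Notation Om := (@open_strip R n).
Implicit Types (x y : 'rV[R]_n) (s a b : R).

(** Lower semicontinuity at an end of the interval, uniformly for x in a ball: the
    boundary values are attained continuously and the ball is compact. *)
Lemma end_lsc (psi : R -> 'rV[R]_n -> R) (phi : 'rV[R]_n -> R) (s0 R1 eta : R) y a b :
  0 < eta -> (forall x, ell y a b s0 x <= phi x) ->
  (forall x, joint psi z @[z --> within (@strip R n) (nbhs (row_mx s0%:M x : 'rV[R]_(1 + n)))]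
     --> phi x) ->
  exists2 d, 0 < d & forall s, `|s - s0| < d -> 0 <= s <= 1 -> forall x, `|x| <= R1 ->
    ell y a b s x - eta <= psi s x.
Proof.
move=> eta0 Hphi Hc.
have /compact_near_coveringP nc := @ball0_compact R n R1.
have e3 : 0 < eta / 3 by rewrite divr_gt0.
have : \forall s \near (s0 : R), [set x | `|x| <= R1] `<=`
    (fun x => 0 <= s <= 1 -> ell y a b s x - eta <= psi s x).
  apply: (nc R (nbhs s0) (fun s x => 0 <= s <= 1 -> ell y a b s x - eta <= psi s x)) => x _.
  have /cvgrPdist_lt /(_ _ e3) := Hc x.
  rewrite /within /= => /nbhs_ballP[d1 /= d10 H1].
  have cell : continuous_at (pt s0 x) (fun z => ell y a b (hd z) (tl z)).
    rewrite /ell; apply: ctB; last by apply: ctM; [exact: ct_hd|exact: ct_cst].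
    apply: ctB.
      by apply: ct_dotv; [exact: ct_tl|exact: ct_cst].
    by apply: ctM; [apply: ctB; [exact: ct_cst|exact: ct_hd]|exact: ct_cst].
  have [d2 d20 H2] := (cont_epsP _ _).1 cell _ e3.
  exists ([set x' | `|x' - x| < Num.min d1 d2], [set s | `|s - s0| < Num.min d1 d2]).
    by split; apply: nbhs_norm_lt; rewrite lt_min d10.
  move=> [x' s] /= [xx ss] s01.
  have zn : `|pt s x' - pt s0 x| < Num.min d1 d2 by rewrite ptB pt_norm_lt.
  move: zn; rewrite lt_min => /andP[zn1 zn2].
  have := H2 _ zn2; rewrite !hd_pt !tl_pt ltr_norml => /andP[h1 h2].
  have Bz : ball (pt s0 x) d1 (pt s x') by rewrite -ball_normE /= distrC.
  have sS : @strip R n (pt s x') by rewrite strip_pt.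
  have := H1 _ Bz sS; rewrite joint_pt ltr_norml => /andP[h3 h4].
  have := Hphi x; lra.
move=> /nbhs_ballP[d /= d0 Hd]; exists d => // s ss s01 x xR.
apply: (Hd s) => //; by rewrite -ball_normE /= distrC.
Qed.

Lemma plateau (s1 s2 R1 : R) : 0 < s1 -> s1 <= s2 -> s2 < 1 -> 0 <= R1 ->
  exists d N chi, [/\ 0 < d, 0 <= N, tests d N chi, forall z, 0 <= chi z &
    forall z : 'rV[R]_(1 + n), s1 <= hd z <= s2 -> `|tl z| <= R1 -> chi z = 1].
Proof.
move=> s10 s12 s21 R10.
pose d := Num.min s1 (1 - s2) / 2.
have m0 : 0 < Num.min s1 (1 - s2) by rewrite lt_min s10/=; lra.
have [m1 m2] : Num.min s1 (1 - s2) <= s1 /\ Num.min s1 (1 - s2) <= 1 - s2.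
  by rewrite !ge_min !lexx orbT.
have d0 : 0 < d by rewrite divr_gt0.
pose pos (t : R) := (t + `|t|) / 2.
have pos0 t : 0 <= pos t by rewrite /pos; have := ler_norm (- t); rewrite normrN; lra.
have posE t : t <= 0 -> pos t = 0 by move=> t0; rewrite /pos ler0_norm// subrr mul0r.
have pos_ge t : t <= pos t by rewrite /pos; have := ler_norm t; lra.
have ctpos (V : normedModType R) (f : V -> R) v : continuous_at v f -> continuous_at v (fun v => pos (f v)).
  by move=> cf; apply: ctM; [apply: ctD => //; exact: ct_norm|exact: ct_cst].
pose R2 := Num.max 1 R1.
pose chi (z : 'rV[R]_(1 + n)) := pos (1 - (pos (s1 - hd z) + pos (hd z - s2) + pos (`|z| - R2)) / d).
exists d, (R2 + d), chi; split => //.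
- by apply: addr_ge0; [rewrite /R2 le_max ler01|exact: ltW].
- split=> [z|z nK].
    have cn : continuous_at z (fun z : 'rV[R]_(1 + n) => `|z|).
      by apply: (@ct_norm R _ _ id); exact: ct_id.
    apply: (ctpos _ (fun z => 1 - (pos (s1 - hd z) + pos (hd z - s2) + pos (`|z| - R2)) / d)).
    apply: ctB; first exact: ct_cst.
    apply: ctM; last exact: ct_cst.
    apply: ctD; last by apply: (ctpos _ (fun z => `|z| - R2)); apply: ctB => //; exact: ct_cst.
    apply: ctD.
      by apply: (ctpos _ (fun z => s1 - hd z)); apply: ctB; [exact: ct_cst|exact: ct_hd].
    by apply: (ctpos _ (fun z => hd z - s2)); apply: ctB; [exact: ct_hd|exact: ct_cst].
  apply: posE; rewrite subr_le0 ler_pdivlMr// mul1r.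
  have g1 := pos_ge (s1 - hd z); have g2 := pos_ge (hd z - s2); have g3 := pos_ge (`|z| - R2).
  have p1 := pos0 (s1 - hd z); have p2 := pos0 (hd z - s2); have p3 := pos0 (`|z| - R2).
  rewrite leNgt; apply/negP => lt; apply: nK; rewrite /Kbox/=; rewrite /d in lt *.
  split; last by lra.
  by apply/andP; split; lra.
- move=> z; exact: pos0.
- move=> z /andP[z1 z2] zR; rewrite /chi (posE (s1 - hd z)) ?subr_le0// (posE (hd z - s2)) ?subr_le0//.
  rewrite (posE (`|z| - R2)); last first.
    rewrite subr_le0 -(pt_hd_tl z) pt_normE ge_max; apply/andP; split; rewrite le_max.
      by apply/orP; left; rewrite ler_norml; apply/andP; split; lra.
    by rewrite zR orbT.
  by rewrite !addr0 mul0r subr0 /pos normr1; lra.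
Qed.

(** At z the function g(s,.) - <.,y> + kap |.|^2 / 2 is minimal on its slice. If z lay outside
    the ball, convexity along the segment from (s, 0) to z would make the value at the
    point of norm R2 on it at most the value at (s, 0), contrary to hypothesis. *)
Lemma minim_in_ball (g : 'rV[R]_(1 + n) -> R) kap R2 z : Ck 2 Om g -> cvx Om g -> 0 <= kap ->
  0 < R2 -> Om z ->
  (forall x', `|x'| = R2 -> g (pt (hd z) 0) < g (pt (hd z) x') - dotv x' (tl (Pk kap g z))) ->
  `|tl z| <= R2.
Proof.
move=> Cg cg k0 R20 Oz H; set y := tl (Pk kap g z) in H; set s := hd z in H; set x := tl z.
have O0 : Om (pt s 0) by rewrite /open_strip/= -/(hd (pt _ _)) hd_pt.
have := Pk_supp k0 Cg cg Oz O0.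
rewrite dotv_pt hdB tlB !hd_pt !tl_pt -/s subrr mulr0 add0r sub0r -/x -/y.
have -> : dotv (0 : 'rV[R]_n) 0 = 0 by rewrite /dotv big1// => i _; rewrite mxE mul0r.
rewrite mulr0 addr0 -scaleN1r dotvZr mulN1r => h1.
rewrite leNgt; apply/negP => xR.
have x0' : 0 < `|x| by apply: lt_trans xR.
pose th := R2 / `|x|.
have th0 : 0 <= th by rewrite /th (divr_ge0 (ltW R20) (ltW x0')).
have th1 : th <= 1 by rewrite /th ler_pdivrMr// mul1r ltW.
have th01 : 0 <= th <= 1 by rewrite th0.
have := cg _ _ th O0 Oz th01; set w := pt s 0 + _.
have wE : w = pt s (th *: x).
  by rewrite /w -{1}(pt_hd_tl z) -/s -/x ptB subrr subr0 ptZ mulr0 ptD addr0 add0r.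
rewrite wE => h2.
have xn : `|th *: x| = R2.
  by rewrite normrZ ger0_norm// /th divfK// gt_eqF.
have := H _ xn.
have h10 : dotv (th *: x) y = th * dotv y x by rewrite dotvZl dotvC.
have h11 : th * (g z - dotv y x) <= th * g (pt s 0).
  by apply: ler_wpM2l => //; clear -n h1; lra.
by rewrite h10 => h3; clear -n h2 h3 h11; lra.
Qed.

(** Compare the dip at (s0, x0) with the tangent planes at z1 and z2. These have the same
    x-slope y, close to y0, so that up to multiples of eta the two inequalities bound the
    s-slopes from below and above by a0 - b0 plus, respectively minus, 2 eta. The constant
    7 leaves room for the errors: 1 from the quadratic term, 2 from the low slices and 2
    from replacing y by y0. *)
Lemma slope_gap (g : 'rV[R]_(1 + n) -> R) kap z1 z2 s0 x0 y0 a0 b0 eta :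
  Ck 2 Om g -> cvx Om g -> 0 <= kap -> Om z1 -> Om z2 -> Om (pt s0 x0) -> 0 < eta ->
  hd z1 < s0 -> s0 < hd z2 -> tl (Pk kap g z1) = tl (Pk kap g z2) ->
  kap * dotv x0 x0 <= eta ->
  (forall x, x = x0 \/ x = tl z1 \/ x = tl z2 ->
    `|dotv x (tl (Pk kap g z1)) - dotv x y0| <= eta) ->
  g (pt s0 x0) <= ell y0 a0 b0 s0 x0 - 7 * eta ->
  ell y0 a0 b0 (hd z1) (tl z1) - 2 * eta <= g z1 ->
  ell y0 a0 b0 (hd z2) (tl z2) - 2 * eta <= g z2 ->
  2 * eta <= hd (Pk kap g z2) - hd (Pk kap g z1).
Proof.
move=> Cg cg k0 O1 O2 O0 eta0 z10 z20 te kD dy p0 q1 q2.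
have := Pk_supp k0 Cg cg O1 O0.
rewrite dotv_pt hdB tlB !hd_pt !tl_pt dotvBr => p1.
have := Pk_supp k0 Cg cg O2 O0.
rewrite dotv_pt hdB tlB !hd_pt !tl_pt -te dotvBr => p2.
move: dy p1 p2; set y := tl (Pk kap g z1); rewrite !(dotvC y) => dy p1 p2.
have /andP[u1 u1'] : - eta <= dotv (tl z1) y - dotv (tl z1) y0 <= eta.
  by rewrite -ler_norml; apply: dy; right; left.
have /andP[u2 u2'] : - eta <= dotv (tl z2) y - dotv (tl z2) y0 <= eta.
  by rewrite -ler_norml; apply: dy; right; right.
have /andP[u0 u0'] : - eta <= dotv x0 y - dotv x0 y0 <= eta.
  by rewrite -ler_norml; apply: dy; left.
move: p0 q1 q2 p1 p2; rewrite /ell; set t1 := hd (Pk _ _ _); set t2 := hd (Pk _ _ _).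
set s1 := hd z1 in z10 *; set s2 := hd z2 in z20 * => p0 q1 q2 p1 p2.
have v2 : (a0 - b0) * (s2 - s0) + 2 * eta <= t2 * (s2 - s0).
  clear -n p0 q2 p2 u0 u0' u2 u2' kD; lra.
have v1 : t1 * (s0 - s1) <= (a0 - b0) * (s0 - s1) - 2 * eta.
  clear -n p0 q1 p1 u0 u0' u1 u1' kD; lra.
have s11 : 0 < s1 by move: O1; rewrite /open_strip/= -/(hd z1) => /andP[].
have s21 : s2 < 1 by move: O2; rewrite /open_strip/= -/(hd z2) => /andP[].
have i1 : 0 < s0 - s1 by rewrite subr_gt0.
have i2 : 0 < s2 - s0 by rewrite subr_gt0.
have e2 : 0 <= 2 * eta by rewrite mulr_ge0// ltW.
have i1' : 2 * eta * (s0 - s1) <= 2 * eta.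
  by apply: ler_piMr => //; clear -n s21 s11 z20 z10; lra.
have i2' : 2 * eta * (s2 - s0) <= 2 * eta.
  by apply: ler_piMr => //; clear -n s21 s11 z20 z10; lra.
have w2 : a0 - b0 + 2 * eta <= t2.
  by rewrite -(ler_pM2r i2); apply: le_trans v2; clear -n i2'; lra.
have w1 : t1 <= a0 - b0 - 2 * eta.
  by rewrite -(ler_pM2r i1); apply: le_trans v1 _; clear -n i1'; lra.
by clear -n w1 w2 eta0; lra.
Qed.

(** In a ball the boundary values are attained uniformly ([end_lsc]); outside a large ball
    coercivity makes psi larger than [ell]. *)
Lemma low_slices (psiw psi0 psi1 : 'rV[R]_n -> R) (psi : R -> 'rV[R]_n -> R) y0 a0 b0 (c K : R) s0 eta : HRMA_solution psiw psi0 psi1 psi ->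
  0 < c -> (forall s x, 0 <= s <= 1 -> dotv x y0 + c * `|x| - K <= psi s x) ->
  adm psi0 psi1 y0 a0 b0 -> 0 < s0 < 1 -> 0 < eta ->
  exists s1 s2, [/\ 0 < s1 < s0, s0 < s2 < 1,
    forall x, ell y0 a0 b0 s1 x - eta <= psi s1 x &
    forall x, ell y0 a0 b0 s2 x - eta <= psi s2 x].
Proof.
move=> sol c0 Hco ad /andP[s00 s01] eta0.
pose L s := - (1 - s) * a0 - s * b0.
have ellL s x : ell y0 a0 b0 s x = dotv x y0 + L s by rewrite /ell /L; ring.
pose Lm := Num.max (- a0) (- b0).
have LLm s : 0 <= s <= 1 -> L s <= Lm.
  move=> /andP[u0 u1]; have [l1 l2] : - a0 <= Lm /\ - b0 <= Lm by rewrite !le_max !lexx orbT.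
  have q1 : (1 - s) * - a0 <= (1 - s) * Lm by apply: ler_wpM2l => //; rewrite subr_ge0.
  have q2 : s * - b0 <= s * Lm by apply: ler_wpM2l.
  by rewrite /L; clear -n q1 q2; lra.
pose R1 := (`|Lm + K|) / c.
have far s x : 0 <= s <= 1 -> R1 <= `|x| -> ell y0 a0 b0 s x - eta <= psi s x.
  move=> s01' xR; have := Hco s x s01'; have := LLm s s01'; rewrite ellL.
  have : c * R1 <= c * `|x| by apply: ler_wpM2l => //; exact: ltW.
  rewrite /R1 mulrCA divff ?gt_eqF// mulr1; have := ler_norm (Lm + K).
  by clear -n eta0; lra.
have E0 x : ell y0 a0 b0 0 x <= psi0 x by have := ad.1 x; rewrite /ell; lra.
have E1 x : ell y0 a0 b0 1 x <= psi1 x by have := ad.2 x; rewrite /ell; lra.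
have [d1 d10 H1] := end_lsc R1 eta0 E0 (HRMA_cont0 sol).
have [d2 d20 H2] := end_lsc R1 eta0 E1 (HRMA_cont1 sol).
clear ellL LLm E0 E1 Hco ad sol.
pose m1 := Num.min d1 s0; pose m2 := Num.min d2 (1 - s0).
have m10 : 0 < m1 by rewrite lt_min d10.
have m20 : 0 < m2 by rewrite lt_min d20/= subr_gt0.
have m1d : m1 <= d1 by rewrite ge_min lexx.
have m1s : m1 <= s0 by rewrite ge_min lexx orbT.
have m2d : m2 <= d2 by rewrite ge_min lexx.
have m2s : m2 <= 1 - s0 by rewrite ge_min lexx orbT.
exists (m1 / 2), (1 - m2 / 2); split.
- by apply/andP; split; clear -n m10 m1s; lra.
- by apply/andP; split; clear -n m20 m2s s01; lra.
- have s101 : 0 <= m1 / 2 <= 1 by apply/andP; split; clear -n m10 m1s s01; lra.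
  move=> x; have [xR|xR] := leP `|x| R1; last exact: far s101 (ltW xR).
  by apply: H1 => //; rewrite subr0 gtr0_norm ?divr_gt0//; clear -n m10 m1d; lra.
- have s201 : 0 <= 1 - m2 / 2 <= 1 by apply/andP; split; clear -n m20 m2s s00; lra.
  move=> x; have [xR|xR] := leP `|x| R1; last exact: far s201 (ltW xR).
  apply: H2 => //; rewrite addrC addKr normrN gtr0_norm ?divr_gt0//; clear -n m20 m2d; lra.
Qed.

(** The comparison principle: a strict dip of a solution below an admissible [ell] with
    coercive slope y0 would carry Monge-Ampere mass. Near y0 the minimizers of
    g(s,.) - <.,y> stay in a fixed ball, where the mollified functions g are uniformly close
    to psi; [slope_gap] gives the increment of tau_y, and [MA_lower] the mass. *)
Lemma no_dip (psiw psi0 psi1 : 'rV[R]_n -> R) (psi : R -> 'rV[R]_n -> R) y0 a0 b0 (c K B : R) s0 x0 :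
  continuous psiw -> HRMA_solution psiw psi0 psi1 psi ->
  (forall s x, 0 <= s <= 1 -> `|psi s x - psiw x| <= B) ->
  0 < c -> (forall s x, 0 <= s <= 1 -> dotv x y0 + c * `|x| - K <= psi s x) ->
  adm psi0 psi1 y0 a0 b0 -> 0 < s0 < 1 -> ell y0 a0 b0 s0 x0 <= psi s0 x0.
Proof.
move=> cw sol HB c0 Hco ad s001; rewrite leNgt; apply/negP => dip.
have cpsi : cvx (@strip R n) (joint psi) by apply/convex_functionP; exact: HRMA_convex sol.
have ctpsi := joint_cont cw cpsi HB.
have sub : Om `<=` @strip R n.
  by move=> z; rewrite /open_strip/strip/= => /andP[/ltW -> /ltW ->].
(* 7 eta for the errors in slope_gap, 1 eta for the mollification *)
pose eta := (ell y0 a0 b0 s0 x0 - psi s0 x0) / 8.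
have eta0 : 0 < eta by rewrite divr_gt0// subr_gt0.
have dipE : psi s0 x0 = ell y0 a0 b0 s0 x0 - 8 * eta by rewrite /eta; field.
clearbody eta.
have [s1 [s2 [/andP[s1p s1s0] /andP[s0s2 s2p] low1 low2]]] := low_slices sol c0 Hco ad s001 eta0.
have s12 : s1 <= s2 by exact: ltW (lt_trans s1s0 s0s2).
have btw s : s1 <= s <= s2 -> 0 < s < 1.
  by move=> /andP[u v]; rewrite (lt_le_trans s1p u) (le_lt_trans v s2p).
(* radius of the ball containing all minimizers *)
pose R2 := 2 * (`|K| + `|psiw 0| + `|B| + 3) / c.
have R20 : 0 < R2 by rewrite divr_gt0// mulr_gt0// ltr_wpDl// !addr_ge0.
have R2E : c / 2 * R2 = `|K| + `|psiw 0| + `|B| + 3 by rewrite /R2; field; rewrite gt_eqF.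
clearbody R2.
pose D0 := dotv x0 x0.
have D00 : 0 <= D0 by apply: le_trans (dotv_ge _); rewrite exprn_ge0.
pose X0 := R2 + `|x0|.
have X00 : 0 <= X0 by rewrite addr_ge0// ltW.
have R2X : R2 <= X0 by rewrite lerDl.
have x0X : `|x0| <= X0 by rewrite lerDr ltW.
have [r [r0 rc re]] : exists r, [/\ 0 < r, n%:R * r <= c / 2 & n%:R * r * X0 <= eta].
  have nR : 0 <= n%:R :> R by exact: ler0n.
  have w0 : 0 < n%:R * X0 + 1 by rewrite ltr_wpDl// mulr_ge0.
  exists (Num.min (c / 2 / (n%:R + 1)) (eta / (n%:R * X0 + 1))); set r := Num.min _ _.
  have r0 : 0 < r by rewrite lt_min !divr_gt0// ltr_wpDl.
  split => //.
    have : r <= c / 2 / (n%:R + 1) by rewrite ge_min lexx.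
    by rewrite ler_pdivlMr ?ltr_wpDl//; clear -n r0; lra.
  have : r <= eta / (n%:R * X0 + 1) by rewrite ge_min lexx orbT.
  by rewrite ler_pdivlMr//; clear -n r0; lra.
have dy x y X1 : `|y - y0| <= r -> `|x| <= X1 -> `|dotv x y - dotv x y0| <= n%:R * r * X1.
  move=> yr xX; rewrite -dotvBr; apply: le_trans (dotv_abs _ _) _.
  rewrite -mulrA [r * _]mulrC; apply: ler_wpM2l => //.
  by apply: ler_pM.
have [g [Cg cg gu]] := mollify (cvxS sub cpsi) ctpsi.
have [dt [N [chi [dt0 N0 tc chi0 chi1]]]] := plateau s1p s12 s2p (ltW R20).
(* the mollified functions are uniformly close to psi on a large box *)
pose dK := Num.min s1 (1 - s2); pose NK := Num.max 1 X0.
have dK0 : 0 < dK by rewrite lt_min s1p/= subr_gt0.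
have inK s x : s1 <= s <= s2 -> `|x| <= X0 -> Kbox dK NK (pt s x).
  move=> ss xR; have /andP[u0 u1] := btw s ss; have /andP[a1 a2] := ss.
  rewrite /Kbox/= hd_pt; split.
    have [dK1 dK2] : dK <= s1 /\ dK <= 1 - s2 by rewrite !ge_min !lexx orbT.
    by apply/andP; split; clear -n dK1 dK2 a1 a2; lra.
  rewrite pt_normE ge_max; apply/andP; split; rewrite le_max.
    by apply/orP; left; rewrite gtr0_norm// ltW.
  by rewrite xR orbT.
have [J HJ] := gu dK NK eta dK0 eta0.
have [J' HJ'] := gu dK NK 1 dK0 ltr01.
have kk0 : 0 < eta / (D0 + 1) by rewrite divr_gt0// ltr_wpDl.
have Os s x : s1 <= s <= s2 -> Om (pt s x).
  by move=> /btw; rewrite /open_strip/= -/(hd (pt s x)) hd_pt.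
have minim j k z : (J' <= j)%N -> 0 < k -> s1 <= hd z <= s2 ->
    `|tl (Pk k (g j) z) - y0| <= r -> `|tl z| <= R2.
  move=> jJ k0 zs yr.
  have Oz : Om z by rewrite -(pt_hd_tl z); exact: Os.
  apply: (minim_in_ball (Cg j) (cg j) (ltW k0) R20 Oz) => x xn.
  have xX : `|x| <= X0 by rewrite xn.
  have oX : `|(0 : 'rV[R]_n)| <= X0 by rewrite normr0.
  have := HJ' _ jJ _ (inK _ _ zs xX); rewrite joint_pt ltr_norml => /andP[h1 _].
  have := HJ' _ jJ _ (inK _ _ zs oX); rewrite joint_pt ltr_norml => /andP[_ h2].
  have ss : 0 <= hd z <= 1 by have /andP[u v] := btw _ zs; rewrite !ltW.
  have h5 := Hco (hd z) x ss; rewrite xn in h5.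
  have xle : `|x| <= R2 by rewrite xn.
  have := dy _ _ _ yr xle; rewrite ler_norml => /andP[_ h6].
  have h7 : n%:R * r * R2 <= c / 2 * R2 by apply: ler_wpM2r => //; exact: ltW.
  have := HB (hd z) 0 ss; rewrite ler_norml => /andP[_ h9].
  have k1 := ler_norm K; have k2 := ler_norm (psiw 0); have k3 := ler_norm B.
  by clear -n h1 h2 h5 h6 h7 h9 k1 k2 k3 R2E; lra.
have M k : (maxn J J' <= k)%N -> 2 * eta * bump_mass y0 r <= MA_C2 (g k) chi.
  rewrite geq_max => /andP[jJ jJ'].
  have eta2 : 0 <= 2 * eta by rewrite mulr_ge0// ltW.
  apply: (@MA_lower R n (g k) dt N chi y0 r (2 * eta) s1 s2 (eta / (D0 + 1)) dt0 N0 tc chi0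
    (Cg k) (cg k) r0 eta2 s1p s12 s2p kk0).
    by move=> kap /andP[k0 kk] z zs yr; apply: chi1 => //; exact: minim yr.
  move=> kap /andP[k0 kk] z1 z2 e1 e2 te yr.
  have s1s : s1 <= s1 <= s2 by rewrite lexx.
  have s2s : s1 <= s2 <= s2 by rewrite lexx andbT.
  have s0s : s1 <= s0 <= s2 by rewrite !ltW.
  have x1 : `|tl z1| <= X0 by apply: le_trans R2X; apply: (minim k kap) => //; rewrite e1.
  have x2 : `|tl z2| <= X0.
    by apply: le_trans R2X; apply: (minim k kap) => //; rewrite ?e2// -te.
  have z1E : z1 = pt s1 (tl z1) by rewrite -[LHS]pt_hd_tl e1.
  have z2E : z2 = pt s2 (tl z2) by rewrite -[LHS]pt_hd_tl e2.
  have O1 : Om z1 by rewrite z1E; exact: Os.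
  have O2 : Om z2 by rewrite z2E; exact: Os.
  have O0 : Om (pt s0 x0) by exact: Os.
  have kD : kap * dotv x0 x0 <= eta.
    move: kk; rewrite ltr_pdivlMr ?ltr_wpDl// => kk.
    by apply: le_trans (ltW kk); apply: ler_wpM2l; [exact: ltW|rewrite lerDl].
  have q1 := HJ _ jJ _ (inK _ _ s1s x1); have q2 := HJ _ jJ _ (inK _ _ s2s x2).
  have q0 := HJ _ jJ _ (inK _ _ s0s x0X).
  rewrite joint_pt -z1E in q1; rewrite joint_pt -z2E in q2; rewrite joint_pt in q0.
  move: q0 q1 q2; rewrite !ltr_norml => /andP[_ q0] /andP[q1 _] /andP[q2 _].
  apply: (slope_gap (s0 := s0) (x0 := x0) (y0 := y0) (a0 := a0) (b0 := b0) (Cg k) (cg k) (ltW k0)) => //.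
  - by rewrite e1.
  - by rewrite e2.
  - move=> x xx; apply: le_trans re; apply: dy => //.
    by case: xx => [->|[->|->]].
  - by clear -n q0 dipE; lra.
  - by have := low1 (tl z1); rewrite e1; clear -n q1; lra.
  - by have := low2 (tl z2); rewrite e2; clear -n q2; lra.
have gC k : Ck 2 Om (g k) /\ convex_function Om (g k).
  by split=> //; apply/convex_functionP.
have gU K' : compact K' -> K' `<=` Om -> {uniform K', g @ \oo --> joint psi}.
  move=> cK KO; apply/unif_cvgP => e e0.
  have [d' [N' [d'0 N'0 KB]]] := compact_Kbox cK KO.
  by have [J0 HJ0] := gu d' N' e d'0 e0; exists J0 => j Jj z /KB; exact: HJ0.
have := HRMA_MA sol gC gU (tests_test dt0 tc).
have mass : 0 < 2 * eta * bump_mass y0 r by rewrite mulr_gt0 ?mulr_gt0// bump_mass_gt0.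
move/cvgrPdist_lt => /(_ _ mass)[J0 _ HJ0].
have /= := HJ0 (maxn J0 (maxn J J')) (leq_maxl _ _).
have := M (maxn J0 (maxn J J')) (leq_maxr _ _).
rewrite sub0r normrN => h1 h2; have := ler_norm (MA_C2 (g (maxn J0 (maxn J J'))) chi).
by move=> h3; have := le_lt_trans (le_trans h1 h3) h2; rewrite ltxx.
Qed.

Section main.
Variables (psiw psi0 psi1 : 'rV[R]_n -> R) (C : R) (gg : 'rV[R]_n) (cc C1 : R).
Variable (psi : R -> 'rV[R]_n -> R).

Hypothesis cw : continuous psiw.
Hypothesis b0 : forall x, `|psi0 x - psiw x| <= C.
Hypothesis b1 : forall x, `|psi1 x - psiw x| <= C.
Hypothesis c0 : cvx setT psi0.
Hypothesis c1 : cvx setT psi1.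
Hypothesis cc0 : 0 < cc.
Hypothesis coer : forall x, dotv x gg + cc * `|x| - C1 <= psiw x.

(** Subgradients give admissible triples that touch psi, so that psi is at most the
    envelope. For the converse, an arbitrary admissible triple (y, a, b) is mixed with a
    small multiple t of the coercive minorant of psiw; at the slope obtained psi is
    coercive, [no_dip] applies, and t is chosen so small that a dip would persist. *)
Theorem solution_envelope : HRMA_solution psiw psi0 psi1 psi -> envelope psi0 psi1 psi.
Proof.
move=> sol s x s01.
have [B HB] := HRMA_bounded sol.
have cpsi : cvx (@strip R n) (joint psi) by apply/convex_functionP; exact: HRMA_convex sol.
have ctpsi := joint_cont cw cpsi HB.
have sub : Om `<=` @strip R n.
  by move=> z; rewrite /open_strip/strip/= => /andP[/ltW -> /ltW ->].
have bd0 := HRMA_bound0 sol; have bd1 := HRMA_bound1 sol.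
have [s_0|s_0] := eqVneq s 0.
  rewrite s_0 bd0; split=> [y a b [h _]|e e0]; first by have := h x; rewrite /ell; lra.
  have [y [a [b [ad E]]]] := touch0 cw b0 b1 c0 x.
  by exists y, a, b; split=> //; rewrite E; lra.
have [s_1|s_1] := eqVneq s 1.
  rewrite s_1 bd1; split=> [y a b [_ h]|e e0]; first by have := h x; rewrite /ell; lra.
  have [y [a [b [ad E]]]] := touch1 cw b0 b1 c1 x.
  by exists y, a, b; split=> //; rewrite E; lra.
have s01' : 0 < s < 1.
  by have /andP[? ?] := s01; rewrite !lt_neqAle eq_sym s_0 s_1/=; apply/andP; split.
have Oz : Om (pt s x) by rewrite /open_strip/= -/(hd _) hd_pt.
split=> [y a b ad|e e0]; last first.
  have [p Hp] := subgrad_exists (cvxS sub cpsi) ctpsi Oz.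
  have [a [b [[h0 h1] E _]]] := subgrad_adm cpsi Oz Hp.
  exists (tl p), a, b; split; first by split=> x'; rewrite -?bd0 -?bd1.
  by rewrite hd_pt tl_pt joint_pt in E; rewrite E; lra.
rewrite leNgt; apply/negP => dip.
pose ag := C1 + C.
have adg : adm psi0 psi1 gg ag ag.
  have cp : 0 <= cc by exact: ltW.
  split=> x'; have := coer x'; have : 0 <= cc * `|x'| by rewrite mulr_ge0.
    by have := b0 x'; rewrite ler_norml => /andP[? ?]; rewrite /ag; lra.
  by have := b1 x'; rewrite ler_norml => /andP[? ?]; rewrite /ag; lra.
pose el := ell y a b s x; pose eg := ell gg ag ag s x.
pose q := `|el - eg| + 1; have q0 : 0 < q by rewrite ltr_wpDl.
(* mixing with weight t changes the value of ell by at most half of the dip *)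
pose t := Num.min 1 ((el - psi s x) / 2 / q).
have ep : 0 < el - psi s x by rewrite subr_gt0.
have t0 : 0 < t by rewrite lt_min ltr01 !divr_gt0.
have t1 : t <= 1 by rewrite ge_min lexx.
have tq : t * q <= (el - psi s x) / 2.
  have : t <= (el - psi s x) / 2 / q by rewrite ge_min lexx orbT.
  by rewrite ler_pdivlMr.
pose yt := (1 - t) *: y + t *: gg; pose at_ := (1 - t) * a + t * ag; pose bt := (1 - t) * b + t * ag.
have adt : adm psi0 psi1 yt at_ bt.
  have u0 : 0 <= 1 - t by lra.
  have u1 : 0 <= t by exact: ltW.
  split=> x'; rewrite /yt dotvDr !dotvZr.
    have k1 : (1 - t) * (dotv x' y - a) <= (1 - t) * psi0 x' by apply: ler_wpM2l => //; exact: ad.1.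
    have k2 : t * (dotv x' gg - ag) <= t * psi0 x' by apply: ler_wpM2l => //; exact: adg.1.
    by rewrite /at_; lra.
  have k1 : (1 - t) * (dotv x' y - b) <= (1 - t) * psi1 x' by apply: ler_wpM2l => //; exact: ad.2.
  have k2 : t * (dotv x' gg - ag) <= t * psi1 x' by apply: ler_wpM2l => //; exact: adg.2.
  by rewrite /bt; lra.
have elt : ell yt at_ bt s x = (1 - t) * el + t * eg.
  by rewrite /el /eg /ell /yt /at_ /bt dotvDr !dotvZr; ring.
pose K := (1 - t) * (a + C) + t * C1 + B.
have tc0 : 0 < t * cc by rewrite mulr_gt0.
have co s' x' : 0 <= s' <= 1 -> dotv x' yt + t * cc * `|x'| - K <= psi s' x'.
  move=> s'01; have := HB s' x' s'01; rewrite ler_norml => /andP[h1 h2].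
  have k1 : (1 - t) * (dotv x' y - a - C) <= (1 - t) * psiw x'.
    apply: ler_wpM2l; first lra.
    by have := b0 x'; have := ad.1 x'; rewrite ler_norml => ? /andP[? ?]; lra.
  have k2 : t * (dotv x' gg + cc * `|x'| - C1) <= t * psiw x'.
    by apply: ler_wpM2l; [exact: ltW|exact: coer].
  rewrite /yt dotvDr !dotvZr /K; lra.
have := no_dip x cw sol HB tc0 co adt s01'; rewrite elt.
have : t * (el - eg) <= t * q.
  by apply: ler_wpM2l; [exact: ltW|rewrite /q; have := ler_norm (el - eg); lra].
lra.
Qed.

End main.
End uniq.

(** * Semicontinuity, and discs in logarithmic coordinates *)

Section visc.
Context {R : realType}.

Definition usc (V : normedModType R) (f : V -> R) := forall x a, f x < a ->
  exists2 d, 0 < d & forall y, `|y - x| < d -> f y < a.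

Lemma usc_max (V : normedModType R) (K : set V) (f : V -> R) p0 : compact K -> K p0 ->
  usc f -> exists2 p, K p & forall q, K q -> f q <= f p.
Proof.
move=> cK Kp0 uf; apply: contrapT => NM.
have Hlt p : K p -> exists2 q, K q & f p < f q.
  move=> Kp; apply: contrapT => Np; apply: NM; exists p => // q Kq.
  by rewrite leNgt; apply/negP => h; apply: Np; exists q.
have /compact_near_coveringP nc := cK.
have bd : exists M, forall p, K p -> f p < M.
  have : \forall j \near \oo, K `<=` (fun p => f p < j%:R).
    apply: (nc nat \oo (fun j p => f p < j%:R)) => p Kp.
    have [d d0 Hd] := uf p (f p + 1) ltac:(lra).
    exists ([set p' | `|p' - p| < d], [set j : nat | f p + 1 <= j%:R]).
      split; first exact: nbhs_norm_lt.
      exact: nbhs_infty_ger.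
    by move=> [p' j] /= [/Hd h1 h2]; exact: lt_le_trans h2.
  by move=> [j _ Hj]; exists j%:R => p; exact: (Hj j (leqnn j)).
have [M HM] := bd.
pose S := f @` K; have hS : has_sup S.
  by split; [exists (f p0), p0|exists M => _ [p Kp <-]; exact/ltW/HM].
pose s := sup S.
have fs p : K p -> f p < s.
  by move=> Kp; have [q Kq] := Hlt _ Kp; move/lt_le_trans; apply; apply: ub_le_sup; [exact: hS.2|exists q].
have : \forall l \near s, K `<=` (fun p => l < s -> f p < l).
  apply: (nc R (nbhs s) (fun l p => l < s -> f p < l)) => p Kp.
  have fps := fs _ Kp; have fm : f p < (f p + s) / 2 by lra.
  have [d d0 Hd] := uf _ _ fm.
  exists ([set p' | `|p' - p| < d], [set l : R | `|l - s| < (s - f p) / 2]).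
    by split; apply: nbhs_norm_lt => //; lra.
  move=> [p' l] /= [/Hd h1 h2] ls; apply: lt_trans h1 _.
  by move: h2; rewrite ltr_norml => /andP[h2 _]; lra.
move=> /nbhs_ballP[d /= d0 Hd].
have Bl : ball s d (s - d / 2).
  by rewrite -ball_normE /= opprB addrC subrK gtr0_norm ?divr_gt0//; lra.
have := Hd _ Bl => H.
have : s <= s - d / 2.
  by apply: ge_sup => [|_ [p Kp <-]]; [exists (f p0), p0|apply/ltW/H => //; lra].
lra.
Qed.

Lemma ln1p_taylor (s : R) : `|s| <= 2^-1 -> `|ln (1 + s) - s + s ^+ 2 / 2| <= 2 * `|s| ^+ 3.
Proof.
move=> s2; pose g t : R := ln (1 + t) - t + t ^+ 2 / 2.
have dg t : `|t| <= `|s| -> is_derive t (1:R) g (t ^+ 2 / (1 + t)).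
  move=> ts; have t1 : 0 < 1 + t.
    by have := le_trans ts s2; rewrite ler_norml => /andP[? ?]; lra.
  have l1 : is_derive t (1:R) (fun t => 1 + t) 1.
    by rewrite -[X in is_derive _ _ _ X]add0r; apply: is_deriveD.
  have l2 : is_derive t (1:R) (fun t => ln (1 + t)) ((1 + t)^-1 * 1).
    by apply: (@is_derive1_comp _ (@ln R) (fun t => 1 + t)) => //; exact: is_derive1_ln.
  apply/is_derive_epsP => e e0.
  have /is_derive_epsP /(_ (e / 2))[|d d0 Hd] := l2; first by rewrite divr_gt0.
  exists (Num.min d e); first by rewrite lt_min d0.
  move=> h; rewrite lt_min => /andP[hd he].
  have := Hd h hd; rewrite mulr1 /g.
  rewrite (_ : ln (1 + (t + h)) - (t + h) + (t + h) ^+ 2 / 2 - (ln (1 + t) - t + t ^+ 2 / 2) - h * (t ^+ 2 / (1 + t)) =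
     (ln (1 + (t + h)) - ln (1 + t) - h * (1 + t)^-1) + h * h / 2); last first.
    by field; rewrite gt_eqF.
  move=> H; apply: le_trans (ler_normD _ _) _.
  have : `|h * h / 2| <= e / 2 * `|h|.
    rewrite normrM normrM (@ger0_norm _ (2^-1))//.
    have : `|h| * `|h| <= e * `|h| by apply: ler_wpM2r => //; exact: ltW.
    lra.
  lra.
have [t ts E] := mvt_sym dg.
have g0 : g 0 = 0 by rewrite /g addr0 ln1; ring.
rewrite g0 subr0 in E; rewrite -/(g s) E normrM.
have t1 : 2^-1 <= 1 + t by have := le_trans ts s2; rewrite ler_norml => /andP[? ?]; lra.
have : `|t ^+ 2 / (1 + t)| <= 2 * `|s| ^+ 2.
  rewrite normrM normrX normfV (@ger0_norm _ (1 + t)); last lra.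
  rewrite mulrC; apply: ler_pM => //.
  - by rewrite invr_ge0; lra.
  - by rewrite -[leRHS]invrK lef_pV2 ?posrE//; lra.
  - by rewrite ler_sqr ?nnegrE.
move=> h; have := ler_wpM2r (normr_ge0 s) h; rewrite exprSr; lra.
Qed.

(** The displacement of log |z| on a disc: for z = e^p (1 + r w e^(i th)) with real p and w,
    log |z| = p + log_disc r w th. *)
Definition log_disc (r w th : R) : R := ln (1 + (2 * r * w * cos th + r ^+ 2 * w ^+ 2)) / 2.

(** With a = r w and c = cos th, put s = 2 a c + a^2. Then s / 2 - s^2 / 4 equals
    a c - a^2 cos(2 th) / 2 up to terms of order a^3, and ln (1 + s) = s - s^2 / 2 + O(s^3). *)
Lemma log_disc_taylor (r w th W : R) : 0 <= r -> `|w| <= W -> 1 <= W -> r * W <= 6^-1 ->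
  `|log_disc r w th - (r * w * cos th - r ^+ 2 * w ^+ 2 * cos (2 * th) / 2)| <= 30 * (r * W) ^+ 3.
Proof.
move=> r0 wW W1 rW.
pose a := r * w; have aW : `|a| <= r * W by rewrite normrM ger0_norm// ler_wpM2l.
set A := r * W in rW aW *; have A0 : 0 <= A by apply: le_trans aW.
set c := cos th; have c1 : `|c| <= 1 by rewrite ler_norml cos_geN1 cos_le1.
pose s := 2 * a * c + a ^+ 2.
have ac : `|a * c| <= A.
  by rewrite normrM; apply: le_trans aW; apply: ler_piMr.
have a2 : `|a ^+ 2| <= A ^+ 2 by rewrite normrX ler_sqr ?nnegrE.
have A2 : A ^+ 2 <= A by rewrite expr2 ler_piMr//; lra.
have s3 : `|s| <= 3 * A.
  apply: le_trans (ler_normD _ _) _; rewrite -mulrA normrM ger0_norm//; lra.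
have := @ln1p_taylor s ltac:(lra).
have -> : log_disc r w th = ln (1 + s) / 2 by rewrite /log_disc /s /a -/c; congr (ln (1 + _) / 2); ring.
move=> H; rewrite [2 * th]mulr_natl cos_mulr2n -/c.
have -> : ln (1 + s) / 2 - (r * w * c - r ^+ 2 * w ^+ 2 * (c ^+ 2 *+ 2 - 1) / 2) =
   (ln (1 + s) - s + s ^+ 2 / 2) / 2 + (- (a ^+ 2 * (a * c)) - (a ^+ 2) * (a ^+ 2) / 4).
  by rewrite /s /a; field.
have A3 : A ^+ 3 = A ^+ 2 * A by rewrite exprSr.
have h1 : `|a ^+ 2 * (a * c)| <= A ^+ 3 by rewrite A3 normrM; apply: ler_pM.
have h2 : `|a ^+ 2 * a ^+ 2| <= A ^+ 3.
  by rewrite A3 normrM; apply: ler_pM => //; apply: le_trans A2.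
have h3 : `|s| ^+ 3 <= (3 * A) ^+ 3 by rewrite lerXn2r ?nnegrE//; lra.
rewrite exprMn in h3.
have h4 : 0 <= A ^+ 3 by rewrite exprn_ge0.
move: H h1 h2; rewrite !ler_norml; move=> /andP[k1 k2] /andP[k3 k4] /andP[k5 k6].
set u := ln _ - s + _ in k1 k2 *; set a3 := a ^+ 2 * (a * c) in k3 k4 *.
set a4 := a ^+ 2 * a ^+ 2 in k5 k6 *; set S := `|s| ^+ 3 in h3 k1 k2 *; set A_3 := A ^+ 3 in h3 h4 k3 k4 k5 k6 *.
have h5 : S <= 27 * A_3 by move: h3; rewrite (_ : 3 ^+ 3 = 27 :> R)//; ring.
apply/andP; split; clear -k1 k2 k3 k4 k5 k6 h4 h5; lra.
Qed.

End visc.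

(** * Second order expansions along a disc *)

Section jet2.
Context {R : realType}.
Variable r0 : R.
Hypothesis r01 : r0 <= 1.

(** Second order Taylor expansion in r, uniform in the angle. The coefficient c is kept
    apart from b because cos^2 has mean 1/2 while cos(2 th) has mean 0. *)
Definition jet2 (f : R -> R -> R) (a b c : R) := exists2 C, 0 <= C &
  forall r th, 0 <= r <= r0 ->
    `|f r th - (r * (a * cos th) + r ^+ 2 * (b * cos (2 * th) + c * cos th ^+ 2))| <= C * r ^+ 3.

Lemma jet2D f g a b c a' b' c' : jet2 f a b c -> jet2 g a' b' c' ->
  jet2 (fun r th => f r th + g r th) (a + a') (b + b') (c + c').
Proof.
move=> [C C0 H] [C' C'0 H']; exists (C + C'); first exact: addr_ge0.
move=> r th rr; rewrite [leRHS]mulrDl; apply: le_trans _ (lerD (H r th rr) (H' r th rr)).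
apply: le_trans _ (ler_normD _ _); rewrite le_eqVlt; apply/orP; left; apply/eqP; congr (`|_|); ring.
Qed.

Lemma jet2Z f a b c k : jet2 f a b c -> jet2 (fun r th => k * f r th) (k * a) (k * b) (k * c).
Proof.
move=> [C C0 H]; exists (`|k| * C); first exact: mulr_ge0.
move=> r th rr; rewrite -[leRHS]mulrA; apply: le_trans _ (ler_wpM2l (normr_ge0 k) (H r th rr)).
rewrite -normrM le_eqVlt; apply/orP; left; apply/eqP; congr (`|_|); ring.
Qed.

Lemma jet2_0 : jet2 (fun _ _ => 0) 0 0 0.
Proof.
exists 0 => // r th _.
by rewrite !mul0r addr0 !mulr0 addr0 subrr normr0.
Qed.

Lemma jet2_sum m (f : 'I_m -> R -> R -> R) a b c : (forall i, jet2 (f i) (a i) (b i) (c i)) ->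
  jet2 (fun r th => \sum_i f i r th) (\sum_i a i) (\sum_i b i) (\sum_i c i).
Proof.
move=> H; elim: (index_enum _) => [|i s IH].
  have := jet2_0; congr jet2; rewrite ?big_nil//.
  by apply/funext => r; apply/funext => th; rewrite big_nil.
have := jet2D (H i) IH; rewrite !big_cons; congr jet2.
by apply/funext => r; apply/funext => th; rewrite big_cons.
Qed.

Lemma jet2_lin f a b c : jet2 f a b c -> exists2 C, 0 <= C &
  forall r th, 0 <= r <= r0 -> `|f r th - r * (a * cos th)| <= C * r ^+ 2 /\ `|f r th| <= C * r.
Proof.
move=> [C C0 H]; pose D := C + (`|b| + `|c|).
have D0 : 0 <= D by rewrite !addr_ge0.
exists (D + `|a|); first by rewrite addr_ge0.
move=> r th rr; have := H r th rr; case/andP: (rr) => r_0 r_1; have R01 := r01.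
have r2 : 0 <= r ^+ 2 by rewrite exprn_ge0.
have rr2 : r ^+ 3 <= r ^+ 2 by rewrite exprSr ler_piMr//; lra.
have rr1 : r ^+ 2 <= r by rewrite expr2 ler_piMr//; lra.
have cos1 (t : R) : `|cos t| <= 1 by rewrite ler_norml cos_geN1 cos_le1.
have hb : `|b * cos (2 * th) + c * cos th ^+ 2| <= `|b| + `|c|.
  apply: le_trans (ler_normD _ _) _; rewrite [`|b * _|]normrM [`|c * _|]normrM normrX; apply: lerD; apply: ler_piMr => //.
  by rewrite exprn_ile1.
have h1 : `|r ^+ 2 * (b * cos (2 * th) + c * cos th ^+ 2)| <= (`|b| + `|c|) * r ^+ 2.
  by rewrite normrM ger0_norm// mulrC ler_wpM2r.
have h2 : C * r ^+ 3 <= C * r ^+ 2 by rewrite ler_wpM2l.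
move=> HC; have h3 : `|f r th - r * (a * cos th)| <= D * r ^+ 2.
  rewrite (_ : _ - _ = (f r th - (r * (a * cos th) + r ^+ 2 * (b * cos (2 * th) + c * cos th ^+ 2)))
     + r ^+ 2 * (b * cos (2 * th) + c * cos th ^+ 2)); last ring.
  apply: le_trans (ler_normD _ _) _; rewrite /D [leRHS]mulrDl; apply: lerD => //; exact: le_trans h2.
have h4 : `|r * (a * cos th)| <= `|a| * r.
  by rewrite !normrM (ger0_norm r_0) mulrC ler_wpM2r// ler_piMr.
have h5 : 0 <= `|a| * r ^+ 2 by rewrite mulr_ge0.
have h6 : D * r ^+ 2 <= D * r by rewrite ler_wpM2l.
split; first by rewrite [leRHS]mulrDl; lra.
rewrite -[f r th](subrK (r * (a * cos th))).
apply: le_trans (ler_normD _ _) _; rewrite [leRHS]mulrDl; apply: lerD => //; lra.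
Qed.

(** A product starts at second order, where only the first order terms contribute. *)
Lemma jet2M f g a b c a' b' c' : jet2 f a b c -> jet2 g a' b' c' ->
  jet2 (fun r th => f r th * g r th) 0 0 (a * a').
Proof.
move=> /jet2_lin[C C0 H] /jet2_lin[C' C'0 H']; exists (C * C' + C * `|a'|).
  by rewrite addr_ge0// mulr_ge0.
move=> r th rr; have [h1 h2] := H r th rr; have [h3 h4] := H' r th rr.
case/andP: (rr) => r_0 r_1; have R01 := r01.
rewrite (_ : _ - _ = f r th * (g r th - r * (a' * cos th)) +
   (f r th - r * (a * cos th)) * (r * (a' * cos th))); last ring.
have h5 : `|r * (a' * cos th)| <= `|a'| * r.
  by rewrite !normrM (ger0_norm r_0) mulrC ler_wpM2r// ler_piMr// ler_norml cos_geN1 cos_le1.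
apply: le_trans (ler_normD _ _) _; rewrite [leRHS]mulrDl !normrM; apply: lerD.
  have := ler_pM (normr_ge0 _) (normr_ge0 _) h2 h3.
  by congr (_ <= _); ring.
have := ler_pM (normr_ge0 _) (normr_ge0 _) h1 h5.
by congr (_ <= _); rewrite ?normrM; ring.
Qed.

Lemma jet2_log_disc w W : `|w| <= W -> 1 <= W -> r0 * W <= 6^-1 ->
  jet2 (fun r th => log_disc r w th) w (- w ^+ 2 / 2) 0.
Proof.
move=> wW W1 rW; exists (30 * W ^+ 3); first by rewrite mulr_ge0// exprn_ge0//; lra.
move=> r th /andP[r_0 r_1].
have := @log_disc_taylor R r w th W r_0 wW W1 (le_trans (ler_wpM2r (le_trans ler01 W1) r_1) rW).
rewrite exprMn mulrCA mulrA [r ^+ 3 * _]mulrC [_ * r ^+ 3]mulrC mulrA; congr (`|_| <= _); last ring.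
by field.
Qed.
End jet2.

(** * Sub-mean values force convexity *)

Section submean.
Context {R : realType}.

Lemma log_disc_bound (r w th W : R) : 0 <= r -> `|w| <= W -> 1 <= W -> r * W <= 6^-1 ->
  `|log_disc r w th| <= 40 * (r * W).
Proof.
move=> r0 wW W1 rW; have := log_disc_taylor th r0 wW W1 rW.
set A := r * W in rW *; have A0 : 0 <= A by rewrite mulr_ge0//; lra.
set v := r * w * cos th; set v2 := r ^+ 2 * w ^+ 2 * cos (2 * th) / 2; set L := log_disc _ _ _.
have a1 : `|r * w| <= A by rewrite normrM ger0_norm// ler_wpM2l.
have cos1 (t : R) : `|cos t| <= 1 by rewrite ler_norml cos_geN1 cos_le1.
have h1 : `|v| <= A by rewrite /v normrM; apply: le_trans a1; exact: ler_piMr.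
have AA : A ^+ 2 <= A by rewrite expr2 ler_piMr//; lra.
have A3 : A ^+ 3 <= A by apply: le_trans AA; rewrite exprSr ler_piMr ?exprn_ge0//; lra.
have h2 : `|v2| <= A / 2.
  rewrite /v2 normrM (@ger0_norm _ (2^-1))// ler_pM2r// -exprMn normrM normrX.
  apply: le_trans AA; apply: (@le_trans _ _ (`|r * w| ^+ 2)); first by apply: ler_piMr.
  by rewrite ler_sqr ?nnegrE.
move: h1 h2; rewrite !ler_norml => /andP[? ?] /andP[? ?] /andP[? ?]; apply/andP; split; lra.
Qed.

Variable n : nat.
Variable f : 'rV[R]_n -> R.
Hypothesis uf : usc f.
Hypothesis submean_f : forall (p w : 'rV[R]_n) (r a b c : R), 0 < r -> (forall i, r * `|w 0 i| < 1) ->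
  (forall th, f (p + \row_j log_disc r (w 0 j) th) <= a + b * cos th + c * cos (2 * th)) -> f p <= a.

Section seg.
Variables (x w : 'rV[R]_n) (i : 'I_n).
Hypothesis wi : w 0 i != 0.
Variables (kap del N : R).
Hypothesis del0 : 0 < del.

Let T (p : 'rV[R]_n) : R := (p 0 i - x 0 i) / w 0 i.
Let U (p : 'rV[R]_n) := p - x - T p *: w.
Let S (p : 'rV[R]_n) : R := dotv (U p) (U p).

Let TD p L : T (p + L) = T p + (w 0 i)^-1 * L 0 i.
Proof. by rewrite /T mxE; ring. Qed.
Let UD p L : U (p + L) = U p + (L - ((w 0 i)^-1 * L 0 i) *: w).
Proof. by rewrite /U TD; apply/rowP => j; rewrite !mxE; ring. Qed.

Let cT p : continuous_at p T.
Proof. by apply: ctM; [apply: ctB; [exact: ct_coord|exact: ct_cst]|exact: ct_cst]. Qed.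

Lemma slab_contS p : continuous_at p S.
Proof.
apply: (ct_eq (g := fun p : 'rV[R]_n => \sum_j (p 0 j - x 0 j - T p * w 0 j) * (p 0 j - x 0 j - T p * w 0 j))).
  by move=> q; rewrite /S /dotv; apply: eq_bigr => j _; rewrite !mxE.
have cc j : continuous_at p (fun p : 'rV[R]_n => p 0 j - x 0 j - T p * w 0 j).
  apply: ctB; last by apply: ctM; [exact: cT|exact: ct_cst].
  by apply: ctB; [exact: ct_coord|exact: ct_cst].
by apply: ct_sum => j; apply: ctM.
Qed.

(** On the slab around the segment from x to x + w: affine along the segment, plus the
    concave bump del T (1 - T), plus N times the squared distance to the line.
    [T], [U] and [S] are the parameter of the projection to the line, the deviation
    from it and its squared norm. *)
Definition penalty p := kap * T p - del * (T p ^+ 2 - T p) + N * S p.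

(** Near a local maximum p of f - penalty, f is at most f p plus the increment of the
    penalty. Along the disc in the direction w this increment is a trigonometric
    polynomial with mean - del r^2 / 2, up to O(r^3): the deviation from the line is of second
    order, so that the term in N contributes only r^2 cos(2 th) and higher order. The
    sub-mean property would then give f p < f p. *)
Lemma no_local_max p d : 0 < d ->
  (forall p', `|p' - p| < d -> f p' - penalty p' <= f p - penalty p) -> False.
Proof.
move=> d0 H.
pose W := `|w| + 1; have W1 : 1 <= W by rewrite lerDr.
have W0 : 0 < W by apply: lt_le_trans W1.
have wW j : `|w 0 j| <= W by apply: le_trans (coord_le _ _) _; rewrite lerDl.
pose r0 := (6 * W)^-1.
have r00 : 0 < r0 by rewrite invr_gt0 mulr_gt0.
have r0W : r0 * W = 6^-1 by rewrite /r0; field; rewrite gt_eqF.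
have r01 : r0 <= 1.
  by rewrite /r0 invf_le1 ?mulr_gt0//; lra.
pose L r th : 'rV[R]_n := \row_j log_disc r (w 0 j) th.
pose tau r th := (w 0 i)^-1 * log_disc r (w 0 i) th.
pose zeta r th j := log_disc r (w 0 j) th + (- w 0 j) * tau r th.
have eL j : jet2 r0 (fun r th => log_disc r (w 0 j) th) (w 0 j) (- w 0 j ^+ 2 / 2) 0.
  by apply: jet2_log_disc (wW j) W1 _; rewrite r0W.
have et := jet2Z (w 0 i)^-1 (eL i); rewrite mulVf// mulr0 -/tau in et.
have ez j := jet2D (eL j) (jet2Z (- w 0 j) et).
have {}ez j : exists b, jet2 r0 (fun r th => zeta r th j) 0 b 0.
  by eexists; have := ez j; rewrite mulr1 subrr mulr0 addr0; exact.
have [b Eb] := choice ez.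
pose u := U p.
have e1 := jet2_sum (fun j => jet2Z (u 0 j) (Eb j)).
have e2 := jet2_sum (fun j => jet2M r01 (Eb j) (Eb j)).
have e3 := jet2M r01 et et.
have := jet2D (jet2Z kap et) (jet2D (jet2D (jet2Z (- del * (2 * T p - 1)) et) (jet2Z (- del) e3))
   (jet2D (jet2Z (2 * N) e1) (jet2Z N e2))).
set ca := (X in jet2 _ _ X _ _); set cb := (X in jet2 _ _ _ X _).
set cc := (X in jet2 _ _ _ _ X).
have -> : cc = - del.
  rewrite /cc !mulr0 !big1; first by ring.
  - by move=> j _; ring.
  - by move=> j _; ring.
case=> C C0 HC.
have key r th : 0 <= r <= r0 -> penalty (p + L r th) - penalty p <=
   (- del / 2 * r ^+ 2 + C * r ^+ 3) + (r * ca) * cos th + (r ^+ 2 * (cb - del / 2)) * cos (2 * th).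
  move=> rr; have := HC r th rr; rewrite ler_norml => /andP[_].
  set g := (X in X - _ <= _ -> _).
  have -> : penalty (p + L r th) - penalty p = g.
    rewrite /penalty /S TD UD -/u.
    have -> : L r th - ((w 0 i)^-1 * L r th 0 i) *: w = \row_j zeta r th j.
      by apply/rowP => j; rewrite !mxE /zeta /tau; ring.
    set zz := \row_j zeta r th j; rewrite [L r th 0 i]mxE -/(tau r th) (dotvDl _ u zz) (dotvDr u u zz) (dotvDr zz u zz) (dotvC zz u) /g.
    have -> : \sum_i0 u 0 i0 * zeta r th i0 = dotv u zz.
      by rewrite /dotv; apply: eq_bigr => j _; rewrite [zz _ _]mxE.
    have -> : \sum_i0 zeta r th i0 * zeta r th i0 = dotv zz zz.
      by rewrite /dotv; apply: eq_bigr => j _; rewrite [zz _ _]mxE.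
    by ring.
  have -> : cos (2 * th) = 2 * cos th ^+ 2 - 1 by rewrite [2 * th]mulr_natl cos_mulr2n mulr_natl.
  set cs := cos th; move=> h; rewrite -subr_ge0.
  move: h; rewrite -subr_ge0; congr (0 <= _); by field.
pose r := Num.min r0 (Num.min (d / (80 * W)) (del / (2 * (2 * C + 1)))).
have C21 : 0 < 2 * C + 1 by lra.
have rp : 0 < r by rewrite !lt_min r00 !divr_gt0 ?mulr_gt0.
have rr0 : 0 <= r <= r0 by rewrite ltW//= ge_min lexx.
have rW : r * W <= 6^-1 by rewrite -r0W ler_pM2r//; case/andP: rr0.
have rd : 40 * (r * W) < d.
  have : r <= d / (80 * W) by rewrite /r !ge_min lexx orbT.
  by rewrite ler_pdivlMr ?mulr_gt0//; lra.
have Hr : r * (2 * (2 * C + 1)) <= del by rewrite -ler_pdivlMr ?mulr_gt0// /r !ge_min lexx !orbT.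
have : f p <= f p + (- del / 2 * r ^+ 2 + C * r ^+ 3).
  apply: (@submean_f p w r _ (r * ca) (r ^+ 2 * (cb - del / 2))) => //.
    move=> j; apply: (@le_lt_trans _ _ (r * W)); first by rewrite ler_pM2l.
    by apply: le_lt_trans rW _; lra.
  move=> th; rewrite -/(L r th).
  have : `|p + L r th - p| < d.
    rewrite addrC addKr; apply: le_lt_trans rd; apply/row_norm_le.
      by rewrite mulr_ge0// mulr_ge0// ltW.
    by move=> j; rewrite mxE; apply: log_disc_bound => //; exact: ltW.
  move/H => h1; have h2 := key r th rr0; clear -h1 h2; lra.
rewrite lerDl exprSr => h.
have r2 : 0 < r ^+ 2 by rewrite exprn_gt0.
have : 0 <= r ^+ 2 * (- del / 2 + C * r) by apply: le_trans h _; rewrite le_eqVlt; apply/orP; left; apply/eqP; ring.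
rewrite pmulr_rge0// => h3.
have dd := del0; clear -n f uf submean_f x w i wi kap del N del0 h3 Hr rp dd; lra.
Qed.

Lemma slab_compact : compact [set p | 0 <= T p <= 1 /\ S p <= 1].
Proof.
apply: (subclosed_compact _ (@ball_compact R n x (`|w| + 1))).
  rewrite (_ : [set _ | _] = (T @^-1` [set r | 0 <= r]) `&` ((T @^-1` [set r | r <= 1]) `&` (S @^-1` [set r | r <= 1]))).
    apply: closedI; first by apply: closed_comp; [move=> z _; apply: cT|exact: closed_ge].
    apply: closedI; first by apply: closed_comp; [move=> z _; apply: cT|exact: closed_le].
    by apply: closed_comp; [move=> z _; apply: slab_contS|exact: closed_le].
  apply/seteqP; split => p /=; first by move=> [/andP[? ?] ?].
  by move=> [h1 [h2 h3]]; rewrite h1 h2.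
move=> p /= [/andP[T0 T1] S1]; rewrite -[p - x](subrK (T p *: w)) addrC.
apply: le_trans (ler_normD _ _) _; apply: lerD.
  by rewrite normrZ ger0_norm// ler_piMl.
have := le_trans (dotv_ge (U p)) S1.
by rewrite -[leRHS](expr1n _ 2) ler_sqr ?nnegrE.
Qed.
End seg.

(** Suppose that f exceeds its chord at some point of the segment. Maximize f - penalty
    over the slab. For large N, upper semicontinuity keeps the maximum away from the
    boundary: near the ends because f is there at most slightly larger than its end
    values, on the lateral boundary because of the term in N. This contradicts
    [no_local_max]. *)
Theorem submean_cvx : cvx setT f.
Proof.
move=> x y t _ _ /andP[t0 t1]; rewrite leNgt; apply/negP => viol.
set w := y - x in viol.
have [w0|] := eqVneq w 0.
  have xy : y = x by apply/eqP; rewrite -subr_eq0 -/w w0.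
  by move: viol; rewrite w0 scaler0 addr0 xy subrr mulr0 addr0 ltxx.
move=> wn0; have [i wi] : exists i, w 0 i != 0.
  apply: contrapT => H; apply/negP: wn0; rewrite negbK; apply/eqP/rowP => i; rewrite [RHS]mxE.
  by apply/eqP; apply: contrapT => /negP h; apply: H; exists i.
pose kap := f y - f x; pose D := f (x + t *: w) - f x - t * kap.
have D0 : 0 < D by rewrite /D /kap; lra.
pose T (p : 'rV[R]_n) : R := (p 0 i - x 0 i) / w 0 i.
pose U (p : 'rV[R]_n) := p - x - T p *: w.
pose S (p : 'rV[R]_n) : R := dotv (U p) (U p).
pose K := [set p | 0 <= T p <= 1 /\ S p <= 1].
have cK : compact K by exact: slab_compact.
have cpen N p : continuous_at p (penalty x w i kap D N).
  have cT : continuous_at p T by apply: ctM; [apply: ctB; [exact: ct_coord|exact: ct_cst]|exact: ct_cst].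
  apply: ctD; last by apply: ctM; [exact: ct_cst|exact: slab_contS].
  apply: ctB; first by apply: ctM; [exact: ct_cst|exact: cT].
  apply: ctM; first exact: ct_cst.
  by apply: ctB => //; apply: ctM.
have upen N : usc (fun p => f p - penalty x w i kap D N p).
  move=> p a fa.
  pose e := (a - (f p - penalty x w i kap D N p)) / 2.
  have e0 : 0 < e by rewrite /e; lra.
  have [d1 d10 H1] := @uf p (f p + e) ltac:(lra).
  have [d2 d20 H2] := (cont_epsP _ _).1 (cpen N p) _ e0.
  exists (Num.min d1 d2); first by rewrite lt_min d10.
  move=> q; rewrite lt_min => /andP[/H1 h1 /H2]; rewrite ltr_norml => /andP[h2 _].
  rewrite /e in h1 h2; lra.
have Tx s : T (x + s *: w) = s.
  rewrite /T mxE [(s *: w) _ _]mxE; by field.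
have Sx s : S (x + s *: w) = 0.
  by rewrite /S /U Tx [x + _]addrC addrK subrr /dotv big1// => j _; rewrite mxE mul0r.
have Kx s : 0 <= s <= 1 -> K (x + s *: w) by move=> h; split; rewrite ?Tx ?Sx.
have [pM KpM HM] := usc_max cK (Kx t ltac:(by rewrite t0)) (upen 0).
pose M := f pM - penalty x w i kap D 0 pM.
have [dx dx0 Hdx] := @uf x (f x + D / 2) ltac:(lra).
have [dy dy0 Hdy] := @uf y (f y + D / 2) ltac:(lra).
(* a point of the slab at distance at least dm from the line pays more than max f *)
pose dm := Num.min 1 (Num.min dx dy).
have dm0 : 0 < dm by rewrite !lt_min ltr01 dx0.
pose N := (`|M - f x| + 1) / dm ^+ 2.
have N0 : 0 < N by rewrite divr_gt0 ?exprn_gt0// ltr_wpDl.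
have [p Kp Hp] := usc_max cK (Kx t ltac:(by rewrite t0)) (upen N).
have F0 : f x + 3 / 4 * D <= f p - penalty x w i kap D N p.
  apply: le_trans (Hp _ (Kx t ltac:(by rewrite t0))).
  rewrite /penalty -/(T _) -/(U _) -/(S _) Tx Sx mulr0 addr0.
  have : 0 <= D * (t - 2^-1) ^+ 2 by rewrite mulr_ge0 ?sqr_ge0// ltW.
  have -> : f (x + t *: w) = D + f x + t * kap by rewrite /D; ring.
  move: (D) => D'; lra.
have Sp : S p < dm ^+ 2.
  rewrite ltNge; apply/negP => h.
  have : N * dm ^+ 2 <= N * S p by rewrite ler_pM2l.
  rewrite {1}/N divfK ?gt_eqF ?exprn_gt0// => h2.
  have := HM p Kp; rewrite -/M => h3; have h4 := ler_norm (M - f x).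
  move: F0 h3; rewrite /penalty -/(T p) -/(U p) -/(S p) -/N mul0r addr0; lra.
have Up : `|U p| < dm.
  have := le_lt_trans (dotv_ge (U p)) Sp; rewrite ltr_sqr ?nnegrE//; exact: ltW.
have [/andP[Tp0 Tp1] _] := Kp.
have S0 : 0 <= N * S p by rewrite mulr_ge0 ?(ltW N0)//; exact: le_trans (sqr_ge0 _) (dotv_ge _).
have T0 : 0 < T p.
  rewrite lt_neqAle Tp0 andbT; apply/eqP => T0.
  have /Hdx : `|p - x| < dx.
    have := Up; rewrite /U -T0 scale0r subr0 => /lt_le_trans; apply.
    by rewrite /dm !ge_min lexx orbT.
  move: F0; rewrite /penalty -/(T p) -/(U p) -/(S p) -T0; lra.
have T1 : T p < 1.
  rewrite lt_neqAle Tp1 andbT; apply/eqP => T1.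
  have /Hdy : `|p - y| < dy.
    have := Up; rewrite /U T1 scale1r (_ : p - x - w = p - y); last first.
      by rewrite /w opprB addrA subrK.
    by move=> /lt_le_trans; apply; rewrite /dm !ge_min lexx !orbT.
  move: F0; rewrite /penalty -/(T p) -/(U p) -/(S p) T1 /kap; lra.
have S1 : S p < 1.
  apply: lt_le_trans Sp _; rewrite exprn_ile1//; first exact: ltW.
  by rewrite /dm ge_min lexx.
have cT : continuous_at p T by apply: ctM; [apply: ctB; [exact: ct_coord|exact: ct_cst]|exact: ct_cst].
have cS : continuous_at p S by exact: slab_contS.
pose e := Num.min (T p) (Num.min (1 - T p) (1 - S p)).
have e0 : 0 < e by rewrite !lt_min T0 !subr_gt0 T1.
have [d1 d10 H1] := (cont_epsP _ _).1 cT _ e0.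
have [d2 d20 H2] := (cont_epsP _ _).1 cS _ e0.
apply: (@no_local_max x w i wi kap D N D0 p (Num.min d1 d2)); first by rewrite lt_min d10.
move=> q; rewrite lt_min => /andP[/H1 h1 /H2 h2]; apply: Hp.
have [k1 [k2 k3]] : e <= T p /\ e <= 1 - T p /\ e <= 1 - S p by rewrite /e !ge_min !lexx !orbT.
move: h1 h2; rewrite !ltr_norml => /andP[? ?] /andP[? ?].
by split; [apply/andP; split|]; lra.
Qed.
End submean.

(** * Complex discs and their logarithmic images *)

Section trig.
Context {R : realType}.
Notation mu := (@lebesgue_measure R).

(** The integrand of the sub-mean inequality is only known through an upper bound.
    The integrals of f^+ and f^- are suprema over the simple functions below them, and the
    inclusion of these families gives monotonicity. *)
Lemma integral_mono (D : set R) (f g : R -> \bar R) : (forall x, D x -> (f x <= g x)%E) ->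
  (\int[mu]_(x in D) f x <= \int[mu]_(x in D) g x)%E.
Proof.
have nonneg_mono (f1 g1 : R -> \bar R) : (forall x, D x -> (0 <= f1 x <= g1 x)%E) ->
    (\int[mu]_(x in D) f1 x <= \int[mu]_(x in D) g1 x)%E.
  move=> H; rewrite !ge0_integralE; first last.
  - by move=> x /H /andP[].
  - by move=> x /H /andP[]; exact: le_trans.
  apply: le_ereal_sup => _ [h hf <-]; exists h => // x; apply: le_trans (hf x) _.
  by rewrite !patchE; case: ifPn => // /set_mem /H /andP[].
move=> H; rewrite [leLHS]integralE [leRHS]integralE; apply: leeB.
  apply: nonneg_mono => x /H fg; rewrite !funeposE; apply/andP; split; first by rewrite le_max lexx orbT.
  by rewrite ge_max !le_max fg lexx orbT.
apply: nonneg_mono => x /H fg; rewrite !funenegE; apply/andP; split; first by rewrite le_max lexx orbT.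
by rewrite ge_max !le_max leeN2 fg lexx orbT.
Qed.

(** Only the constant term has a nonzero mean over a period. *)
Lemma trig_int (a b c : R) :
  (\int[mu]_(t in `[0%R, (2 * pi)%R]) ((a + b * cos t + c * cos (2 * t))%:E) = (2 * pi * a)%:E)%E.
Proof.
have pi0 : 0 < 2 * pi :> R by rewrite mulr_gt0// pi_gt0.
pose f (t : R) := a + b * cos t + c * cos (2 * t).
have cf : continuous f.
  move=> t; have c2 : continuous_at t (fun t : R => cos (2 * t)).
    apply: (ct_comp (f := fun t : R => 2 * t) (g := @cos R)); last exact: continuous_cos.
    by apply: ctM; [exact: ct_cst|exact: cvg_id].
  apply: ctD; last by apply: ctM => //; exact: ct_cst.
  apply: ctD; first exact: ct_cst.
  by apply: ctM; [exact: ct_cst|exact: continuous_cos].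
have -> : 2 * pi * a = Ii 0 (2 * pi) f.
  pose F (t : R) := a * t + b * sin t + c / 2 * sin (2 * t).
  have dF (t : R) : 0 <= t <= 2 * pi -> is_derive t (1:R) F (f t).
    move=> _; have d2 : is_derive t (1:R) (fun t : R => sin (2 * t)) (2 * cos (2 * t)).
      have l2 : is_derive t (1:R) (fun t : R => 2 * t) 2.
        apply/is_derive_epsP => e e0; exists 1 => // h _.
        by rewrite (_ : _ - _ = 0) ?normr0 ?mulr_ge0 ?(ltW e0)//; ring.
      rewrite mulrC; apply: (@is_derive1_comp _ (@sin R) (fun t : R => 2 * t)) => //.
    have d1 := is_derive_sin t.
    apply/is_derive_epsP => e e0.
    pose k := `|b| + `|c| + 1; have k0 : 0 < k by rewrite ltr_wpDl// addr_ge0.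
    have /is_derive_epsP /(_ (e / k))[|e1 e10 H1] := d1; first by rewrite divr_gt0.
    have /is_derive_epsP /(_ (e / k))[|e2 e20 H2] := d2; first by rewrite divr_gt0.
    exists (Num.min e1 e2); first by rewrite lt_min e10.
    move=> h; rewrite lt_min => /andP[/H1 h1 /H2 h2].
    rewrite (_ : _ - _ = b * (sin (t + h) - sin t - h * cos t) +
       c / 2 * (sin (2 * (t + h)) - sin (2 * t) - h * (2 * cos (2 * t)))); last first.
      by rewrite /F /f; field.
    apply: le_trans (ler_normD _ _) _; rewrite !normrM (@ger0_norm _ (2^-1))//.
    have := ler_wpM2l (normr_ge0 b) h1; have := ler_wpM2l (normr_ge0 c) h2.
    have -> : e * `|h| = k * (e / k * `|h|) by field; rewrite gt_eqF.
    set E := e / k * `|h|; have E0 : 0 <= E by rewrite mulr_ge0// divr_ge0// ltW.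
    have : 0 <= `|c| * E by rewrite mulr_ge0.
    have : 0 <= `|c| * `|sin (2 * (t + h)) - sin (2 * t) - h * (2 * cos (2 * t))| by rewrite mulr_ge0.
    rewrite /k; lra.
  have s4 : sin (2 * (2 * pi)) = 0 :> R.
    by rewrite [2 * (2 * pi)]mulr_natl sin_mulr2n [2 * pi]mulr_natl sin2pi mulr0 mul0rn.
  have s2 : sin (2 * pi) = 0 :> R by rewrite [2 * pi]mulr_natl sin2pi.
  transitivity (F (2 * pi) - F 0); last by apply/esym; exact: Ii_FTC2.
  by rewrite /F !mulr0 sin0 s4 s2; ring.
rewrite /Ii /Rintegral fineK//; apply: integrable_fin_num => //; exact: cont_int.
Qed.
End trig.

Section cpx.
Context {R : realType}.
Implicit Types (z w : Cpx R).

(** The norm of a complex number is itself a complex number; this is its real part. *)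
Definition modulus z : R := reC `|z|.

Lemma modulusE z : modulus z = Num.sqrt (reC z ^+ 2 + imC z ^+ 2).
Proof. by rewrite /modulus /reC /imC [`|z|]normc_def. Qed.

Lemma normC_modulus z : `|z| = mkC (modulus z) 0.
Proof. by rewrite modulusE /reC /imC [`|z|]normc_def. Qed.

Lemma cpx_eqP z w : reC z = reC w -> imC z = imC w -> z = w.
Proof. by case: z w => a b [c d]; rewrite /reC /imC /= => -> ->. Qed.

Lemma sqr_modulus_gt0 z : z != 0 -> 0 < reC z ^+ 2 + imC z ^+ 2.
Proof.
move=> z0; rewrite lt_neqAle addr_ge0 ?sqr_ge0// andbT eq_sym paddr_eq0 ?sqr_ge0//.
rewrite !sqrf_eq0; apply: contra z0 => /andP[/eqP h1 /eqP h2].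
by apply/eqP/cpx_eqP; rewrite ?h1 ?h2.
Qed.

Lemma ln_modulus z : z != 0 -> ln (modulus z) = ln (reC z ^+ 2 + imC z ^+ 2) / 2.
Proof.
move=> /sqr_modulus_gt0 z0; rewrite modulusE.
have s0 : 0 < Num.sqrt (reC z ^+ 2 + imC z ^+ 2) by rewrite sqrtr_gt0.
rewrite -[in RHS](sqr_sqrtr (ltW z0)) lnXn// -mulr_natl; by field.
Qed.

Lemma RelogE n (z : 'rV[Cpx R]_n) j : Relog z 0 j = ln (modulus (z 0 j)).
Proof. by rewrite mxE. Qed.

Lemma Relog_expC n (x : 'rV[R]_n) : Relog (expC x) = x.
Proof.
apply/rowP => j; rewrite RelogE mxE modulusE /reC /imC /=.
by rewrite expr0n /= addr0 sqrtr_sqr gtr0_norm ?expR_gt0// expRK.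
Qed.

Lemma expC_torus n (x : 'rV[R]_n) : torus (expC x).
Proof.
move=> j; rewrite mxE; apply/eqP => /(congr1 (@reC R)); rewrite /reC /= => /eqP.
by rewrite gt_eqF// expR_gt0.
Qed.

(** The disc of radius r w_j e^(p_j) around e^(p_j) avoids 0. *)
Lemma disc_torus n (p w : 'rV[R]_n) (r : R) (l : Cpx R) : 0 < r -> (forall i, r * `|w 0 i| < 1) ->
  `|l| <= 1 -> torus (expC p + l *: (\row_j mkC (r * w 0 j * expR (p 0 j)) 0)).
Proof.
move=> r0 rw; case: l => a b l1 j; rewrite !mxE; apply/eqP => /(congr1 (@reC R)).
rewrite /reC /= mulr0 subr0.
have a1 : `|a| <= 1.
  have := l1; rewrite normC_modulus lecE /= eqxx /= modulusE; apply: le_trans.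
  by rewrite -sqrtr_sqr ler_sqrt ?lerDl ?addr_ge0 ?sqr_ge0.
have := expR_gt0 (p 0 j); set E := expR _ => E0.
move/eqP; rewrite (_ : E + _ = E * (1 + a * (r * w 0 j))); last ring.
rewrite mulf_eq0 gt_eqF//= => /eqP h.
have : `|a * (r * w 0 j)| < 1.
  rewrite normrM; apply: le_lt_trans (rw j); rewrite -[leRHS]mul1r normrM (gtr0_norm r0).
  by rewrite ler_wpM2r// mulr_ge0// ltW.
by rewrite ltr_norml => /andP[]; lra.
Qed.

(** |e^p (1 + r w e^(i th))|^2 = e^(2p) (1 + 2 r w cos th + r^2 w^2). *)
Lemma disc_Relog n (p w : 'rV[R]_n) (r th : R) : 0 < r -> (forall i, r * `|w 0 i| < 1) ->
  Relog (expC p + mkC (cos th) (sin th) *: (\row_j mkC (r * w 0 j * expR (p 0 j)) 0)) =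
    p + \row_j log_disc r (w 0 j) th.
Proof.
move=> r0 rw; apply/rowP => j.
have l1 : `|mkC (cos th) (sin th)| <= 1.
  by rewrite normC_modulus modulusE /reC /imC /= cos2Dsin2 sqrtr1.
rewrite RelogE ln_modulus; last by have H := @disc_torus n p w r _ r0 rw l1; exact: H.
rewrite !mxE /reC /imC /= !mulr0 subr0 !add0r /log_disc.
set E := expR _; have E0 : 0 < E := expR_gt0 _; set u := w 0 j.
have -> : (E + cos th * (r * u * E)) ^+ 2 + (sin th * (r * u * E)) ^+ 2 =
  E ^+ 2 * (1 + (2 * r * u * cos th + r ^+ 2 * u ^+ 2)).
  have -> : r ^+ 2 * u ^+ 2 = r ^+ 2 * u ^+ 2 * (cos th ^+ 2 + sin th ^+ 2) by rewrite cos2Dsin2 mulr1.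
  by ring.
have P : 0 < 1 + (2 * r * u * cos th + r ^+ 2 * u ^+ 2).
  have c1 : `|cos th| <= 1 by rewrite ler_norml cos_geN1 cos_le1.
  have k : `|r * u * cos th| <= `|r * u| by rewrite normrM ler_piMr.
  have k1 : `|r * u| < 1 by rewrite normrM gtr0_norm//; exact: rw.
  have : 0 < (1 - `|r * u|) ^+ 2 by rewrite exprn_gt0// subr_gt0.
  move: k; rewrite ler_norml => /andP[k _].
  have -> : r ^+ 2 * u ^+ 2 = `|r * u| ^+ 2 by rewrite real_normK ?num_real// exprMn.
  move: k; set q := `|r * u|; move=> k; rewrite sqrrB expr1n mul1r; lra.
by rewrite lnM ?posrE ?exprn_gt0// lnXn// expRK -mulr_natr; field.
Qed.
End cpx.

(** * Plurisubharmonic functions in logarithmic coordinates *)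

Section psh.
Context {R : realType}.
Notation mu := (@lebesgue_measure R).
Variables (n : nat) (Phi : 'rV[Cpx R]_n -> \bar R) (g : 'rV[R]_n -> R).
Hypothesis Phig : forall z, torus z -> Phi z = (g (Relog z))%:E.
Hypothesis pshP : psh (@torus R n) Phi.

Lemma expC_near (x : 'rV[R]_n) (P : set 'rV[Cpx R]_n) : nbhs (expC x) P ->
  exists2 d, 0 < d & forall y, `|y - x| < d -> P (expC y).
Proof.
move=> /nbhs_ballP[e /= e0 He].
have ed : 0 < reC e by move: e0; rewrite ltcE => /andP[_].
have ee : e = mkC (reC e) 0.
  by move: e0; rewrite ltcE => /andP[/eqP h _]; apply: cpx_eqP.
pose h (x : 'rV[R]_n) : 'rV[R]_n := \row_j expR (x 0 j).
have ch : continuous_at x h.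
  apply: ct_mx => i j; apply: (ct_eq (g := fun x : 'rV[R]_n => expR (x 0 j))).
    by move=> y; rewrite mxE.
  apply: (ct_comp (f := fun x : 'rV[R]_n => x 0 j)); first exact: ct_coord.
  exact: continuous_expR.
have [d d0 Hd] := (cont_epsP _ _).1 ch _ ed.
exists d => // y /Hd yx; apply: He; split; first exact: e0.
move=> i j; rewrite -ball_normE /= (ord1 i) !mxE ee normC_modulus ltcE /= eqxx /= modulusE.
rewrite /reC /imC /= subrr expr0n addr0 sqrtr_sqr distrC.
by have := le_lt_trans (coord_le _ j) yx; rewrite !mxE.
Qed.

Lemma psh_usc : usc g.
Proof.
move=> x a gxa; have [_ U _] := pshP.
have := U _ (expC_torus x) a; rewrite Phig ?Relog_expC ?lte_fin; last exact: expC_torus.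
move=> /(_ gxa) /expC_near[d d0 Hd]; exists d => // y /Hd.
by rewrite /= Phig ?Relog_expC ?lte_fin//; exact: expC_torus.
Qed.

(** The disc with centre e^p and direction (r w_j e^(p_j)) in the sub-mean inequality. *)
Lemma psh_submean (p w : 'rV[R]_n) (r a b c : R) : 0 < r -> (forall i, r * `|w 0 i| < 1) ->
  (forall th, g (p + \row_j log_disc r (w 0 j) th) <= a + b * cos th + c * cos (2 * th)) -> g p <= a.
Proof.
move=> r0 rw H; have [_ _ S] := pshP.
have := S _ _ (fun l => @disc_torus R n p w r l r0 rw).
rewrite Phig ?Relog_expC; last exact: expC_torus.
move=> h; rewrite -lee_fin; apply: le_trans h _.
have pi0 : 0 < 2 * pi :> R by rewrite mulr_gt0// pi_gt0.
have -> : a%:E = (((2 * pi)^-1)%:E * (2 * pi * a)%:E)%E.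
  by rewrite -EFinM; congr EFin; rewrite mulrA mulVf ?mul1r// gt_eqF.
apply: lee_wpmul2l; first by rewrite lee_fin invr_ge0 ltW.
rewrite -(trig_int a b c); apply: integral_mono => th _.
rewrite Phig; first by rewrite disc_Relog// lee_fin; exact: H.
apply: disc_torus => //.
by rewrite normC_modulus modulusE /reC /imC /= cos2Dsin2 sqrtr1.
Qed.

Lemma psh_cvx : cvx setT g.
Proof. by apply: submean_cvx; [exact: psh_usc|exact: psh_submean]. Qed.
End psh.

Section logpot.
Context {R : realType}.
Variables (n : nat) (M : topologicalType) (X : complex_structure R n M)
  (T : toric_structure X) (om : form11 R n M) (psiw : 'rV[R]_n -> R).
Hypothesis pot : is_potential om (open_orbit T) (@torus R n) (fun z => psiw (Relog z)).
Variable (v : M -> R).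
Hypothesis vi : invariant_fun T v.
Hypothesis vP : PSH X om (EFin \o v).

(** The compact torus moves e^(Re log z) to z. *)
Lemma inv_expC (z : 'rV[Cpx R]_n) : torus z ->
  v (cinv (open_orbit T) z) = v (cinv (open_orbit T) (expC (Relog z))).
Proof.
move=> tz; pose th : 'rV[Cpx R]_n := \row_j (z 0 j / `|z 0 j|).
have n0 j : `|z 0 j| != 0 by rewrite normr_eq0; exact: tz.
have cth : compact_torus th by move=> j; rewrite mxE normf_div normr_id divff.
have tth : torus th by move=> j; rewrite mxE mulf_neq0// ?invr_eq0//; exact: tz.
rewrite -(vi (cinv (open_orbit T) (expC (Relog z))) cth) (act_orbit T tth); last exact: expC_torus.
congr (v (cinv _ _)); apply/rowP => j; rewrite !mxE -/(modulus (z 0 j)).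
rewrite (_ : mkC _ 0 = `|z 0 j|) ?divfK// normC_modulus; congr mkC.
rewrite lnK// posrE modulusE sqrtr_gt0; exact/sqr_modulus_gt0/tz.
Qed.

(** psi_om + v is plurisubharmonic on the open orbit and depends on Re log z only. *)
Lemma log_potential_cvx : cvx setT (log_potential T psiw v).
Proof.
have [_ _ H] := vP.
have Hp := H _ _ _ (orbit_atlas T) pot.
apply: (psh_cvx _ Hp) => z tz; rewrite /log_potential /= EFinD; congr (_ + _)%E.
by rewrite inv_expC.
Qed.
End logpot.

(** * Second derivatives along curves *)

Section curve.
Context {R : realType}.

Lemma vderiv m (c : R -> 'rV[R]_m) t (v : 'rV[R]_m) :
  (forall i, is_derive t (1:R) (fun s => c s 0 i) (v 0 i)) -> diffat c t (fun s => s *: v).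
Proof.
move=> H e e0.
have : \forall h \near (0 : R), forall i, `|c (t + h) 0 i - c t 0 i - h * v 0 i| <= e * `|h|.
  apply: (@filter_forall _ _ (fun i h => `|c (t + h) 0 i - c t 0 i - h * v 0 i| <= e * `|h|) (nbhs (0:R))) => i; have /is_derive_epsP /(_ e e0)[d d0 Hd] := H i.
  apply/nbhs_ballP; exists d => //= h; rewrite -ball_normE /= sub0r normrN; exact: Hd.
move=> /nbhs_ballP[d /= d0 Hd]; exists d => // h hd.
have := Hd h; rewrite -ball_normE /= sub0r normrN => /(_ hd) Hi.
apply/row_norm_le; first by rewrite mulr_ge0// ltW.
by move=> i; rewrite !mxE; exact: Hi.
Qed.

Lemma chain_rule m (E : set 'rV[R]_m) (h : 'rV[R]_m -> R) (c : R -> 'rV[R]_m) t (v : 'rV[R]_m) :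
  open E -> Ck 1 E h -> E (c t) ->
  (forall i, is_derive t (1:R) (fun s => c s 0 i) (v 0 i)) ->
  is_derive t (1:R) (fun s => h (c s)) (\sum_i v 0 i * partial i h (c t)).
Proof.
move=> oE ch Ec dc; apply/is_derive_epsP => e e0.
have dh := C1_diffat oE ch Ec; have {}dc := vderiv dc.
pose B := \sum_i `|partial i h (c t)|.
have B0 : 0 <= B by apply: sumr_ge0.
have LB (u : 'rV[R]_m) : `|\sum_i u 0 i * partial i h (c t)| <= B * `|u|.
  apply: le_trans (ler_norm_sum _ _ _) _; rewrite mulr_suml; apply: ler_sum => i _.
  by rewrite normrM mulrC ler_wpM2l//; exact: coord_le.
(* half of e for the remainder of h, half for that of the curve *)
pose e1 := e / (2 * (B + 1)).
have B1 : 0 < 2 * (B + 1) by lra.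
have e10 : 0 < e1 by rewrite divr_gt0.
pose e2 := e / (2 * (`|v| + e1)).
have v1 : 0 < 2 * (`|v| + e1) by rewrite mulr_gt0// ltr_wpDl.
have e20 : 0 < e2 by rewrite divr_gt0.
have [d2 d20 H2] := dh _ e20.
have [d1 d10 H1] := dc _ e10.
exists (Num.min d1 (d2 / (`|v| + e1))); first by rewrite lt_min d10 divr_gt0// ltr_wpDl.
move=> s; rewrite lt_min ltr_pdivlMr ?ltr_wpDl// => /andP[/H1 h1 h2].
set D := c (t + s) - c t.
have h1' : `|D - s *: v| <= e1 * `|s| by exact: h1.
have D1 : `|D| <= `|s| * (`|v| + e1).
  rewrite -[D](subrK (s *: v)); apply: le_trans (ler_normD _ _) _; rewrite normrZ; lra.
have E1 : c t + D = c (t + s) by rewrite /D addrC subrK.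
have := H2 D (le_lt_trans D1 h2); rewrite E1 => h3.
rewrite (_ : _ - _ = (h (c (t + s)) - h (c t) - \sum_i D 0 i * partial i h (c t)) +
   \sum_i (D - s *: v) 0 i * partial i h (c t)); last first.
  rewrite -[RHS]addrA; congr (_ + _); rewrite mulr_sumr -!sumrN -big_split; apply: eq_bigr => i _.
  by rewrite /= [(D - _) _ _]mxE [(- (s *: v)) _ _]mxE [(s *: v) _ _]mxE; ring.
apply: le_trans (ler_normD _ _) _.
have h4 : e2 * `|D| <= e / 2 * `|s|.
  apply: (@le_trans _ _ (e2 * (`|s| * (`|v| + e1)))); first by apply: ler_wpM2l => //; exact: ltW.
  rewrite /e2 le_eqVlt; apply/orP; left; apply/eqP; field.
  by rewrite gt_eqF// ltr_wpDl.
have h5 := LB (D - s *: v).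
have h6 : B * `|D - s *: v| <= e / 2 * `|s|.
  apply: (@le_trans _ _ ((B + 1) * (e1 * `|s|))); first by apply: ler_pM => //; lra.
  rewrite /e1 le_eqVlt; apply/orP; left; apply/eqP; field.
  by rewrite gt_eqF//; lra.
move: h3 h4 h5 h6; clear; lra.
Qed.

Lemma dr_sum m (f : 'I_m -> R -> R) (df : 'I_m -> R) t :
  (forall i, is_derive t (1:R) (f i) (df i)) ->
  is_derive t (1:R) (fun s => \sum_i f i s) (\sum_i df i).
Proof.
move=> H; elim: (index_enum _) => [|i s IH].
  rewrite big_nil; under eq_fun do rewrite big_nil; exact: is_derive_cst.
rewrite big_cons; under eq_fun do rewrite big_cons; exact: is_deriveD.
Qed.

Lemma drM (f g : R -> R) df dg t : is_derive t (1:R) f df -> is_derive t (1:R) g dg ->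
  is_derive t (1:R) (fun s => f s * g s) (df * g t + f t * dg).
Proof.
move=> Hf Hg; have -> : df * g t + f t * dg = f t *: dg + g t *: df.
  by rewrite /GRing.scale/=; ring.
exact: is_deriveM.
Qed.

Lemma drZ (f : R -> R) k df t : is_derive t (1:R) f df -> is_derive t (1:R) (fun s => k * f s) (k * df).
Proof.
move=> H; rewrite -[k * df]add0r -[0](mul0r (f t)); exact: drM (is_derive_cst k t 1) H.
Qed.

Lemma dr_lin (m w t : R) : is_derive t (1:R) (fun s => m + s * w) w.
Proof.
apply/is_derive_epsP => e e0; exists 1 => // h _.
by rewrite (_ : _ - _ = 0) ?normr0 ?mulr_ge0 ?(ltW e0)//; ring.
Qed.

Lemma dr_expl (m w t : R) : is_derive t (1:R) (fun s => expR (m + s * w)) (w * expR (m + t * w)).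
Proof.
rewrite mulrC; apply: (@is_derive1_comp _ (@expR R) (fun s => m + s * w)); exact: dr_lin.
Qed.

Lemma dr_cosl (w t : R) : is_derive t (1:R) (fun s => cos (s * w)) (- w * sin (t * w)).
Proof.
rewrite mulNr -mulrN mulrC.
apply: (@is_derive1_comp _ (@cos R) (fun s => s * w)).
have := dr_lin 0 w t; congr is_derive; by apply/funext => s; rewrite add0r.
Qed.

Lemma dr_sinl (w t : R) : is_derive t (1:R) (fun s => sin (s * w)) (w * cos (t * w)).
Proof.
rewrite mulrC; apply: (@is_derive1_comp _ (@sin R) (fun s => s * w)).
have := dr_lin 0 w t; congr is_derive; by apply/funext => s; rewrite add0r.
Qed.

Lemma dr_unique (f : R -> R) a b t : is_derive t (1:R) f a -> is_derive t (1:R) f b -> a = b.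
Proof. by move=> [_ <-] [_ <-]. Qed.

(** The second derivative of h along a curve; the two conclusions are kept together
    because the second one differentiates the first. *)
Lemma chain_rule2 m (E : set 'rV[R]_m) (h : 'rV[R]_m -> R) (c c1 c2 : R -> 'rV[R]_m) :
  open E -> Ck 2 E h -> (forall t, E (c t)) ->
  (forall t i, is_derive t (1:R) (fun s => c s 0 i) (c1 t 0 i)) ->
  (forall t i, is_derive t (1:R) (fun s => c1 s 0 i) (c2 t 0 i)) ->
  (forall t, is_derive t (1:R) (fun s => h (c s)) (\sum_i c1 t 0 i * partial i h (c t))) /\
  (forall t, is_derive t (1:R) (fun s => \sum_i c1 s 0 i * partial i h (c s))
     (\sum_i (c2 t 0 i * partial i h (c t) +
       c1 t 0 i * \sum_k c1 t 0 k * partial k (partial i h) (c t)))).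
Proof.
move=> oE ch Ec d1 d2; split => t; first by apply: (chain_rule oE (CkW ch)).
apply: dr_sum => i; apply: drM => //.
by apply: (chain_rule oE _ (Ec t)) => //; exact: (ch.2 i).2.
Qed.

(** A function with positive second derivative lies strictly above its tangents. *)
Lemma strict_tangent_line (h h1 h2 : R -> R) : (forall t, is_derive t (1:R) h (h1 t)) ->
  (forall t, is_derive t (1:R) h1 (h2 t)) -> (forall t, 0 < h2 t) ->
  h 0 + h1 0 < h 1.
Proof.
move=> d1 d2 p.
have cw (f f1 : R -> R) a b : (forall t, is_derive t (1:R) f (f1 t)) -> {within `[a, b], continuous f}.
  move=> df; apply: continuous_subspaceT => t.
  apply: differentiable_continuous; apply/derivable1_diffP.
  exact: (@ex_derive _ _ _ _ _ _ _ (df t)).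
have [a] := @MVT R h h1 0 1 ltr01 (fun t _ => d1 t) (cw _ _ _ _ d1).
rewrite in_itv/= => /andP[a0 a1]; rewrite subr0 mulr1 => E1.
have [b] := @MVT R h1 h2 0 a a0 (fun t _ => d2 t) (cw _ _ _ _ d2).
move=> _; rewrite subr0 => E2.
have : 0 < h2 b * a by rewrite mulr_gt0.
lra.
Qed.
End curve.

(** * The Levi form in real coordinates *)

Section levi.
Context {R : realType}.
Variable n : nat.
Implicit Types (phi : 'rV[Cpx R]_n -> R) (z : 'rV[Cpx R]_n).

Lemma toCK t : ofC (toC t) = t :> 'rV[R]_(n + n).
Proof.
rewrite -[RHS]hsubmxK; congr row_mx; apply/rowP => j; rewrite !mxE.
  by [].
by [].
Qed.

Let Fr phi : 'rV[R]_(n + n) -> R := phi \o @toC R n.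

Lemma partial_cst m (i : 'I_m) (a : R) x : partial i (fun=> a) x = 0.
Proof. by rewrite /partial derive_cst. Qed.

Lemma partialZ m (i : 'I_m) (f : 'rV[R]_m -> R) (a : R) x : derivable f x (delta_mx 0 i) ->
  partial i (fun y => a * f y) x = a * partial i f x.
Proof. by move=> d; rewrite /partial (deriveZ a d). Qed.

Lemma partialC_real (k : 'I_(n + n)) phi z :
  partialC k (fun w => mkC (phi w) 0) z = mkC (partial k (Fr phi) (ofC z)) 0.
Proof. by rewrite /partialC; congr mkC; exact: partial_cst. Qed.

Lemma imaginaryE : 'i = mkC 0 1 :> Cpx R.
Proof. by rewrite -complexiE. Qed.

Lemma mkC_half (a b : R) : mkC a b / 2 = mkC (a / 2) (b / 2).
Proof.
have -> : (2 : Cpx R) = mkC 2 0.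
  by rewrite -[2]/(1 + 1 : Cpx R); apply: cpx_eqP; rewrite /reC /imC /= ?addr0//.
have n0 : mkC 2 0 != 0 :> Cpx R.
  by apply/eqP => /(congr1 (@reC R)); rewrite /reC /= => /eqP; rewrite pnatr_eq0.
apply: (mulIf n0); rewrite divfK//.
by apply: cpx_eqP; rewrite /reC /imC /=; field.
Qed.

Lemma half_diff_re (a b c d : R) : 
  reC ((mkC (2^-1 * a) b - 'i * mkC c (2^-1 * d)) / 2) = (a + d) / 4.
Proof.
rewrite imaginaryE (_ : _ - _ = mkC (2^-1 * a + 2^-1 * d) (b - c)).
  by rewrite mkC_half /reC /=; field.
by apply: cpx_eqP; rewrite /reC /imC /=; ring.
Qed.

Lemma dzbar_real (k : 'I_n) phi z :
  dzbar k (fun w => mkC (phi w) 0) z =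
  mkC (2^-1 * partial (lshift n k) (Fr phi) (ofC z)) (2^-1 * partial (rshift n k) (Fr phi) (ofC z)).
Proof.
rewrite /dzbar !partialC_real imaginaryE.
set A := partial _ _ _; set B := partial _ _ _.
rewrite (_ : _ + _ = mkC A B) ?mkC_half; first by congr mkC; rewrite mulrC.
by apply: cpx_eqP; rewrite /reC /imC /=; ring.
Qed.

(** The real part of the Levi form is a quarter of the sum of the second derivatives in
    the real and in the imaginary directions; the mixed ones are in the imaginary part. *)
Lemma levi_re phi z (E : set 'rV[R]_(n + n)) j k : Ck 2 E (Fr phi) -> E (ofC z) ->
  reC (levi phi z j k) =
    (partial (lshift n j) (partial (lshift n k) (Fr phi)) (ofC z) +
     partial (rshift n j) (partial (rshift n k) (Fr phi)) (ofC z)) / 4.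
Proof.
move=> [_ H] Ez; rewrite mxE /dz.
have dF i l : derivable (partial i (Fr phi)) (ofC z) (delta_mx 0 l) by apply: (((H i).2).2 l).1.
pose h (q : 'I_n -> 'I_(n + n)) t := 2^-1 * partial (q k) (Fr phi) t.
have E1 : @reC R \o dzbar k (fun w => mkC (phi w) 0) \o @toC R n = h (@lshift n n).
  by apply/funext => t; rewrite /comp dzbar_real toCK.
have E2 : @imC R \o dzbar k (fun w => mkC (phi w) 0) \o @toC R n = h (@rshift n n).
  by apply/funext => t; rewrite /comp dzbar_real toCK.
have P l : partialC l (dzbar k (fun w => mkC (phi w) 0)) z =
   mkC (2^-1 * partial l (partial (lshift n k) (Fr phi)) (ofC z))
       (2^-1 * partial l (partial (rshift n k) (Fr phi)) (ofC z)).
  by rewrite /partialC E1 E2 /h !partialZ.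
rewrite !P; exact: half_diff_re.
Qed.

Lemma reC_sum I (r : seq I) (P : pred I) (f : I -> Cpx R) :
  reC (\sum_(i <- r | P i) f i) = \sum_(i <- r | P i) reC (f i).
Proof. by apply: (big_morph (@reC R)) => // -[a b] [c d]. Qed.

(** On a real vector only the real part of a matrix contributes to the real part of the
    Hermitian form. *)
Lemma herm_re (v : 'rV[R]_n) (L : 'M[Cpx R]_n) :
  let vc : 'rV[Cpx R]_n := \row_j mkC (v 0 j) 0 in
  reC ((vc *m L *m Defs.conjmx vc) 0 0) = \sum_k \sum_j v 0 k * v 0 j * reC (L j k).
Proof.
move=> vc; rewrite mxE reC_sum; apply: eq_bigr => k _.
rewrite !mxE mulr_suml reC_sum; apply: eq_bigr => j _; rewrite !mxE.
rewrite conj_Creal; last by apply/complex_realP; exists (v 0 k).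
by case: (L j k) => a b; rewrite /reC /=; ring.
Qed.
End levi.

(** * Strict convexity and coercivity of the Kahler potential *)

Section sums.
Context {R : realType}.
Variables (n : nat) (a b d : 'I_(n + n) -> R) (H : 'I_(n + n) -> 'I_(n + n) -> R).
Hypothesis ar : forall j, a (rshift n j) = 0.

(** Second derivative along a curve whose velocity has only real components. *)
Lemma sum_left : (forall j, b (rshift n j) = 0) ->
  \sum_i (a i * d i + b i * \sum_k b k * H k i) =
  \sum_k a (lshift n k) * d (lshift n k) +
  \sum_k \sum_j b (lshift n k) * b (lshift n j) * H (lshift n j) (lshift n k).
Proof.
move=> br; rewrite big_split_ord /= [X in _ + X]big1 ?addr0; last first.
  by move=> j _; rewrite ar br !mul0r addr0.
rewrite big_split /=; congr (_ + _); apply: eq_bigr => k _.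
rewrite big_split_ord /= [X in _ + X]big1 ?addr0; last by move=> j _; rewrite br mul0r.
by rewrite mulr_sumr; apply: eq_bigr => j _; rewrite mulrA.
Qed.

(** Second derivative along a curve whose velocity has only imaginary components and
    whose acceleration is real. *)
Lemma sum_right : (forall j, b (lshift n j) = 0) ->
  \sum_i (a i * d i + b i * \sum_k b k * H k i) =
  \sum_k a (lshift n k) * d (lshift n k) +
  \sum_k \sum_j b (rshift n k) * b (rshift n j) * H (rshift n j) (rshift n k).
Proof.
move=> bl; rewrite big_split_ord /=; congr (_ + _); apply: eq_bigr => k _.
  by rewrite bl mul0r addr0.
rewrite ar mul0r add0r big_split_ord /= [X in X + _]big1 ?add0r; last by move=> j _; rewrite bl mul0r.
by rewrite mulr_sumr; apply: eq_bigr => j _; rewrite mulrA.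
Qed.
End sums.

Section strict.
Context {R : realType}.
Variables (n : nat) (M : topologicalType) (X : complex_structure R n M)
  (T : toric_structure X) (om : form11 R n M) (psiw : 'rV[R]_n -> R).
Hypothesis pot : is_potential om (open_orbit T) (@torus R n) (fun z => psiw (Relog z)).
Hypothesis kahler : kahler_form X om.

Let F (t : 'rV[R]_(n + n)) : R := psiw (Relog (toC t)).
Let E : set 'rV[R]_(n + n) := @toC R n @^-1` @torus R n.

Lemma Eopen : open E.
Proof.
apply: open_eps => t Et.
pose q (t : 'rV[R]_(n + n)) : R := \prod_j (t 0 (lshift n j) ^+ 2 + t 0 (rshift n j) ^+ 2).
have qt : 0 < q t.
  by apply: prodr_gt0 => j _; have := sqr_modulus_gt0 (Et j); rewrite mxE.
have cq : continuous_at t q.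
  apply: ct_prod => j; apply: ctD; apply: ctM; exact: ct_coord.
have [d d0 Hd] := (cont_epsP _ _).1 cq _ qt.
exists d => // y /Hd; rewrite ltr_norml => /andP[qy _].
have {}qy : q y != 0 by rewrite gt_eqF//; lra.
move=> j; apply/eqP; rewrite mxE => H; move/eqP: qy; apply.
rewrite /q (bigD1 j)//= (_ : _ + _ = 0) ?mul0r//.
have -> : y 0 (lshift n j) = 0 by have := congr1 (@reC R) H.
have -> : y 0 (rshift n j) = 0 by have := congr1 (@imC R) H.
by rewrite expr0n addr0.
Qed.

Let CF k : Ck k E F. Proof. by have [_ _ H _] := pot; exact: H. Qed.

Let pol (p q : 'rV[R]_n) : 'rV[R]_(n + n) := row_mx p q.

(** F depends on the moduli of the coordinates only. *)
Let FP (p th : 'rV[R]_n) : (forall j, 0 < p 0 j) ->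
  let t := pol (\row_j (p 0 j * cos (th 0 j))) (\row_j (p 0 j * sin (th 0 j))) in
  E t /\ F t = psiw (\row_j ln (p 0 j)).
Proof.
move=> p0 t.
have N j : reC (toC t 0 j) ^+ 2 + imC (toC t 0 j) ^+ 2 = p 0 j ^+ 2.
  rewrite mxE /reC /imC /= /t /pol row_mxEl row_mxEr !mxE !exprMn -mulrDr cos2Dsin2 mulr1//.
have Et : E t.
  move=> j; apply/eqP => H; have := N j; rewrite H /reC /imC /= expr0n addr0 => /eqP.
  by rewrite eq_sym sqrf_eq0 gt_eqF.
split=> //; rewrite /F; congr psiw; apply/rowP => j.
rewrite RelogE ln_modulus; last exact: Et.
by rewrite N lnXn// mxE -mulr_natr; field.
Qed.

(** e^m as a point of R^(n+n). *)
Let cexp (m : 'rV[R]_n) : 'rV[R]_(n + n) := pol (\row_j expR (m 0 j)) 0.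

Let FE m : E (cexp m) /\ F (cexp m) = psiw m.
Proof.
have [] := @FP (\row_j expR (m 0 j)) 0; first by move=> j; rewrite mxE expR_gt0.
rewrite (_ : pol _ _ = cexp m); last first.
  by congr row_mx; apply/rowP => j; rewrite !mxE ?cos0 ?mulr1// sin0 mulr0.
move=> Em ->; split=> //; congr psiw; apply/rowP => j; by rewrite !mxE expRK.
Qed.

Lemma psiw_cont : continuous psiw.
Proof.
move=> x; apply: (ct_eq (g := fun x => F (cexp x))); first by move=> y; rewrite (FE y).2.
apply: (ct_comp (f := cexp)); last exact: (CF 0).1 (FE x).1.
apply: ct_mx => i j; rewrite (ord1 i); case: (split_ordP j) => k ->.
  apply: (ct_eq (g := fun x : 'rV[R]_n => expR (x 0 k))); first by move=> y; rewrite row_mxEl mxE.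
  apply: (ct_comp (f := fun x : 'rV[R]_n => x 0 k)); first exact: ct_coord.
  exact: continuous_expR.
apply: (ct_eq (g := fun=> 0 : R)); first by move=> y; rewrite row_mxEr mxE.
exact: ct_cst.
Qed.

Let G (m : 'rV[R]_n) : 'rV[R]_n := \row_j (expR (m 0 j) * partial (lshift n j) F (cexp m)).

Let dr_pol (p q : R -> 'rV[R]_n) (dp dq : 'rV[R]_n) t :
  (forall j, is_derive t (1:R) (fun s => p s 0 j) (dp 0 j)) ->
  (forall j, is_derive t (1:R) (fun s => q s 0 j) (dq 0 j)) ->
  forall i, is_derive t (1:R) (fun s => pol (p s) (q s) 0 i) (pol dp dq 0 i).
Proof.
move=> Hp Hq i; case: (split_ordP i) => k ->.
  rewrite row_mxEl; have := Hp k; congr is_derive; by apply/funext => s; rewrite row_mxEl.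
rewrite row_mxEr; have := Hq k; congr is_derive; by apply/funext => s; rewrite row_mxEr.
Qed.

Let dr_row (f : 'I_n -> R -> R) (df : 'I_n -> R) t : (forall j, is_derive t (1:R) (f j) (df j)) ->
  forall j, is_derive t (1:R) (fun s => (\row_j f j s : 'rV[R]_n) 0 j) ((\row_j df j : 'rV[R]_n) 0 j).
Proof.
move=> H j; rewrite mxE; have := H j; congr is_derive; by apply/funext => s; rewrite mxE.
Qed.

Let lap (m v : 'rV[R]_n) : R := \sum_k \sum_j v 0 k * v 0 j *
  (partial (lshift n j) (partial (lshift n k) F) (cexp m) +
   partial (rshift n j) (partial (rshift n k) F) (cexp m)).

(** [lap m v] is four times the Kahler form at e^m on the real vector v. *)
Let lap_pos m v : v != 0 -> 0 < lap m v.
Proof.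
move=> v0.
pose vc : 'rV[Cpx R]_n := \row_j mkC (v 0 j) 0.
have vc0 : vc != 0.
  apply: contra v0 => /eqP H; apply/eqP/rowP => j.
  by have := congr1 (fun u : 'rV[Cpx R]_n => reC (u 0 j)) H; rewrite !mxE.
have tz : torus (toC (cexp m)) := (FE m).1.
have cz : crange (open_orbit T) (toC (cexp m)) by rewrite orbit_range.
have := kf_positive kahler (orbit_atlas T) cz vc0.
have [_ _ _ H] := pot; rewrite -H// ltcE => /andP[_ K0].
have K : 0 < \sum_k \sum_j v 0 k * v 0 j * reC (levi (fun z => psiw (Relog z)) (toC (cexp m)) j k).
  by have <- := herm_re v (levi (fun z => psiw (Relog z)) (toC (cexp m))); exact: K0.
have -> : lap m v = 4 * \sum_k \sum_j v 0 k * v 0 j * reC (levi (fun z => psiw (Relog z)) (toC (cexp m)) j k).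
  rewrite /lap mulr_sumr; apply: eq_bigr => k _; rewrite mulr_sumr; apply: eq_bigr => j _.
  have Em : E (ofC (toC (cexp m))) by rewrite toCK; exact: (FE m).1.
  have -> := @levi_re R n (fun z => psiw (Relog z)) (toC (cexp m)) E j k (CF 2) Em.
  rewrite toCK; move: (partial (lshift n j) _ _) (partial (rshift n j) _ _) => a b.
  by field.
by rewrite mulr_gt0.
Qed.

(** Along s |-> e^(m + s w) the second derivative of psi_om is the sum of a Hessian term and
    of a first order term that comes from the acceleration of the curve. Along
    t |-> e^(m + s w + i t w) the function is constant, so that its second derivative at t = 0
    vanishes; it contains the same first order term with the opposite sign. Adding
    the two leaves the Levi form on a real vector, which is positive. *)
Lemma strict_support (m : 'rV[R]_n) :
  exists g, forall w, w != 0 -> psiw m + dotv w g < psiw (m + w).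
Proof.
exists (G m) => w w0.
pose e s : 'rV[R]_n := \row_j expR (m 0 j + s * w 0 j).
pose c s := pol (e s) 0.
have cE s : c s = cexp (m + s *: w) by congr row_mx; apply/rowP => j; rewrite !mxE.
pose e1 s : 'rV[R]_n := \row_j (w 0 j * expR (m 0 j + s * w 0 j)).
pose e2 s : 'rV[R]_n := \row_j (w 0 j * (w 0 j * expR (m 0 j + s * w 0 j))).
have d0 t j : is_derive t (1:R) (fun s : R => (0 : 'rV[R]_n) 0 j) ((0 : 'rV[R]_n) 0 j).
  by rewrite mxE; exact: is_derive_cst.
have Ec s : E (c s) by rewrite cE; exact: (FE _).1.
have [D1 D2] := @chain_rule2 R _ E F c (fun s => pol (e1 s) 0) (fun s => pol (e2 s) 0)
  Eopen (CF 2) Ec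
  (fun t => dr_pol (p := e) (q := fun=> 0) (dp := e1 t) (dq := 0)
     (dr_row (fun j => dr_expl (m 0 j) (w 0 j) t)) (d0 t))
  (fun t => dr_pol (p := e1) (q := fun=> 0) (dp := e2 t) (dq := 0)
     (dr_row (fun j => drZ (w 0 j) (dr_expl (m 0 j) (w 0 j) t))) (d0 t)).
have H2 s : \sum_i (pol (e2 s) 0 0 i * partial i F (c s) +
       pol (e1 s) 0 0 i * \sum_k pol (e1 s) 0 0 k * partial k (partial i F) (c s)) =
    lap (m + s *: w) (e1 s).
  (* the orbit of the compact torus in the direction w, on which F is constant *)
  pose b t := pol (\row_j (e s 0 j * cos (t * w 0 j))) (\row_j (e s 0 j * sin (t * w 0 j))).
  pose b1 t := pol (\row_j (e s 0 j * (- w 0 j * sin (t * w 0 j)))) (\row_j (e s 0 j * (w 0 j * cos (t * w 0 j)))).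
  pose b2 t := pol (\row_j (e s 0 j * (- w 0 j * (w 0 j * cos (t * w 0 j)))))
    (\row_j (e s 0 j * (w 0 j * (- w 0 j * sin (t * w 0 j))))).
  have e0 j : 0 < e s 0 j by rewrite mxE expR_gt0.
  have FPb t : E (b t) /\ F (b t) = psiw (\row_j ln (e s 0 j)).
    have := @FP (e s) (t *: w) e0; congr (E _ /\ F _ = _);
      by congr row_mx; apply/rowP => j; rewrite !mxE.
  have [B1 B2] := @chain_rule2 R _ E F b b1 b2 Eopen (CF 2) (fun t => (FPb t).1)
    (fun t => dr_pol (dr_row (fun j => drZ (e s 0 j) (dr_cosl (w 0 j) t)))
       (dr_row (fun j => drZ (e s 0 j) (dr_sinl (w 0 j) t))))
    (fun t => dr_pol (dr_row (fun j => drZ (e s 0 j) (drZ (- w 0 j) (dr_sinl (w 0 j) t))))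
       (dr_row (fun j => drZ (e s 0 j) (drZ (w 0 j) (dr_cosl (w 0 j) t))))).
  have Z1 t : \sum_i b1 t 0 i * partial i F (b t) = 0.
    apply: (dr_unique (B1 t)).
    by rewrite (_ : (fun s => _) = cst (psiw (\row_j ln (e s 0 j)))); [exact: is_derive_cst|apply/funext => u; exact: (FPb u).2].
  have Z2 : \sum_i (b2 0 0 i * partial i F (b 0) +
       b1 0 0 i * \sum_k b1 0 0 k * partial k (partial i F) (b 0)) = 0.
    apply: (dr_unique (B2 0)).
    by rewrite (_ : (fun s => _) = cst 0); [exact: is_derive_cst|apply/funext => u; exact: Z1].
  have b0 : b 0 = c s.
    congr row_mx; apply/rowP => j; rewrite [LHS]mxE mul0r ?cos0 ?mulr1// sin0 mulr0 mxE//.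
  have P2 j : pol (e2 s) 0 0 (lshift n j) = w 0 j * e1 s 0 j by rewrite row_mxEl !mxE.
  have P1 j : pol (e1 s) 0 0 (lshift n j) = e1 s 0 j by rewrite row_mxEl.
  have P2r j : pol (e2 s) 0 0 (rshift n j) = 0 by rewrite row_mxEr mxE.
  have P1r j : pol (e1 s) 0 0 (rshift n j) = 0 by rewrite row_mxEr mxE.
  have Q2 j : b2 0 0 (lshift n j) = - (w 0 j * e1 s 0 j).
    by rewrite row_mxEl !mxE mul0r cos0; ring.
  have Q2r j : b2 0 0 (rshift n j) = 0 by rewrite row_mxEr !mxE mul0r sin0; ring.
  have Q1 j : b1 0 0 (lshift n j) = 0 by rewrite row_mxEl !mxE mul0r sin0; ring.
  have Q1r j : b1 0 0 (rshift n j) = e1 s 0 j by rewrite row_mxEr !mxE mul0r cos0; ring.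
  have S1 := sum_left (fun i => partial i F (c s)) (fun k i => partial k (partial i F) (c s)) P2r P1r.
  have S2 := sum_right (fun i => partial i F (b 0)) (fun k i => partial k (partial i F) (b 0)) Q2r Q1.
  rewrite Z2 in S2; rewrite b0 in S2.
  have S3 : \sum_k b2 0 0 (lshift n k) * partial (lshift n k) F (c s) =
     - \sum_k pol (e2 s) 0 0 (lshift n k) * partial (lshift n k) F (c s).
    by rewrite -sumrN; apply: eq_bigr => k _; rewrite Q2 P2 mulNr.
  rewrite S3 in S2; rewrite S1.
  have S4 : \sum_k pol (e2 s) 0 0 (lshift n k) * partial (lshift n k) F (c s) =
    \sum_k \sum_j b1 0 0 (rshift n k) * b1 0 0 (rshift n j) * partial (rshift n j) (partial (rshift n k) F) (c s).
    by move: S2 => /esym/eqP; rewrite addrC subr_eq0 => /eqP.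
  rewrite S4 /lap -cE -big_split; apply: eq_bigr => k _; rewrite -big_split; apply: eq_bigr => j _.
  rewrite (P1 k) (P1 j) (Q1r k) (Q1r j).
  rewrite mulrDr.
  exact: addrC.
have := strict_tangent_line D1 D2.
rewrite !cE !scale0r scale1r addr0 !(FE _).2 => K.
have -> : dotv w (G m) = \sum_i pol (e1 0) 0 0 i * partial i F (cexp m).
  rewrite big_split_ord /= [X in _ = _ + X]big1 ?addr0; last by move=> j _; rewrite row_mxEr mxE mul0r.
  by apply: eq_bigr => j _; rewrite row_mxEl !mxE mul0r addr0; ring.
apply: K => t; rewrite H2; apply: lap_pos.
apply: contra w0 => /eqP H; apply/eqP/rowP => j.
have /eqP := congr1 (fun u : 'rV[R]_n => u 0 j) H; rewrite !mxE mulf_eq0 => /orP[/eqP//|].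
by rewrite gt_eqF// expR_gt0.
Qed.

(** Subtract the supporting affine function at 0. The difference Phi is positive on the
    unit sphere, hence at least some c > 0 there. A supporting line at a point u of the
    sphere shows that Phi grows at least linearly along the ray of u. *)
Lemma psiw_coercive : exists g c C, 0 < c /\ forall x, dotv x g + c * `|x| - C <= psiw x.
Proof.
have [g Hg] := strict_support 0.
pose Phi x := psiw x - psiw 0 - dotv x g.
have Phi0 x : x != 0 -> 0 < Phi x by move=> /Hg; rewrite add0r /Phi; lra.
pose K := [set x : 'rV[R]_n | `|x| = 1].
have [c c0 Hc] : exists2 c, 0 < c & forall x, `|x| = 1 -> c <= Phi x.
  have [[x0 x01]|N] := pselect (exists x0, K x0); last first.
    by exists 1 => // x x1; exfalso; apply: N; exists x.
  have cK : compact K.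
    apply: (subclosed_compact _ (@ball0_compact R n 1)); last by move=> x /= ->.
    rewrite (_ : K = (fun x => `|x|) @^-1` [set 1]); last by [].
    apply: closed_comp; last exact: closed_eq.
    by move=> x _; apply: (ct_norm (f := id)); exact: ct_id.
  have uP : usc (fun x => - Phi x).
    move=> x a xa; have cP : continuous_at x (fun x => - Phi x).
      by apply: ctN; apply: ctB; [apply: ctB; [exact: psiw_cont|exact: ct_cst]|apply: ct_sum => i; apply: ctM; [exact: ct_coord|exact: ct_cst]].
    have [d d0 Hd] := (cont_epsP _ _).1 cP (a - - Phi x) ltac:(lra).
    by exists d => // y /Hd; rewrite ltr_norml => /andP[_]; lra.
  have [p Kp Hp] := usc_max cK x01 uP.
  exists (Phi p); first by apply: Phi0; rewrite -normr_eq0 Kp oner_eq0.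
  by move=> x /Hp; lra.
exists g, c, (c - psiw 0); split=> // x.
suff : c * `|x| - c <= Phi x by rewrite /Phi; lra.
have [x1|x1] := ltP `|x| 1.
  have : c * `|x| <= c by rewrite ler_piMr// ltW.
  have [->|/Phi0] := eqVneq x 0; last lra.
  by rewrite /Phi /dotv big1 ?subrr ?subr0 => [|i _]; [lra|rewrite mxE mul0r].
have xp : 0 < `|x| by lra.
pose u := `|x|^-1 *: x.
have u1 : `|u| = 1 by rewrite normrZ normfV normr_id mulVf// gt_eqF.
have u0 : u != 0 by rewrite -normr_eq0 u1 oner_eq0.
have xu : x = u + (`|x| - 1) *: u by rewrite scalerBl scale1r addrC subrK scalerA divff ?scale1r// gt_eqF.
have [h Hh] := strict_support u.
have h0 := Hh (- u); rewrite subrr oppr_eq0 -scaleN1r dotvZl in h0.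
have {}h0 := h0 u0.
have cu := Hc _ u1.
have ux : dotv x g = `|x| * dotv u g by rewrite -dotvZl scalerA divff ?scale1r// gt_eqF.
have Hx : psiw u + (`|x| - 1) * dotv u h <= psiw x.
  have [E1|E1] := eqVneq (`|x| - 1) 0.
    by rewrite {2}xu E1 scale0r addr0 mul0r addr0.
  have w0 : (`|x| - 1) *: u != 0 by rewrite scaler_eq0 negb_or E1.
  by have := ltW (Hh _ w0); rewrite -xu dotvZl.
have k1 : (`|x| - 1) * (psiw u - psiw 0) <= (`|x| - 1) * dotv u h by apply: ler_wpM2l; lra.
have k2 : `|x| * c <= `|x| * Phi u by apply: ler_wpM2l.
rewrite /Phi ux; move: k1 k2 Hx; rewrite /Phi; set N := `|x|; nra.
Qed.
End strict.

(** * The Legendre formula and the theorem *)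

Section final.
Context {R : realType}.
Variable n : nat.
Variables psi0 psi1 : 'rV[R]_n -> R.

Let fs sg (y : 'rV[R]_n) : \bar R := (Order.min (psi0 y) (psi1 y - sg))%:E.

Definition legendre_formula (s : R) (x : 'rV[R]_n) : \bar R :=
  ereal_sup [set (legendre (legendre (fun y => (Order.min (psi0 y) (psi1 y - sigma))%:E)) x
                     + (s * sigma)%:E)%E | sigma in [set: R]].

(** By definition of the Legendre transform as a supremum. *)
Lemma adm_legendre y a b : adm psi0 psi1 y a b <-> (legendre (fs (a - b)) y <= a%:E)%E.
Proof.
split=> [[A0 A1]|H].
  apply: ge_ereal_sup => _ [x _ <-]; rewrite /fs -EFinB lee_fin.
  rewrite lerBlDr addrC -lerBlDr le_min A0 /= lerBrDr; have := A1 x; lra.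
have K x : dotv x y - a <= Order.min (psi0 x) (psi1 x - (a - b)).
  have : ((dotv x y)%:E - fs (a - b) x <= a%:E)%E.
    by apply: le_trans H; apply: ereal_sup_ubound; exists x.
  rewrite /fs -EFinB lee_fin; lra.
split=> x; have := K x; rewrite le_min => /andP[]; lra.
Qed.

Lemma legendre_formula_ge y a b s x : adm psi0 psi1 y a b -> ((ell y a b s x)%:E <= legendre_formula s x)%E.
Proof.
move=> /adm_legendre A; apply: (@le_trans _ _ (legendre (legendre (fs (a - b))) x + (s * (a - b))%:E)%E); last first.
  by apply: ereal_sup_ubound; exists (a - b).
have -> : (ell y a b s x)%:E = ((dotv x y - a)%:E + (s * (a - b))%:E)%E.
  by rewrite -EFinD /ell; congr EFin; ring.
apply: leeD => //; apply: (@le_trans _ _ ((dotv y x)%:E - legendre (fs (a - b)) y)%E); last first.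
  by apply: ereal_sup_ubound; exists y.
by rewrite EFinB dotvC; apply: leeB.
Qed.

(** For fixed sigma and y, the smallest admissible a is the Legendre transform at y. If
    this is infinite, y does not contribute to the double transform. *)
Lemma legendre_formula_le s x (B : \bar R) : (forall y a b, adm psi0 psi1 y a b -> ((ell y a b s x)%:E <= B)%E) ->
  (legendre_formula s x <= B)%E.
Proof.
move=> H; apply: ge_ereal_sup => _ [sg _ <-].
rewrite -leeBrDr//; apply: ge_ereal_sup => _ [y _ <-].
rewrite leeBrDr//.
case E : (legendre (fs sg) y) => [A| |].
- have Aadm : adm psi0 psi1 y A (A - sg).
    by apply/adm_legendre; rewrite (_ : A - (A - sg) = sg) ?E//; ring.
  apply: le_trans (H _ _ _ Aadm); rewrite -EFinB -EFinD lee_fin /ell dotvC le_eqVlt.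
  by apply/orP; left; apply/eqP; ring.
- by rewrite /= leNye.
- have : ((dotv x y)%:E - fs sg x <= -oo)%E by rewrite -E; apply: ereal_sup_ubound; exists x.
  by [].
Qed.

Lemma envelope_legendre (psi : R -> 'rV[R]_n -> R) :
  envelope psi0 psi1 psi <-> (forall s x, 0 <= s <= 1 -> (psi s x)%:E = legendre_formula s x).
Proof.
split=> [H s x s01|H s x s01].
  have [H1 H2] := H s x s01; apply/eqP; rewrite eq_le; apply/andP; split.
    apply/lee_addgt0Pr => e e0; have [y [a [b [A lt_ell]]]] := H2 e e0.
    rewrite -leeBlDr//; apply: le_trans (legendre_formula_ge s x A).
    by rewrite -EFinB lee_fin ltW.
  by apply: legendre_formula_le => y a b A; rewrite lee_fin H1.
have E := H s x s01; split=> [y a b A|e e0].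
  by rewrite -lee_fin E; exact: legendre_formula_ge.
apply: contrapT => N.
have : (legendre_formula s x <= (psi s x - e)%:E)%E.
  apply: legendre_formula_le => y a b A; rewrite lee_fin leNgt; apply/negP => h; apply: N.
  by exists y, a, b.
by rewrite -E lee_fin; lra.
Qed.
End final.

Theorem proposition2p3 (R : realType) (n : nat) (M : topologicalType)
    (X : complex_structure R n M)
    (M_hausdorff : hausdorff_space M)
    (M_compact : compact [set: M])
    (M_connected : connected [set: M])
    (T : toric_structure X)
    (om : form11 R n M)
    (om_kahler : kahler_form X om)
    (om_invariant : invariant_form T om)
    (psiw : 'rV[R]_n -> R)
    (psiw_potential :
       is_potential om (open_orbit T) (@torus R n) (fun z => psiw (Relog z)))
    (v0 v1 : M -> R)
    (v0_bounded : [bounded v0 p | p in [set: M]])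
    (v1_bounded : [bounded v1 p | p in [set: M]])
    (v0_invariant : invariant_fun T v0)
    (v1_invariant : invariant_fun T v1)
    (v0_PSH : PSH X om (EFin \o v0))
    (v1_PSH : PSH X om (EFin \o v1))
    (psi : R -> 'rV[R]_n -> R) :
  let psi0 := log_potential T psiw v0 in
  let psi1 := log_potential T psiw v1 in
  HRMA_solution psiw psi0 psi1 psi <->
  (forall (s : R) (x : 'rV[R]_n), 0 <= s <= 1 ->
     (psi s x)%:E =
     ereal_sup [set (legendre (legendre
                       (fun y => (Order.min (psi0 y) (psi1 y - sigma))%:E)) x
                     + (s * sigma)%:E)%E | sigma in [set: R]]).
Proof.
move=> psi0 psi1.
have c0 : cvx setT psi0 := log_potential_cvx psiw_potential v0_invariant v0_PSH.
have c1 : cvx setT psi1 := log_potential_cvx psiw_potential v1_invariant v1_PSH.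
have cw := psiw_cont psiw_potential.
have bd (v : M -> R) : [bounded v p | p in [set: M]] ->
    exists2 C, 0 <= C & forall x, `|log_potential T psiw v x - psiw x| <= C.
  move=> [C [_ HC]]; exists (`|C| + 1) => [|x]; first by rewrite addr_ge0.
  rewrite /log_potential addrC addKr; apply: HC => //.
  by rewrite (le_lt_trans (ler_norm C))// ltrDl.
have [C0 C00 b0] := bd _ v0_bounded; have [C1 C10 b1] := bd _ v1_bounded.
have C01 : 0 <= C0 + C1 by rewrite addr_ge0.
have {}b0 x : `|psi0 x - psiw x| <= C0 + C1 by rewrite (le_trans (b0 x))// lerDl.
have {}b1 x : `|psi1 x - psiw x| <= C0 + C1 by rewrite (le_trans (b1 x))// lerDr.
have [g [c [C [cpos coer]]]] := psiw_coercive psiw_potential om_kahler.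
rewrite -[X in _ <-> X]/(forall s x, 0 <= s <= 1 -> (psi s x)%:E = legendre_formula psi0 psi1 s x) -envelope_legendre.
split; first exact: (solution_envelope cw b0 b1 c0 c1 cpos coer).
exact: (envelope_solution cw C01 b0 b1 c0 c1).
Qed.
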